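(* Let $n\ge 3$ be an integer, $m>1$, $1\le \alpha<m+2/n$, $\chi>0$, $M_0>0$. Let $u_0$ satisfy $u_0\ge 0$, $u_0\in L^1(\mathbb{R}^n;(1+|x|^2)dx)\cap L^\infty(\mathbb{R}^n)$, $\nabla u_0^m\in L^2(\mathbb{R}^n)$ and $m_0:=\int_{\mathbb{R}^n}u_0\,dx<M_0$. Then for any $T>0$ there exists a weak solution $u$ on $[0,T)$ of $$u_t=\Delta u^m+\chi u^\alpha\left(M_0-\int_{\mathbb{R}^n}u(x,t)\,dx\right),\quad x\in\mathbb{R}^n,\ t>0,\qquad u(x,0)=u_0(x).$$ Moreover, $u$ is uniformly bounded: there exists a constant $C=C(\|u_0\|_{L^1(\mathbb{R}^n)},\|u_0\|_{L^\infty(\mathbb{R}^n)},m,\alpha,n,\chi,m_0,M_0)$ (in particular independent of $T$) such that for all $1\le k\le\infty$ $$\sup_{0<t<T}\|u(\cdot,t)\|_{L^k(\mathbb{R}^n)}\le C.$$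
   Context: Weak solution: for $T\in(0,\infty]$, a non-negative function $u$ defined on $\mathbb{R}^n\times[0,T)$ is a weak solution of the Cauchy problem on $[0,T)$ if (i) $u\in L^\infty(0,T;L^1\cap L^\infty(\mathbb{R}^n))$ and $u^m\in L^2(0,T;H^1(\mathbb{R}^n))$; and (ii) for every continuously differentiable function $\varphi$ with compact support in $\mathbb{R}^n\times[0,T)$, $$\int_0^T\!\!\int_{\mathbb{R}^n}\nabla u^m\cdot\nabla\varphi\,dxdt-\chi\int_0^T\left(\int_{\mathbb{R}^n}u^\alpha\varphi\,dx\right)\left(M_0-\int_{\mathbb{R}^n}u\,dx\right)dt=\int_{\mathbb{R}^n}u_0(x)\varphi(x,0)\,dx+\int_0^T\!\!\int_{\mathbb{R}^n}u\,\varphi_t\,dxdt.$$ *)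

(* Defs.v *)
From HB Require Import structures.
From mathcomp Require Import all_boot all_order all_algebra.
From mathcomp Require Import all_classical all_reals all_analysis.

Set Implicit Arguments.
Unset Strict Implicit.
Unset Printing Implicit Defensive.

Import Order.TTheory GRing.Theory Num.Theory.
Import numFieldNormedType.Exports.

Local Open Scope classical_set_scope.
Local Open Scope ring_scope.

Definition measure_rV_display : measure_display -> measure_display.
Proof. exact. Qed.

(* As for [n.-tuple R] in the library, R^n carries the sigma-algebra generated
   by the coordinates, i.e. its Borel sigma-algebra. *)
Section measurable_rV.
Context (R : realType) (n : nat).

Let coord (i : 'I_n) (x : 'rV[R]_n) : R := x 0 i.

Let rV_set0 : g_sigma_preimage coord set0.
Proof. exact: sigma_algebra0. Qed.

Let rV_setC A : g_sigma_preimage coord A -> g_sigma_preimage coord (~` A).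
Proof. exact: sigma_algebraC. Qed.

Let rV_bigcup (F : (set 'rV[R]_n)^nat) :
  (forall i, g_sigma_preimage coord (F i)) ->
  g_sigma_preimage coord (\bigcup_i (F i)).
Proof. exact: sigma_algebra_bigcup. Qed.

HB.instance Definition _ := @isMeasurable.Build
  (measure_rV_display default_measure_display)
  'rV[R]_n (g_sigma_preimage coord) rV_set0 rV_setC rV_bigcup.

End measurable_rV.

Lemma measurable_coord (R : realType) n (i : 'I_n) :
  measurable_fun setT (fun x : 'rV[R]_n => x 0 i).
Proof.
move=> _ Y mY; rewrite setTI; apply: sub_sigma_algebra => /=.
rewrite -bigcup_seq/=; exists i => /=; first by rewrite mem_index_enum.
by exists Y => //; rewrite setTI.
Qed.

Lemma measurable_fun_rV d (T : measurableType d) (R : realType) n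
    (f : T -> 'rV[R]_n) :
  (forall i, measurable_fun setT (fun t => f t 0 i)) -> measurable_fun setT f.
Proof.
move=> mf _ A mA; rewrite setTI.
suff: g_sigma_preimage (fun i (x : 'rV[R]_n) => x 0 i) `<=`
    [set B | measurable (f @^-1` B)] by apply.
apply: smallest_sub.
  split=> [|B mB|F mF] /=.
  - by rewrite preimage_set0.
  - by rewrite setTD preimage_setC; exact: measurableC.
  - by rewrite preimage_bigcup; apply: bigcup_measurable => k _; exact: mF.
rewrite -bigcup_seq => B; case=> i _; case=> Y mY <- /=.
by rewrite setTI -comp_preimage -[X in measurable X]setTI; exact: mf.
Qed.

(* Lebesgue measure on R^n, as the iterated product of the one-dimensional
   Lebesgue measure transported along R x R^n -> R^(n+1). *)
Section lebesgue_rV.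
Context (R : realType).

Definition consv n (z : measurableTypeR R * 'rV[R]_n) : 'rV[R]_n.+1 :=
  \row_i (if unlift ord0 i is Some j then z.2 0 j else z.1).

Lemma measurable_consv n : measurable_fun setT (@consv n).
Proof.
apply: measurable_fun_rV => i; rewrite /consv.
case: (unliftP ord0 i) => [j ->|->].
  under eq_fun do rewrite mxE liftK.
  exact: (measurableT_comp (@measurable_coord R n j) measurable_snd).
under eq_fun do rewrite mxE unlift_none.
exact: measurable_fst.
Qed.

Definition unconsv n (x : 'rV[R]_n.+1) : measurableTypeR R * 'rV[R]_n :=
  (x 0 0, \row_j x 0 (lift ord0 j)).

Lemma consvK n : cancel (@consv n) (@unconsv n).
Proof.
move=> [t x]; rewrite /unconsv /consv !mxE unlift_none; congr pair.
by apply/rowP => j; rewrite !mxE liftK.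
Qed.

Lemma measurable_unconsv n : measurable_fun setT (@unconsv n).
Proof.
apply: measurable_fun_pair; first exact: measurable_coord.
apply: measurable_fun_rV => i; under eq_fun do rewrite mxE.
exact: measurable_coord.
Qed.

Section succ.
Context n (mu : {sigma_finite_measure set 'rV[R]_n -> \bar R}).

Definition lebesgue_rVS : set 'rV[R]_n.+1 -> \bar R :=
  pushforward (lebesgue_measure \x mu)%E (@consv n).

Let lebesgue_rVS0 : lebesgue_rVS set0 = 0%E.
Proof. by rewrite /lebesgue_rVS /pushforward preimage_set0 measure0. Qed.

Let lebesgue_rVS_ge0 A : (0 <= lebesgue_rVS A)%E.
Proof. by rewrite /lebesgue_rVS /pushforward; exact: measure_ge0. Qed.

Let lebesgue_rVS_sigma_additive : semi_sigma_additive lebesgue_rVS.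
Proof.
have mc := @measurable_consv n; exact: measure_semi_sigma_additive.
Qed.

HB.instance Definition _ := isMeasure.Build _ _ _ lebesgue_rVS
  lebesgue_rVS0 lebesgue_rVS_ge0 lebesgue_rVS_sigma_additive.

Let lebesgue_rVS_sigma_finite : sigma_finite setT lebesgue_rVS.
Proof.
have /sigma_finiteP[F [TF ndF Foo]] := sigma_finiteT (@lebesgue_measure R).
have /sigma_finiteP[G [TG ndG Goo]] := sigma_finiteT mu.
exists (fun k => @unconsv n @^-1` (F k `*` G k)) => [|k].
  rewrite -preimage_bigcup (_ : \bigcup_k _ = setT) ?preimage_setT//.
  rewrite -setXTT TF TG predeqE => -[x y]; split.
    by move=> [k _ []/= ? ?]; split; exists k.
  move=> [/= [k _ Fkx] [l _ Gly]]; exists (maxn k l) => //; split.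
  - by move: x Fkx; exact/subsetPset/ndF/leq_maxl.
  - by move: y Gly; exact/subsetPset/ndG/leq_maxr.
have [mF Fk] := Foo k; have [mG Gk] := Goo k.
have mFG : measurable (F k `*` G k) by exact: measurableX.
split; first by rewrite -[X in measurable X]setTI; exact: measurable_unconsv.
rewrite /lebesgue_rVS /pushforward -comp_preimage.
rewrite (_ : _ \o _ = idfun); last by apply/funext => z /=; rewrite consvK.
rewrite preimage_id product_measure1E//.
by rewrite lte_mul_pinfty// ge0_fin_numE.
Qed.

HB.instance Definition _ := Measure_isSigmaFinite.Build _ _ _ lebesgue_rVS
  lebesgue_rVS_sigma_finite.

End succ.

Fixpoint lebesgue_rV n : {sigma_finite_measure set 'rV[R]_n -> \bar R} :=
  if n is m.+1 then lebesgue_rVS (lebesgue_rV m) else \d_(0 : 'rV[R]_0).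

Lemma lebesgue_rV_box n (A : 'I_n -> set R) :
  (forall i, measurable (A i)) ->
  lebesgue_rV n [set x | forall i, A i (x 0 i)] =
  (\prod_(i < n) lebesgue_measure (A i))%E.
Proof.
elim: n A => [|n IHn] A mA.
  by rewrite big_ord0 /= diracE mem_set// => -[].
rewrite big_ord_recl -IHn//= /lebesgue_rVS /pushforward.
rewrite -product_measure1E; [|exact: mA|].
  congr (_ _); apply/seteqP; split => [[t x]|[t x]] /= H.
    split => [|i].
      by have := H ord0; rewrite mxE unlift_none.
    by have := H (lift ord0 i); rewrite mxE liftK.
  by case: H => At Ax i; rewrite mxE; case: (unliftP ord0 i) => [j|] ->.
rewrite [X in measurable X](_ : _ =
    \bigcap_(i in setT) [set x : 'rV[R]_n | A (lift ord0 i) (x 0 i)]).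
  apply: fin_bigcap_measurable => // i _.
  by rewrite -[X in measurable X]setTI; exact: measurable_coord.
by apply/seteqP; split => x Ax i; [move=> _|]; exact: Ax.
Qed.

End lebesgue_rV.

Section sobolev.
Context (R : realType) (n : nat).
Local Notation Rn := 'rV[R]_n.
Local Notation mu := (lebesgue_rV R n).

(* The library norm on ['rV[R]_n] is the sup norm. *)
Definition sqeucl (x : Rn) : R := \sum_i x 0 i ^+ 2.

Definition partial (i : 'I_n) (f : Rn -> R) (x : Rn) : R :=
  'D_(delta_mx 0 i) f x.

(* C_c^oo(R^n) *)
Definition smooth_test (psi : Rn -> R) :=
  (forall (vs : seq Rn) (x : Rn),
     differentiable (foldr (fun v f => 'D_v f : Rn -> R) psi vs) x) /\
  (exists K : set Rn, compact K /\ forall x, ~ K x -> psi x = 0).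

(* [g] is the distributional gradient of [f] *)
Definition weak_gradient (f : Rn -> R) (g : Rn -> Rn) :=
  forall psi, smooth_test psi -> forall i,
    \int[mu]_x (f x * partial i psi x) = - \int[mu]_x (g x 0 i * psi x).

Definition L2_vector (g : Rn -> Rn) :=
  forall i, (fun x => g x 0 i) \in Lfun mu 2%:E.

(* [f] is in H^1(R^n), with gradient [g] *)
Definition H1 (f : Rn -> R) (g : Rn -> Rn) :=
  [/\ f \in Lfun mu 2%:E, L2_vector g & weak_gradient f g].

Definition H1_norm2 (f : Rn -> R) (g : Rn -> Rn) : \bar R :=
  (\int[mu]_x (f x ^+ 2 + sqeucl (g x))%:E)%E.

Definition time (T : \bar R) : set R := [set t | 0 < t /\ (t%:E < T)%E].

Definition cylinder (T : \bar R) : set (measurableTypeR R * Rn) :=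
  [set z | time T z.1].

(* L^oo(0,T; L^1 /\ L^oo(R^n)) *)
Definition Linfty_L1Linfty (T : \bar R) (u : R -> Rn -> R) :=
  measurable_fun (cylinder T) (fun z => u z.1 z.2) /\
  exists M : R, \forall t \ae lebesgue_measure, time T t ->
    ('N[mu]_1 [EFin \o u t] <= M%:E)%E /\ ('N[mu]_+oo [EFin \o u t] <= M%:E)%E.

(* [v] is in L^2(0,T; H^1(R^n)), with spatial gradient [G] *)
Definition L2_H1 (T : \bar R) (v : R -> Rn -> R) (G : R -> Rn -> Rn) :=
  [/\ measurable_fun (cylinder T) (fun z => v z.1 z.2),
      measurable_fun (cylinder T) (fun z => G z.1 z.2),
      (\forall t \ae lebesgue_measure, time T t -> H1 (v t) (G t)) &
      (\int[lebesgue_measure]_(t in time T) H1_norm2 (v t) (G t) < +oo)%E].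

(* A C^1 function with compact support in R^n x [0,T), given as the restriction
   to t >= 0 of a C^1 function on the whole space-time: every such function
   extends, by zero past [T] and by reflection below t = 0.  Its values at
   times outside [0,T) play no role. *)
Definition C1_test (T : \bar R) (phi : R -> Rn -> R) :=
  let Phi := fun z : R * Rn => phi z.1 z.2 in
  [/\ forall z, differentiable Phi z,
      forall v, continuous ('D_v Phi : R * Rn -> R) &
      exists K : set (R * Rn), [/\ compact K,
        K `<=` [set z | 0 <= z.1 /\ (z.1%:E < T)%E] &
        forall z, 0 <= z.1 -> (z.1%:E < T)%E -> ~ K z -> Phi z = 0]].

(* Weak solution on [0,T) of the Cauchy problem
     u_t = Delta u^m + chi u^alpha (M0 - int u),  u(0) = u0;
   [G] is the spatial gradient of u^m. *)
Definition weak_solution (m alpha chi M0 : R) (u0 : Rn -> R) (T : \bar R)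
    (u : R -> Rn -> R) :=
  [/\ forall t x, 0 <= t -> (t%:E < T)%E -> 0 <= u t x,
      Linfty_L1Linfty T u &
      exists G : R -> Rn -> Rn,
        L2_H1 T (fun t x => u t x `^ m) G /\
        forall phi, C1_test T phi ->
          \int[lebesgue_measure]_(t in time T)
             (\int[mu]_x (\sum_i G t x 0 i * partial i (phi t) x))
          - chi * \int[lebesgue_measure]_(t in time T)
             ((\int[mu]_x (u t x `^ alpha * phi t x))
              * (M0 - \int[mu]_x u t x))
          = \int[mu]_x (u0 x * phi 0 x)
            + \int[lebesgue_measure]_(t in time T)
                (\int[mu]_x (u t x * derive1 (phi ^~ x) t))].

End sobolev.

(* Main.v *)
Require Import Defs.
From mathcomp Require Import all_boot all_order all_algebra.
From mathcomp Require Import all_classical all_reals all_analysis.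
From mathcomp Require Import measurable_realfun ess_sup_inf.
From mathcomp Require Import ring lra zify.

Set Implicit Arguments.
Unset Strict Implicit.
Unset Printing Implicit Defensive.

Import Order.TTheory GRing.Theory Num.Theory.
Import numFieldNormedType.Exports.

Local Open Scope classical_set_scope.
Local Open Scope ring_scope.

(* The solution is a limit of explicit finite-difference schemes on periodic
   grids of mesh [2^-p] in the box [-2^p, 2^p[^n, with time step proportional to
   [4^-p].  Under the CFL condition the scheme is monotone, keeps the mass below
   [M0] and, since the exponent condition [alpha < m + 2/n] makes the diffusion
   win at high levels, a De Giorgi iteration bounds it by a level [B] that does
   not depend on the time horizon; the norms of all orders follow from the mass
   and [B].

   Energy, time-translate and second-moment estimates make the approximations
   totally bounded in [L^1] of space-time: an approximation is determined up to a
   small [L^1] error by finitely many rounded values sampled on a coarser grid.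
   The discrete gradients of [u^m] are bounded in [L^2]; suitable convex
   combinations (iterated midpoints) of them converge strongly, and the weak
   formulation and the identity defining the weak gradient, being affine in the
   gradient, pass to those combinations. *)


(** * Difference calculus on a discrete torus *)

(** The level [B] comes from a balance of rates. Mass at most [M0] confines the part of the density
    above a multiple of [B] to a volume of order [M0 / B], hence to the length scale [s0] of order
    (M0 / B)^(1/n). Diffusion damps such a peak at a rate of order B^(m-1) / s0^2, reaction feeds it
    at a rate at most chi M0 B^(alpha-1); since alpha - 1 < m - 1 + 2/n, the first wins for large
    [B]. The mass bound holds at all times, so [B] does not see [T]. The Lipschitz bounds on the two
    powers are available on [[0, B]] only, so stability of the scheme and the bound depend on each
    other: the bound [B / 2] is recovered from the weaker bound [B], one time step after another.
    The diffusion degenerates where the density vanishes, so the energy controls increments of the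
    m-th power only; a modulus of continuity of the inverse power carries them over to the density
    itself. Periodicity removes boundary terms from summation by parts, and test functions, having
    compact support, do not reach the seam of the torus on fine grids. *)

Lemma sqr_sum_in_le (R : realFieldType) (I : finType) (A : {pred I})
    (a : I -> R) :
  (\sum_(i in A) a i) ^+ 2 <= #|A|%:R * \sum_(i in A) a i ^+ 2.
Proof.
have : 0 <= \sum_(i in A) \sum_(j in A) (a i - a j) ^+ 2.
  by apply: sumr_ge0 => i _; apply: sumr_ge0 => j _; exact: sqr_ge0.
have -> : \sum_(i in A) \sum_(j in A) (a i - a j) ^+ 2 =
    2 * (#|A|%:R * (\sum_(i in A) a i ^+ 2) - (\sum_(i in A) a i) ^+ 2).
  transitivity (\sum_(i in A) (#|A|%:R * a i ^+ 2 + (\sum_(j in A) a j ^+ 2)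
     - 2 * a i * \sum_(j in A) a j)).
    apply: eq_bigr => i _.
    transitivity (\sum_(j in A) (a i ^+ 2 + a j ^+ 2 - 2 * a i * a j)).
      by apply: eq_bigr => j _; ring.
    by rewrite sumrB big_split/= sumr_const -[_ *+ _]mulr_natl mulr_sumr.
  rewrite sumrB big_split/= -!mulr_sumr -mulr_suml.
  rewrite sumr_const -[_ *+ _]mulr_natl -mulr_sumr.
  by ring.
by rewrite pmulr_rge0// subr_ge0.
Qed.

Lemma sqr_sum_le (R : realFieldType) (I : finType) (a : I -> R) :
  (\sum_i a i) ^+ 2 <= #|I|%:R * \sum_i a i ^+ 2.
Proof. exact: (@sqr_sum_in_le _ _ predT). Qed.

Section torus.
Context (R : realType) (X : finZmodType) (n : nat) (e : 'I_n -> X).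
Implicit Types (f g v V : X -> R).

(** Differences are not divided by the mesh: its powers are carried by [kap], [tau] and [w], so a
    finite abelian group with chosen elements [e i] is all that is needed here. *)
Definition dif i f x := f (x + e i) - f x.

Definition lap f x := \sum_i (f (x + e i) + f (x - e i) - 2 * f x).

Definition dform f g := \sum_i \sum_x dif i f x * dif i g x.

Lemma sum_shift (a : X) f : \sum_x f (x + a) = \sum_x f x.
Proof. by rewrite [RHS](reindex_inj (addIr a)). Qed.

Lemma sum_lap f g : \sum_x lap f x * g x = - dform f g.
Proof.
rewrite /dform -sumrN /lap.
under eq_bigr do rewrite mulr_suml.
rewrite exchange_big/=; apply: eq_bigr => i _.
rewrite -[LHS]opprK; congr -%R; rewrite -sumrN.
(* At each point the two sides differ by [h (x - e i) - h x], whose sum over the group vanishes. *)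
pose h x := f (x + e i) * g (x + e i) - f x * g (x + e i).
have E : \sum_x (h (x - e i) - h x) = 0.
  by rewrite sumrB sum_shift subrr.
rewrite -[RHS]addr0 -[X in _ + X]E -big_split/=; apply: eq_bigr => x _.
by rewrite /h /dif addrNK; ring.
Qed.

Lemma sum_lapC f g : \sum_x lap f x * g x = \sum_x f x * lap g x.
Proof.
rewrite sum_lap; under [RHS]eq_bigr do rewrite mulrC.
rewrite sum_lap /dform; congr -%R; apply: eq_bigr => i _.
by apply: eq_bigr => x _; rewrite mulrC.
Qed.

Lemma sum_lap0 f : \sum_x lap f x = 0.
Proof.
have := sum_lap f (fun=> 1); under eq_bigr do rewrite mulr1.
move=> ->; rewrite /dform big1 ?oppr0// => i _; rewrite big1// => x _.
by rewrite /dif subrr mulr0.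
Qed.

Lemma dform_ge0 f : 0 <= dform f f.
Proof. by apply: sumr_ge0 => i _; apply: sumr_ge0 => x _; rewrite -expr2 sqr_ge0. Qed.

(** At [x], [lap f] is the sum over [i] of [dif i f x - dif i f (x - e i)]. The factor [4 * n] is
    the source of the one in the CFL condition [so_cfl]. *)
Lemma sum_sqr_lap f : \sum_x lap f x ^+ 2 <= 4 * n%:R * dform f f.
Proof.
have le1 x : lap f x ^+ 2 <=
    2 * n%:R * \sum_i (dif i f x ^+ 2 + dif i f (x - e i) ^+ 2).
  rewrite /lap; apply: le_trans (sqr_sum_le _) _.
  rewrite card_ord -[leRHS]mulrA [leRHS]mulrCA; apply: ler_wpM2l => //.
  rewrite mulr_sumr; apply: ler_sum => i _; rewrite /dif addrNK.
  set a := f _; set b := f _; set c := f _.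
  rewrite -subr_ge0 (_ : _ - _ = (a - b) ^+ 2); first exact: sqr_ge0.
  by ring.
apply: le_trans (ler_sum _ (fun x _ => le1 x)) _.
rewrite -mulr_sumr exchange_big/=.
rewrite (_ : \sum_(j < n) _ = 2 * dform f f); first by rewrite le_eqVlt; apply/orP; left; apply/eqP; ring.
rewrite /dform mulr_sumr; apply: eq_bigr => i _.
rewrite big_split/= (sum_shift (- e i) (fun x => dif i f x ^+ 2)).
by rewrite -[LHS]mulr2n -[LHS]mulr_natl; congr (_ * _); apply: eq_bigr => x _; rewrite expr2.
Qed.

Definition shiftn (a : X) f := \sum_x (f (x + a) - f x) ^+ 2.

Lemma shiftn_ge0 a f : 0 <= shiftn a f.
Proof. by apply: sumr_ge0 => x _; exact: sqr_ge0. Qed.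

Lemma shiftnN a f : shiftn (- a) f = shiftn a f.
Proof.
rewrite /shiftn -(sum_shift a); apply: eq_bigr => x _.
by rewrite addrK -sqrrN opprB.
Qed.

Lemma dform_shiftn f : dform f f = \sum_i shiftn (e i) f.
Proof. by apply: eq_bigr => i _; apply: eq_bigr => x _; rewrite -expr2. Qed.

(** The translation is walked along the partial sums [s k]; each leg has the norm of a single shift,
    and Cauchy-Schwarz over the [m] legs gives the factor. *)
Lemma shiftn_sum m (a : 'I_m -> X) f :
  shiftn (\sum_i a i) f <= m%:R * \sum_i shiftn (a i) f.
Proof.
pose s k : X := \sum_(i < m | (i < k)%N) a i.
have tel x : f (x + \sum_i a i) - f x =
    \sum_(i < m) (f (x + s i + a i) - f (x + s i)).
  have sS (i : 'I_m) : s i.+1 = s i + a i.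
    rewrite /s (bigD1 i)/= ?ltnS// addrC; congr (_ + _).
    by apply: eq_bigl => j; rewrite -val_eqE/=; lia.
  under [RHS]eq_bigr => i _ do rewrite -addrA -sS.
  rewrite -(big_mkord xpredT (fun k => f (x + s k.+1) - f (x + s k))).
  rewrite telescope_sumr//; congr (f (x + _) - f _).
    by rewrite /s; apply: eq_bigl => j; rewrite ltn_ord.
  by rewrite /s big_pred0 ?addr0.
rewrite /shiftn; under eq_bigr do rewrite tel.
apply: le_trans (ler_sum _ (fun x _ => sqr_sum_le _)) _.
rewrite card_ord -mulr_sumr; apply: ler_wpM2l => //.
rewrite exchange_big/=; apply: ler_sum => i _.
by rewrite -(sum_shift (s i) (fun x => (f (x + a i) - f x) ^+ 2)).
Qed.

Lemma shiftn_muln k a f : shiftn (a *+ k) f <= k%:R ^+ 2 * shiftn a f.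
Proof.
have := @shiftn_sum k (fun=> a) f.
by rewrite !sumr_const card_ord -[shiftn _ _ *+ _]mulr_natl mulrA -expr2.
Qed.

(* A lattice vector with coordinates [(-1)^b_i j_i]. *)
Definition latvec (j : 'I_n -> nat) (b : 'I_n -> bool) : X :=
  \sum_i (if b i then - (e i *+ j i) else e i *+ j i).

Lemma shiftn_latvec j b K f : (forall i, (j i <= K)%N) ->
  shiftn (latvec j b) f <= n%:R * K%:R ^+ 2 * dform f f.
Proof.
move=> jK; apply: le_trans (shiftn_sum _ _) _.
rewrite -mulrA; apply: ler_wpM2l => //.
rewrite dform_shiftn mulr_sumr; apply: ler_sum => i _.
apply: (@le_trans _ _ ((j i)%:R ^+ 2 * shiftn (e i) f)).
  by case: (b i); rewrite ?shiftnN; exact: shiftn_muln.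
apply: ler_wpM2r; first exact: shiftn_ge0.
by rewrite lerXn2r ?nnegrE// ler_nat.
Qed.

(* Compare [v] with its average over a box of side [K]: the average is small
   in sup norm since the support of [v] is small compared with the box. *)
Lemma faber_krahn K v : (0 < K)%N ->
  injective (fun j : {ffun 'I_n -> 'I_K} => \sum_i e i *+ j i) ->
  (forall x, 0 <= v x) ->
  (4 * #|[pred x | v x != 0%R]| <= K ^ n)%N ->
  \sum_x v x ^+ 2 <= 4 * n%:R * K%:R ^+ 2 * dform v v.
Proof.
move=> K0 inj v0 supp.
pose J : finType := {ffun 'I_n -> 'I_K}.
pose sh (j : J) : X := \sum_i e i *+ j i.
have cJ : #|{: J}| = (K ^ n)%N by rewrite card_ffun !card_ord.
pose k : R := (K ^ n)%:R.
have k0 : 0 < k by rewrite ltr0n expn_gt0 K0.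
pose av x := k^-1 * \sum_(j : J) v (x + sh j).
have av0 x : 0 <= av x.
  by rewrite mulr_ge0 ?invr_ge0 ?(ltW k0)//; apply: sumr_ge0.
have avle x : av x <= k^-1 * \sum_y v y.
  apply: ler_wpM2l; first by rewrite invr_ge0 (ltW k0).
  rewrite -(sum_shift x v).
  under [leRHS]eq_bigr do rewrite addrC.
  have -> : \sum_(j : J) v (x + sh j) = \sum_(y in [set sh j | j : J]) v (x + y).
    by rewrite big_imset//= => j1 j2 _ _; exact: inj.
  rewrite [leRHS](bigID (mem [set sh j | j : J]))/= lerDl.
  exact: sumr_ge0.
have avsum : \sum_x av x = \sum_x v x.
  rewrite -mulr_sumr exchange_big/=.
  under eq_bigr do rewrite sum_shift.
  by rewrite sumr_const cJ -mulr_natl mulrA mulVf ?mul1r// gt_eqF.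
have sv0 : 0 <= \sum_x v x by apply: sumr_ge0.
(* An average is at most the total sum divided by [k], and [avsum] keeps the total; Cauchy-Schwarz
   on the support, of size at most [k / 4], then gives the quarter. *)
have av2 : \sum_x av x ^+ 2 <= 4^-1 * \sum_x v x ^+ 2.
  apply: (@le_trans _ _ (k^-1 * (\sum_y v y) ^+ 2)).
    rewrite expr2 mulrA -[X in _ * X]avsum mulr_sumr.
    by apply: ler_sum => x _; rewrite expr2; apply: ler_wpM2r.
  pose A := [pred x | v x != 0].
  have vA x : x \notin A -> v x = 0 by move=> /negPn/eqP.
  have -> : \sum_y v y = \sum_(y in A) v y.
    by rewrite (bigID A)/= [X in _ + X]big1 ?addr0// => x /vA.
  have -> : \sum_y v y ^+ 2 = \sum_(y in A) v y ^+ 2.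
    by rewrite (bigID A)/= [X in _ + X]big1 ?addr0// => x /vA ->; rewrite expr0n.
  rewrite ler_pdivrMl//; apply: le_trans (sqr_sum_in_le _ _) _.
  rewrite mulrA; apply: ler_wpM2r; first by apply: sumr_ge0 => x _; exact: sqr_ge0.
  by rewrite ler_pdivlMr// mulrC -natrM ler_nat.
have diff2 : \sum_x (av x - v x) ^+ 2 <= n%:R * K%:R ^+ 2 * dform v v.
  have le1 x : (av x - v x) ^+ 2 <= k^-1 * \sum_(j : J) (v (x + sh j) - v x) ^+ 2.
    have -> : av x - v x = k^-1 * \sum_(j : J) (v (x + sh j) - v x).
      rewrite sumrB sumr_const cJ -[v x *+ _]mulr_natl mulrBr mulrA mulVf ?gt_eqF//.
      by rewrite mul1r.
    rewrite exprMn expr2 -mulrA; apply: ler_wpM2l; first by rewrite invr_ge0 (ltW k0).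
    rewrite ler_pdivrMl// /k -cJ; exact: sqr_sum_le.
  apply: le_trans (ler_sum _ (fun x _ => le1 x)) _.
  rewrite -mulr_sumr exchange_big/= ler_pdivrMl//.
  apply: (@le_trans _ _ (\sum_(j : J) n%:R * K%:R ^+ 2 * dform v v)); last first.
    by rewrite sumr_const cJ -[X in X <= _]mulr_natl.
  apply: ler_sum => j _.
  have -> : sh j = latvec (fun i => j i) (fun=> false) by [].
  by apply: shiftn_latvec => i; exact/ltnW.
(* By [av2] the second term on the right is at most half of the left-hand side and is absorbed. *)
have : \sum_x v x ^+ 2 <= 2 * \sum_x (av x - v x) ^+ 2 + 2 * \sum_x av x ^+ 2.
  rewrite !mulr_sumr -big_split/=; apply: ler_sum => x _.
  rewrite -subr_ge0 (_ : _ - _ = (2 * av x - v x) ^+ 2); first exact: sqr_ge0.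
  by ring.
lra.
Qed.

End torus.

(** * The explicit scheme *)

(** [phi] and [psi] stand for the powers of exponents [m] and [alpha], [kap] for the time step over
    the squared mesh, [w] for the volume of a cell. [Lp] and [P1] control the powers on [[0, B]]
    only. Under [so_tau_small], reaction adds to a value at most half of itself per step. *)
Record scheme_ok (R : realType) (n : nat) (phi psi : R -> R)
    (B Lp P1 kap tau chi M0 w : R) : Prop := SchemeOk {
  so_phi0 : phi 0 = 0;
  so_phi_mono : forall a b, 0 <= a -> a <= b -> phi a <= phi b;
  so_phi_lip : forall a b, 0 <= a -> a <= b -> b <= B ->
    phi b - phi a <= Lp * (b - a);
  so_psi_ge0 : forall a, 0 <= a -> 0 <= psi a;
  so_psi_le : forall a, 0 <= a -> a <= B -> psi a <= P1 * a;
  so_B_gt0 : 0 < B; so_Lp_gt0 : 0 < Lp; so_P1_ge0 : 0 <= P1;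
  so_kap_gt0 : 0 < kap; so_tau_gt0 : 0 < tau; so_chi_gt0 : 0 < chi;
  so_M0_gt0 : 0 < M0; so_w_gt0 : 0 < w;
  so_cfl : 4 * n%:R * kap * Lp <= 1;
  so_tau_small : tau * chi * M0 * P1 <= 2^-1 }.

Section scheme.
Context (R : realType) (X : finZmodType) (n : nat) (e : 'I_n -> X).
Variables (phi psi : R -> R) (B Lp P1 kap tau chi M0 w : R).
Hypothesis ok : scheme_ok n phi psi B Lp P1 kap tau chi M0 w.
Let phi0 := so_phi0 ok.
Let phi_mono := so_phi_mono ok.
Let phi_lip := so_phi_lip ok.
Let psi_ge0 := so_psi_ge0 ok.
Let psi_le := so_psi_le ok.
Let B_gt0 := so_B_gt0 ok.
Let Lp_gt0 := so_Lp_gt0 ok.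
Let P1_ge0 := so_P1_ge0 ok.
Let kap_gt0 := so_kap_gt0 ok.
Let tau_gt0 := so_tau_gt0 ok.
Let chi_gt0 := so_chi_gt0 ok.
Let M0_gt0 := so_M0_gt0 ok.
Let w_gt0 := so_w_gt0 ok.
Let cfl := so_cfl ok.
Let tau_small := so_tau_small ok.
Implicit Types (U v : X -> R).

Definition rate U := chi * (M0 - w * \sum_x U x).
Definition diffuse U x := U x + kap * lap e (phi \o U) x.
Definition step U x := diffuse U x + tau * (rate U * psi (U x)).

Let phi_ge0 a : 0 <= a -> 0 <= phi a.
Proof. by move=> a0; rewrite -phi0; exact: phi_mono. Qed.

Let nkL : 2 * n%:R * kap * Lp <= 1.
Proof.
apply: le_trans cfl; rewrite !ler_wpM2r ?(ltW kap_gt0) ?(ltW Lp_gt0)//.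
by rewrite ler_nat.
Qed.

Lemma sum_const_ord (c : R) : \sum_(i < n) c = n%:R * c.
Proof. by rewrite sumr_const card_ord mulr_natl. Qed.

(** The neighbours contribute nonnegatively, and CFL keeps the outflow [2 * n * kap * phi (U x)]
    below [U x]. *)
Lemma diffuse_ge0 U x : (forall y, 0 <= U y <= B) -> 0 <= diffuse U x.
Proof.
move=> UB; have /andP[u0 uB] := UB x.
have : - (2 * n%:R * phi (U x)) <= lap e (phi \o U) x.
  rewrite /lap /= (_ : - _ = \sum_(i < n) - (2 * phi (U x))); last first.
    by rewrite sum_const_ord; ring.
  apply: ler_sum => i _; rewrite lerDr addr_ge0//; apply: phi_ge0.
    by have /andP[] := UB (x + e i).
  by have /andP[] := UB (x - e i).
have := phi_lip (lexx 0) u0 uB; rewrite phi0 !subr0 => pl.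
move=> /(ler_wpM2l (ltW kap_gt0)) h; rewrite /diffuse.
have : kap * (2 * n%:R * phi (U x)) <= U x.
  apply: (@le_trans _ _ (kap * (2 * n%:R * (Lp * U x)))).
    by rewrite !ler_wpM2l// ?(ltW kap_gt0)// mulr_ge0.
  rewrite (_ : _ * _ = (2 * n%:R * kap * Lp) * U x); last by ring.
  exact: ler_piMl.
lra.
Qed.

(** The maximum principle: CFL now bounds the inflow by the gap [c - U x]. *)
Lemma diffuse_le U c x : 0 <= c -> c <= B ->
  (forall y, 0 <= U y <= c) -> diffuse U x <= c.
Proof.
move=> c0 cB UB; have /andP[u0 uB] := UB x.
have : lap e (phi \o U) x <= 2 * n%:R * (phi c - phi (U x)).
  rewrite /lap /= (_ : 2 * _ * _ = \sum_(i < n) (phi c + phi c - 2 * phi (U x))).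
    apply: ler_sum => i _; rewrite lerD2r lerD//.
      by have /andP[? ?] := UB (x + e i); exact: phi_mono.
    by have /andP[? ?] := UB (x - e i); exact: phi_mono.
  by rewrite sum_const_ord; ring.
have pl := phi_lip u0 uB cB.
move=> /(ler_wpM2l (ltW kap_gt0)) h; rewrite /diffuse.
have : kap * (2 * n%:R * (phi c - phi (U x))) <= c - U x.
  apply: (@le_trans _ _ (kap * (2 * n%:R * (Lp * (c - U x))))).
    by rewrite !ler_wpM2l// ?(ltW kap_gt0)// mulr_ge0.
  rewrite (_ : _ * _ = (2 * n%:R * kap * Lp) * (c - U x)); last by ring.
  by apply: ler_piMl; rewrite // subr_ge0.
lra.
Qed.

Lemma sum_diffuse U : \sum_x diffuse U x = \sum_x U x.
Proof. by rewrite big_split/= -mulr_sumr sum_lap0 mulr0 addr0. Qed.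

Lemma dform_prod_ge (l D : R) (v : X -> R) :
  (forall a b, l <= a -> a <= b -> b <= B -> D * (b - a) <= phi b - phi a) ->
  (forall x, 0 <= v x /\ l + v x <= B) ->
  D * dform e v v <= dform e v (fun x => phi (l + v x)).
Proof.
move=> phiD vB; rewrite /dform mulr_sumr; apply: ler_sum => i _.
rewrite mulr_sumr; apply: ler_sum => x _; rewrite /dif.
have [v1 v1B] := vB x; have [v2 v2B] := vB (x + e i).
move: (v x) (v (x + e i)) v1 v1B v2 v2B => a b a0 aB b0 bB.
have [ab|ba] := leP a b.
  have := @phiD (l + a) (l + b); rewrite lerDl a0 lerD2l => /(_ isT ab bB).
  move=> h; rewrite mulrCA; apply: ler_wpM2l; first by rewrite subr_ge0.
  by move: h; rewrite opprD addrACA subrr add0r.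
have := @phiD (l + b) (l + a); rewrite lerDl b0 lerD2l (ltW ba) => /(_ isT isT aB).
move=> h; rewrite mulrCA -[leRHS]mulrNN; rewrite -[leLHS]mulrNN.
apply: ler_wpM2l; first by rewrite oppr_ge0 subr_le0 ltW.
by move: h; rewrite opprD addrACA subrr add0r -!mulrN !opprB.
Qed.

(** On each edge the increments of [v] and of [V] have the same sign, and that of [V] is at most
    [Lp] times that of [v]. *)
Lemma dform_prod_lip (l : R) (v : X -> R) : 0 <= l ->
  (forall x, 0 <= v x /\ l + v x <= B) ->
  let V x := phi (l + v x) in is_true (dform e V V <= Lp * dform e v V).
Proof.
move=> l0 vB V; rewrite /dform mulr_sumr; apply: ler_sum => i _.
rewrite mulr_sumr; apply: ler_sum => x _; rewrite /dif /V.
have [v1 v1B] := vB x; have [v2 v2B] := vB (x + e i).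
move: (v x) (v (x + e i)) v1 v1B v2 v2B => a b a0 aB b0 bB.
rewrite mulrA.
have [ab|ba] := leP a b.
  have ab' : l + a <= l + b by rewrite lerD2l.
  apply: ler_wpM2r; first by rewrite subr_ge0 phi_mono// addr_ge0.
  have := phi_lip (addr_ge0 l0 a0) ab' bB.
  by rewrite opprD addrACA subrr add0r.
have ba' : l + b <= l + a by rewrite lerD2l ltW.
rewrite -[leLHS]mulrNN -[leRHS]mulrNN.
apply: ler_wpM2r; first by rewrite oppr_ge0 subr_le0 phi_mono// addr_ge0.
have := phi_lip (addr_ge0 l0 b0) ba' aB.
by rewrite opprD addrACA subrr add0r -mulrN !opprB.
Qed.

(** Expanding the square gives the dissipation [- 2 * kap * dform e v V] and a quadratic error;
    [sum_sqr_lap], [dform_prod_lip] and CFL bound the error by half of the dissipation. *)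
Lemma diffuse_energy (l : R) (v : X -> R) : 0 <= l ->
  (forall x, 0 <= v x /\ l + v x <= B) ->
  let V x := phi (l + v x) in
  is_true (\sum_x (v x + kap * lap e V x) ^+ 2 <=
    \sum_x v x ^+ 2 - kap * dform e v V).
Proof.
move=> l0 vB V; have lip : dform e V V <= Lp * dform e v V by exact: dform_prod_lip.
have -> : \sum_x (v x + kap * lap e V x) ^+ 2 =
  \sum_x v x ^+ 2 + 2 * kap * (\sum_x lap e V x * v x)
   + kap ^+ 2 * \sum_x lap e V x ^+ 2.
  by rewrite !mulr_sumr -!big_split/=; apply: eq_bigr => x _; ring.
rewrite sum_lap (_ : dform e V v = dform e v V); last first.
  by apply: eq_bigr => i _; apply: eq_bigr => x _; rewrite mulrC.
have sl := sum_sqr_lap e V.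
have d0 : 0 <= dform e v V.
  by rewrite -(pmulr_rge0 _ Lp_gt0); apply: le_trans lip; exact: dform_ge0.
have : kap ^+ 2 * (\sum_x lap e V x ^+ 2) <= kap * dform e v V.
  apply: (@le_trans _ _ (kap ^+ 2 * (4 * n%:R * (Lp * dform e v V)))).
    apply: ler_wpM2l; first exact: sqr_ge0.
    by apply: le_trans sl _; apply: ler_wpM2l => //; rewrite mulr_ge0.
  rewrite (_ : _ * _ = (4 * n%:R * kap * Lp) * (kap * dform e v V)); last by ring.
  by apply: ler_piMl => //; rewrite mulr_ge0// ltW.
lra.
Qed.

Definition pos (l a : R) := Num.max (a - l) 0.

Lemma pos_ge0 l a : 0 <= pos l a. Proof. by rewrite /pos le_max lexx orbT. Qed.

Lemma pos_le l a b : a <= b -> pos l a <= pos l b.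
Proof. by move=> ab; rewrite /pos ge_max le_max lerD2r ab/= le_max lexx orbT. Qed.

(* Below level [l] the solution is raised to [l]; by monotonicity of the scheme
   this only increases [diffuse U]. *)
Lemma pos_diffuse_le l U x : 0 <= l -> (forall y, 0 <= U y <= B) -> l <= B ->
  pos l (diffuse U x) <=
  `|pos l (U x) + kap * lap e (fun y => phi (l + pos l (U y))) x|.
Proof.
move=> l0 UB lB; set V := fun y => _.
have UV y : phi (U y) <= V y.
  have /andP[u0 _] := UB y; apply: phi_mono => //.
  by rewrite /pos addr_maxr addr0 subrKC le_max lexx.
rewrite {1}/pos ge_max normr_ge0 andbT; apply: le_trans (ler_norm _).
rewrite /diffuse.
have lapV c : c <= U x - V x * (2 * n%:R * kap) ->
   c <= U x + kap * (\sum_i (V (x + e i) + V (x - e i) - 2 * V x)).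
  move=> h; apply: le_trans h _; rewrite lerD2l.
  have Vge0 y : 0 <= V y.
    by have /andP[u0 _] := UB y; apply: le_trans (UV y); exact: phi_ge0.
  apply: (@le_trans _ _ (kap * \sum_(i < n) - (2 * V x))).
    by rewrite sum_const_ord le_eqVlt; apply/orP; left; apply/eqP; ring.
  apply: ler_wpM2l; first exact: ltW.
  by apply: ler_sum => i _; rewrite lerDr addr_ge0.
have lapUV : lap e (phi \o U) x + 2 * n%:R * phi (U x) <=
    lap e V x + 2 * n%:R * V x.
  rewrite /lap.
  rewrite (_ : 2 * n%:R * phi (U x) = \sum_(i < n) 2 * phi (U x)); last first.
    by rewrite sum_const_ord; ring.
  rewrite (_ : 2 * n%:R * V x = \sum_(i < n) 2 * V x); last first.
    by rewrite sum_const_ord; ring.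
  rewrite -!big_split/=; apply: ler_sum => i _.
  by rewrite !subrK lerD.
move: lapUV => /(ler_wpM2l (ltW kap_gt0)) lapUV.
have [lU|Ul] := leP l (U x).
  have pE : pos l (U x) = U x - l by rewrite /pos; apply/max_idPl; rewrite subr_ge0.
  have VE : V x = phi (U x) by rewrite /V pE subrKC.
  rewrite pE; move: lapUV; rewrite VE; lra.
(* Below the level, the gap [l - U x] pays, by CFL, for raising the central value from [phi (U x)]
   to [phi l]. *)
have pE : pos l (U x) = 0 by rewrite /pos; apply/max_idPr; rewrite subr_le0 ltW.
have VE : V x = phi l by rewrite /V pE addr0.
rewrite pE; move: lapUV; rewrite VE.
have /andP[u0 _] := UB x.
have := phi_lip u0 (ltW Ul) lB.
move=> h lapUV.
have : kap * (2 * n%:R * (phi l - phi (U x))) <= l - U x.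
  apply: (@le_trans _ _ (kap * (2 * n%:R * (Lp * (l - U x))))).
    by rewrite !ler_wpM2l// ?(ltW kap_gt0)// mulr_ge0.
  rewrite (_ : _ * _ = (2 * n%:R * kap * Lp) * (l - U x)); last by ring.
  by apply: ler_piMl; rewrite // subr_ge0 ltW.
lra.
Qed.

(** Above the level [l], where [phi] has slope at least [D], the diffusion is no longer degenerate
    and its dissipation controls the full quadratic form of the truncation. *)
Lemma trunc_energy l D U : 0 <= l -> l <= B -> (forall y, 0 <= U y <= B) ->
  (forall a b, l <= a -> a <= b -> b <= B -> D * (b - a) <= phi b - phi a) ->
  \sum_x pos l (diffuse U x) ^+ 2 <=
  \sum_x pos l (U x) ^+ 2 - kap * D * dform e (pos l \o U) (pos l \o U).
Proof.
move=> l0 lB UB phiD.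
have vB x : 0 <= pos l (U x) /\ l + pos l (U x) <= B.
  split; first exact: pos_ge0.
  by have /andP[_ ?] := UB x; rewrite /pos addr_maxr addr0 subrKC ge_max lB andbT.
apply: (@le_trans _ _ (\sum_x
   (pos l (U x) + kap * lap e (fun y => phi (l + pos l (U y))) x) ^+ 2)).
  apply: ler_sum => x _; rewrite -[leRHS]real_normK ?num_real//.
  by rewrite lerXn2r ?nnegrE ?pos_ge0//; exact: pos_diffuse_le.
apply: le_trans (diffuse_energy l0 vB) _.
rewrite lerD2l lerN2 -mulrA; apply: ler_wpM2l; first exact: ltW.
exact: dform_prod_ge.
Qed.

Lemma rate_bounds U : (forall x, 0 <= U x) -> w * \sum_x U x <= M0 ->
  0 <= rate U <= chi * M0.
Proof.
move=> U0 UM; rewrite /rate mulr_ge0/= ?(ltW chi_gt0) ?subr_ge0//.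
rewrite ler_wpM2l ?(ltW chi_gt0)// lerBlDr lerDl mulr_ge0 ?(ltW w_gt0)//.
by apply: sumr_ge0.
Qed.

Lemma step_ge0 U x : (forall x, 0 <= U x <= B) -> w * \sum_x U x <= M0 ->
  0 <= step U x.
Proof.
move=> UB UM; rewrite addr_ge0 ?diffuse_ge0//.
have U0 y : 0 <= U y by have /andP[] := UB y.
have /andP[r0 _] := rate_bounds U0 UM.
by rewrite mulr_ge0 ?(ltW tau_gt0)// mulr_ge0// psi_ge0.
Qed.

(** Reaction closes at most the fraction [tau * chi * P1 * M0], itself at most one half, of the gap
    between the mass and [M0], so the mass cannot overshoot. *)
Lemma step_mass U : (forall x, 0 <= U x <= B) -> w * \sum_x U x <= M0 ->
  w * \sum_x step U x <= M0.
Proof.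
move=> UB UM; rewrite big_split/= sum_diffuse -!mulr_sumr.
have U0 y : 0 <= U y by have /andP[] := UB y.
have psiP : w * \sum_x psi (U x) <= P1 * M0.
  apply: (@le_trans _ _ (P1 * (w * \sum_x U x))); last exact: ler_wpM2l.
  rewrite mulrCA; apply: ler_wpM2l; first exact: ltW.
  by rewrite mulr_sumr; apply: ler_sum => x _; have /andP[] := UB x; exact: psi_le.
have d0 : 0 <= M0 - w * \sum_x U x by rewrite subr_ge0.
rewrite mulrDr -lerBrDl.
rewrite (_ : w * _ = (M0 - w * \sum_x U x) * (tau * chi * (w * \sum_x psi (U x)))).
  apply: ler_piMr => //; apply: (@le_trans _ _ (tau * chi * (P1 * M0))).
    by apply: ler_wpM2l => //; rewrite mulr_ge0 ?ltW.
  rewrite mulrA [X in X <= _](_ : _ = tau * chi * M0 * P1); last by ring.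
  by apply: le_trans tau_small _; lra.
by rewrite /rate; ring.
Qed.

Lemma source_le U x : (forall x, 0 <= U x <= B) -> w * \sum_x U x <= M0 ->
  tau * (rate U * psi (U x)) <= tau * chi * M0 * P1 * U x.
Proof.
move=> UB UM; have U0 y : 0 <= U y by have /andP[] := UB y.
have /andP[r0 rM] := rate_bounds U0 UM.
move: (rate U) r0 rM => r r0 rM.
rewrite -!mulrA; apply: ler_wpM2l; first exact: ltW.
rewrite [leRHS]mulrA; have /andP[? ?] := UB x.
by apply: ler_pM => //; [exact: psi_ge0|exact: psi_le].
Qed.

(** Diffusion keeps the bound [c] and reaction adds at most [c / 2]. This crude bound makes the next
    iterate admissible before De Giorgi's argument improves on it. *)
Lemma step_le U c x : 0 <= c -> 2 * c <= B -> (forall x, 0 <= U x <= c) ->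
  w * \sum_x U x <= M0 -> step U x <= B.
Proof.
move=> c0 cB Uc UM; have UB y : 0 <= U y <= B.
  by have /andP[-> h]/= := Uc y; apply: le_trans h _; lra.
have := diffuse_le x c0 _ Uc => /(_ ltac:(lra)) d.
have s := source_le x UB UM.
have /andP[u0 uc] := Uc x.
have : tau * chi * M0 * P1 * U x <= 2^-1 * U x by exact: ler_wpM2r.
rewrite /step; lra.
Qed.

End scheme.

(** * De Giorgi iteration *)

Section degiorgi.
Context (R : realType) (X : finZmodType) (n : nat) (e : 'I_n -> X).
Variables (phi psi : R -> R) (B Lp P1 kap tau chi M0 w : R).
Hypothesis ok : scheme_ok n phi psi B Lp P1 kap tau chi M0 w.
Let B_gt0 : 0 < B. Proof. exact: so_B_gt0 ok. Qed.
Let Lp_gt0 : 0 < Lp. Proof. exact: so_Lp_gt0 ok. Qed.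
Let P1_ge0 : 0 <= P1. Proof. exact: so_P1_ge0 ok. Qed.
Let kap_gt0 : 0 < kap. Proof. exact: so_kap_gt0 ok. Qed.
Let tau_gt0 : 0 < tau. Proof. exact: so_tau_gt0 ok. Qed.
Let chi_gt0 : 0 < chi. Proof. exact: so_chi_gt0 ok. Qed.
Let M0_gt0 : 0 < M0. Proof. exact: so_M0_gt0 ok. Qed.
Let w_gt0 : 0 < w. Proof. exact: so_w_gt0 ok. Qed.

Variables (eps s0 D : R).
Hypotheses (n_gt0 : (0 < n)%N) (eps_gt0 : 0 < eps) (eps_le1 : eps <= 1)
  (wE : w = eps ^+ n) (tauE : tau = kap * eps ^+ 2)
  (s0_gt0 : 0 < s0) (s0_le1 : s0 <= 1) (D_gt0 : 0 < D)
  (box_inj : forall K, (0 < K)%N -> K%:R * eps <= 2 ->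
     injective (fun j : {ffun 'I_n -> 'I_K} => \sum_i e i *+ j i))
  (phi_low : forall a b, B / 4 <= a -> a <= b -> b <= B ->
     D * (b - a) <= phi b - phi a)
  (s0_big : 256 * M0 / B <= s0 ^+ n)
  (s0_small : 256 * n%:R * (chi * M0 * P1 * B) * s0 ^+ 2 <=
              2^-1 ^+ n.+2 * D * B).

Variables (U0 : X -> R).
Hypotheses (U0_bound : forall x, 0 <= U0 x <= B / 4)
  (U0_mass : w * \sum_x U0 x <= M0).

Local Notation st := (step e phi psi kap tau chi M0 w).

Definition evol k := iter k st U0.

(** Each stage halves the side of the box and the gap between levels; [theta] is 2^-n for the volume
    of the box times 1/4 for the squared gap. The levels [lv i] rise from [B / 4] to [B / 2], and
    [Y i] is the energy allowed above [lv i]. *)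
Let theta : R := 2^-1 ^+ n.+2.
Let lv i : R := B / 2 - B / 4 * 2^-1 ^+ i.
Let Delta i : R := B / 8 * 2^-1 ^+ i.
Let h_gt0 i : 0 < 2^-1 ^+ i :> R.
Proof. by rewrite exprn_gt0// invr_gt0. Qed.
Let h_le1 i : 2^-1 ^+ i <= 1 :> R.
Proof. by rewrite exprn_ile1// ?invr_ge0// invf_le1// ler1n. Qed.
Let theta_gt0 : 0 < theta. Proof. exact: h_gt0. Qed.
Let Y i := B * M0 * theta ^+ i.
Let Y_gt0 i : 0 < Y i.
Proof. by rewrite /Y !mulr_gt0// exprn_gt0. Qed.

Let lv_ge i : B / 4 <= lv i.
Proof.
have b0 : 0 <= B / 4 by rewrite divr_ge0// ltW.
by have := ler_piMr b0 (h_le1 i); rewrite /lv; lra.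
Qed.

Let lv_le i : lv i <= B.
Proof. have b0 : 0 <= B / 4 by rewrite divr_ge0// ltW.
by have := mulr_ge0 b0 (ltW (h_gt0 i)); have := B_gt0; rewrite /lv; lra. Qed.

Let lvS i : lv i.+1 = lv i + Delta i.
Proof. by rewrite /lv /Delta exprS; field. Qed.

Let Delta_gt0 i : 0 < Delta i.
Proof. by rewrite /Delta mulr_gt0// divr_gt0. Qed.

Let En i (U : X -> R) := w * \sum_x pos (lv i) (U x) ^+ 2.

Let posS i (u : R) : pos (lv i.+1) u != 0 -> Delta i <= pos (lv i) u.
Proof.
rewrite /pos lvS; case: (leP (u - (lv i + Delta i)) 0); rewrite ?eqxx// => h _.
by rewrite le_max; apply/orP; left; lra.
Qed.

Let supp_le i (U : X -> R) :
  w * #|[pred x | pos (lv i.+1) (U x) != 0%R]|%:R * Delta i ^+ 2 <= En i U.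
Proof.
rewrite /En -mulrA; apply: ler_wpM2l; first exact: ltW.
set A := [pred x | _].
rewrite mulr_natl -sumr_const (bigID (mem A))/= [leRHS](bigID (mem A))/=.
rewrite [X in _ + X <= _]big_andbC [X in _ + X]big1 ?addr0; last first.
  by move=> x /andP[/negP].
apply: (@le_trans _ _ (\sum_(i0 in A) pos (lv i) (U i0) ^+ 2)); last first.
  by rewrite lerDl; apply: sumr_ge0 => x _; exact: sqr_ge0.
under eq_bigl do rewrite andbb.
apply: ler_sum => x xA; rewrite lerXn2r ?nnegrE ?pos_ge0 ?(ltW (Delta_gt0 i))//.
exact: posS.
Qed.

Let s i := s0 * 2^-1 ^+ i.
Let s_gt0 i : 0 < s i. Proof. by rewrite /s mulr_gt0. Qed.
Let s_le1 i : s i <= 1.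
Proof. by rewrite /s mulr_ile1// ltW. Qed.

(** Chebyshev's inequality between consecutive levels. Of the constant 256, the factor 4 is what
    [faber_krahn] asks for and 64 comes from [Delta i ^+ 2]. *)
Let suppE i (U : X -> R) : En i U <= Y i ->
  4 * (w * #|[pred x | pos (lv i.+1) (U x) != 0%R]|%:R) <= s i ^+ n.
Proof.
move=> /(le_trans (supp_le i U)).
set N := w * _ => NY.
have D2 : 0 < Delta i ^+ 2 by rewrite exprn_gt0.
rewrite -(ler_pM2r D2) -mulrA; apply: le_trans (ler_wpM2l _ NY) _ => //.
have tE : theta ^+ i = 2^-1 ^+ (i * n) * 2^-1 ^+ (i * 2).
  by rewrite /theta -exprM -exprD -mulnDr mulnC addn2.
have DE : Delta i ^+ 2 = B ^+ 2 / 64 * 2^-1 ^+ (i * 2).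
  by rewrite /Delta [in RHS]exprM; move: (2^-1 ^+ i) => h; field.
have sE : s i ^+ n = s0 ^+ n * 2^-1 ^+ (i * n) by rewrite /s exprMn exprM.
rewrite /Y tE DE sE (_ : 4 * _ = (256 * M0 / B) * (2^-1 ^+ (i * n) *
  (B ^+ 2 / 64 * 2^-1 ^+ (i * 2)))); last first.
  move: (2^-1 ^+ (i * n)) (2^-1 ^+ (i * 2)) => h1 h2.
  by field; rewrite gt_eqF.
rewrite -[leRHS]mulrA; apply: ler_wpM2r => //.
by rewrite mulr_ge0 ?(ltW (h_gt0 _))// mulr_ge0 ?(ltW (h_gt0 _))// divr_ge0 ?sqr_ge0.
Qed.

Let pos_add (l a r : R) : 0 <= r ->
  pos l (a + r) ^+ 2 <= pos l a ^+ 2 + 2 * r * pos l (a + r).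
Proof.
move=> r0; have h1 : pos l (a + r) <= pos l a + r.
  rewrite /pos ge_max addr_ge0//= ?le_max ?lexx ?orbT// andbT.
  by rewrite addrAC lerD2r le_max lexx.
have h2 : pos l a <= pos l (a + r) by apply: pos_le; rewrite lerDl.
have h3 := pos_ge0 l a.
rewrite -lerBlDl subr_sqr (_ : 2 * r * _ = r * (2 * pos l (a + r))); last by ring.
apply: ler_pM; rewrite ?subr_ge0 ?addr_ge0 ?pos_ge0//; lra.
Qed.

(** Where the upper truncation is positive, the lower one is at least [Delta i]. This charges the
    source term, linear in the truncation, to the energy of the previous level. *)
Let pos_prev i (u : R) : Delta i * pos (lv i.+1) u <= pos (lv i) u ^+ 2.
Proof.
have [->|/posS h] := eqVneq (pos (lv i.+1) u) 0; first by rewrite mulr0 sqr_ge0.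
rewrite expr2; apply: ler_pM => //; [exact: ltW|exact: pos_ge0|].
by rewrite /pos ge_max !le_max lexx orbT andbT lerD2l lerN2 lvS lerDl (ltW (Delta_gt0 i)).
Qed.

Let cap := s0_small.

Let F : R := chi * M0 * P1 * B.

Let energy_step i (U : X -> R) : (forall x, 0 <= U x <= B) ->
  w * \sum_x U x <= M0 -> (forall x, 0 <= st U x <= B) ->
  En i (st U) <= Y i -> En i U <= Y i -> En i.+1 U <= Y i.+1 ->
  En i.+1 (st U) <= Y i.+1.
Proof.
move=> UB UM UB' Ei' Ei ES.
(* When the box is smaller than a cell, [suppE] leaves room for less than one cell, so the new
   iterate has no part above the next level at all. *)
have [se|es] := ltP (s i) eps.
  have := suppE Ei'; set N := #|_| => N4.
  suff N0 : N = 0%N.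
    rewrite /En big1 ?mulr0 ?(ltW (Y_gt0 _))// => x _.
    have /card0_eq/(_ x) := N0.
    by rewrite inE => /negbFE/eqP ->; rewrite expr0n.
  apply/eqP; rewrite eqn0Ngt; apply/negP => N1.
  have : s i ^+ n < w.
    by rewrite wE ltrXn2r ?nnegrE ?ltW// -lt0n.
  have : w <= 4 * (w * N%:R).
    by rewrite mulrCA ler_peMr ?(ltW w_gt0)// -natrM ler1n muln_gt0 N1.
  by move=> wN sw; have := le_lt_trans (le_trans wN N4) sw; rewrite ltxx.
have U0' x : 0 <= U x by have /andP[] := UB x.
set l := lv i.+1.
have l0 : 0 <= l by apply: le_trans (lv_ge _); rewrite divr_ge0// ltW.
have phiD a b : l <= a -> a <= b -> b <= B -> D * (b - a) <= phi b - phi a.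
  by move=> la; apply: phi_low; apply: le_trans la; exact: lv_ge.
have tr := trunc_energy e ok l0 (lv_le _) UB phiD.
pose v := pos l \o U; rewrite -/v in tr.
(* box of side [s i] *)
pose K := (Num.truncn (s i / eps)).+1.
have K1 : s i / eps < K%:R by rewrite truncnS_gt.
have K2 : K%:R <= 2 * (s i / eps).
  have : 1 <= s i / eps by rewrite ler_pdivlMr// mul1r.
  have : (Num.truncn (s i / eps))%:R <= s i / eps.
    by rewrite truncn_le// divr_ge0// ltW.
  rewrite /K -natr1; lra.
have fk : \sum_x v x ^+ 2 <= 4 * n%:R * K%:R ^+ 2 * dform e v v.
  apply: faber_krahn => //.
  - apply: box_inj => //.
    apply: (@le_trans _ _ (2 * (s i / eps) * eps)); first by rewrite ler_wpM2r// ltW.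
    by rewrite -mulrA divfK ?gt_eqF// ler_piMr// s_le1.
  - by move=> x; exact: pos_ge0.
  - have := suppE Ei; rewrite -/l; set N := #|_| => N4.
    rewrite -(ler_nat R) natrM natrX -(ler_pM2l w_gt0) mulrCA.
    apply: le_trans N4 _; rewrite wE -exprMn lerXn2r ?nnegrE ?(ltW (s_gt0 i)) ?mulr_ge0 ?(ltW eps_gt0)//.
    by rewrite mulrC -ler_pdivrMr// ltW.
have d0 := dform_ge0 e v.
(* The damping rate: with [K] at most [2 * (s i / eps)], [faber_krahn] costs
   [16 * n * s i ^+ 2 / eps ^+ 2], and [tau = kap * eps ^+ 2] absorbs the mesh. *)
pose a := D / (16 * n%:R * s i ^+ 2).
have n0 : 0 < n%:R :> R by rewrite ltr0n.
have den0 : 0 < 16 * n%:R * s i ^+ 2 by rewrite !mulr_gt0// exprn_gt0.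
have a0 : 0 < a by rewrite /a divr_gt0.
have dis : tau * a * (\sum_x v x ^+ 2) <= kap * D * dform e v v.
  apply: (@le_trans _ _ (tau * a * (4 * n%:R * (2 * (s i / eps)) ^+ 2 * dform e v v))).
    apply: ler_wpM2l; first by rewrite mulr_ge0// ltW.
    apply: le_trans fk _; apply: ler_wpM2r => //.
    apply: ler_wpM2l; first by rewrite mulr_ge0.
    by rewrite lerXn2r ?nnegrE// mulr_ge0// divr_ge0// ltW.
  rewrite le_eqVlt; apply/orP; left; apply/eqP.
  by rewrite tauE /a; field; rewrite !gt_eqF.
(* This makes [1 - tau * a] a nonnegative weight in [step3]; it rests on CFL, on [D <= Lp] and on
   [eps <= s i]. *)
have ta1 : tau * a <= 1.
  have DL : D <= Lp.
    have B0 := B_gt0; have q1 : B / 4 <= B by lra.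
    have := phi_low (lexx _) q1 (lexx _).
    have q0 : 0 <= B / 4 by rewrite divr_ge0// ltW.
    have := so_phi_lip ok q0 q1 (lexx _).
    move=> x1 x2; have := le_trans x2 x1.
    by rewrite ler_pM2r//; lra.
  have n1 : 1 <= n%:R :> R by rewrite ler1n.
  have kD : 4 * n%:R * (kap * D) <= 1.
    apply: le_trans (so_cfl ok); rewrite mulrA; apply: ler_wpM2l => //.
    by rewrite !mulr_ge0// ltW.
  have kD1 : kap * D <= 1.
    apply: le_trans kD; rewrite ler_peMl//; first by rewrite mulr_ge0// ltW.
    lra.
  rewrite tauE /a mulrA ler_pdivrMr// mul1r.
  apply: (@le_trans _ _ (eps ^+ 2)).
    by rewrite mulrAC; apply: ler_piMl => //; exact: sqr_ge0.
  apply: (@le_trans _ _ (s i ^+ 2)).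
    by rewrite lerXn2r ?nnegrE ?(ltW eps_gt0) ?(ltW (s_gt0 i)).
  rewrite ler_peMl ?sqr_ge0//; lra.
(* A fraction [tau * a] of the energy is dissipated, while reaction adds a term linear in the
   truncation of the new iterate; the latter is charged to level [i] at the new time. *)
have key : En i.+1 (st U) <= (1 - tau * a) * Y i.+1 + 2 * tau * F * (Y i / Delta i).
  have step1 : En i.+1 (st U) <= w * (\sum_x pos l (diffuse e phi kap U x) ^+ 2)
      + 2 * tau * F * (w * \sum_x pos l (st U x)).
    rewrite /En -/l mulrCA -mulrDr; apply: ler_wpM2l; first exact: ltW.
    rewrite mulr_sumr -big_split/=; apply: ler_sum => x _.
    set r := tau * (rate chi M0 w U * psi (U x)).
    have r0 : 0 <= r.
      have /andP[? _] := rate_bounds ok U0' UM.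
      rewrite /r mulr_ge0 ?(ltW tau_gt0)// mulr_ge0//.
      exact: (so_psi_ge0 ok).
    have rF : r <= tau * F.
      apply: le_trans (source_le ok x UB UM) _.
      rewrite /F [leRHS](_ : _ = tau * chi * M0 * P1 * B); last by ring.
      apply: ler_wpM2l; last by have /andP[] := UB x.
      by rewrite !mulr_ge0// ltW.
    apply: le_trans (pos_add _ _ r0) _; rewrite lerD2l.
    apply: ler_wpM2r; first exact: pos_ge0.
    by rewrite -mulrA; apply: ler_wpM2l.
  have step2 : w * \sum_x pos l (st U x) <= Y i / Delta i.
    rewrite ler_pdivlMr//; apply: le_trans Ei'; rewrite /En -mulrA.
    apply: ler_wpM2l; first exact: ltW.
    by rewrite mulr_suml; apply: ler_sum => x _; rewrite mulrC; exact: pos_prev.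
  have step3 : w * (\sum_x pos l (diffuse e phi kap U x) ^+ 2) <=
      (1 - tau * a) * Y i.+1.
    apply: (@le_trans _ _ ((1 - tau * a) * En i.+1 U)); last first.
      by apply: ler_wpM2l => //; rewrite subr_ge0.
    rewrite /En -/l mulrCA; apply: ler_wpM2l; first exact: ltW.
    by apply: le_trans tr _; rewrite mulrBl mul1r lerD2l lerN2.
  apply: le_trans step1 _; apply: lerD => //.
  apply: ler_wpM2l => //.
  by rewrite !mulr_ge0// ltW.
apply: le_trans key _.
suff : 2 * tau * F * (Y i / Delta i) <= tau * a * Y i.+1 by lra.
have YS : Y i.+1 = theta * Y i by rewrite /Y exprS; ring.
rewrite YS (_ : 2 * _ * _ * _ = tau * Y i * (2 * F / Delta i)); last by ring.
rewrite (_ : tau * a * _ = tau * Y i * (a * theta)); last by ring.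
apply: ler_wpM2l; first by rewrite mulr_ge0// ltW.
rewrite ler_pdivrMr//.
have hi := h_gt0 i.
have := cap; rewrite -/theta -/F => c.
rewrite /a /Delta (_ : D / _ * _ * _ =
    theta * D * (B / 8 * 2^-1 ^+ i) / (16 * n%:R * s i ^+ 2)); last first.
  by move: theta (2^-1 ^+ i) (16 * n%:R * s i ^+ 2) => t h q; ring.
rewrite ler_pdivlMr//.
have -> : s i ^+ 2 = s0 ^+ 2 * (2^-1 ^+ i * 2^-1 ^+ i).
  by rewrite /s; move: (2^-1 ^+ i) => h; ring.
(* The damping rate grows like 4^i with the stage, the source factor [1 / Delta i] only like 2^i, so
   the stage [i = 0], which is [s0_small], is the worst. *)
have hh : 2^-1 ^+ i * 2^-1 ^+ i <= 2^-1 ^+ i :> R.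
  by apply: ler_piMl; [exact: ltW|exact: h_le1].
have F0 : 0 <= 256 * n%:R * F * s0 ^+ 2.
  by rewrite mulr_ge0 ?sqr_ge0// mulr_ge0// /F !mulr_ge0// ltW.
have hh0 : 0 <= 2^-1 ^+ i * 2^-1 ^+ i :> R by rewrite mulr_ge0// ltW.
have := ler_pM F0 hh0 c hh.
move: theta F (2^-1 ^+ i) => t f h; lra.
Qed.

(** Double induction, on the level and then on time. At level 0 the mass bounds the energy; at later
    levels the energy starts from zero, as [U0] is at most [B / 4], and [energy_step] keeps it below
    [Y i]. A value above [B / 2] would contribute a fixed positive amount to every level, whereas
    [Y i] tends to 0. *)
Lemma degiorgi J : (forall j, (j <= J)%N -> forall x, 0 <= evol j x <= B) ->
  (forall j, (j <= J)%N -> w * \sum_x evol j x <= M0) ->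
  forall j, (j <= J)%N -> forall x, evol j x <= B / 2.
Proof.
move=> UB UM.
have E i : forall j, (j <= J)%N -> En i (evol j) <= Y i.
  elim: i => [|i IH] j.
    move=> jJ; rewrite /Y expr0 mulr1 -[leRHS]mulrC.
    apply: (@le_trans _ _ (w * (\sum_x evol j x) * B)); last first.
      by apply: ler_wpM2r; [exact: ltW|exact: UM].
    rewrite /En -mulrA; apply: ler_wpM2l; first exact: ltW.
    rewrite mulr_suml; apply: ler_sum => x _; have /andP[u0 uB] := UB _ jJ x.
    have pu : pos (lv 0) (evol j x) <= evol j x.
      rewrite /pos ge_max u0 andbT lerBlDr lerDl.
      by apply: le_trans (lv_ge 0); rewrite divr_ge0// ltW.
    rewrite expr2; apply: ler_pM; rewrite ?pos_ge0//.
    exact: le_trans uB.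
  elim: j => [_|j IHj jJ].
    rewrite /En big1 ?mulr0 ?(ltW (Y_gt0 _))// => x _.
    rewrite /pos (max_idPr _) ?expr0n// subr_le0.
    by apply: le_trans (lv_ge _); have /andP[] := U0_bound x.
  have jJ' : (j <= J)%N by exact: ltnW.
  apply: (energy_step (UB _ jJ') (UM _ jJ') (UB _ jJ) (IH _ jJ) (IH _ jJ') (IHj jJ')).
move=> j jJ x; rewrite leNgt; apply/negP => hx.
have c0 : 0 < w * (evol j x - B / 2) ^+ 2.
  by rewrite mulr_gt0// exprn_gt0// subr_gt0.
have small i : w * (evol j x - B / 2) ^+ 2 <= B * M0 * 2^-1 ^+ i.
  apply: (@le_trans _ _ (Y i)).
    apply: le_trans (E i j jJ); rewrite /En.
    apply: ler_wpM2l; first exact: ltW.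
    rewrite (bigD1 x)//=; apply: ler_wpDr.
      by apply: sumr_ge0 => y _; exact: sqr_ge0.
    rewrite lerXn2r ?nnegrE ?subr_ge0 ?(ltW hx) ?pos_ge0//.
    rewrite /pos le_max; apply/orP; left; rewrite lerD2l lerN2.
    rewrite /lv lerBlDr lerDl mulr_ge0 ?divr_ge0// ltW//.
  rewrite /Y /theta -exprM; apply: ler_wpM2l; first by rewrite mulr_ge0// ltW.
  apply: ler_wiXn2l; [by rewrite invr_ge0|by rewrite invf_le1// ler1n|by rewrite leq_pmull].
set c := w * _ in c0 small.
have := small (Num.truncn (B * M0 / c)).+1.
rewrite exprVn ler_pdivlMr ?exprn_gt0//.
set N := (Num.truncn _).+1.
have N1 : B * M0 / c < N%:R by rewrite truncnS_gt.
have N2 : N%:R < 2 ^+ N :> R by rewrite -natrX ltr_nat ltn_expl.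
rewrite mulrC -ler_pdivlMr// leNgt => /negP; apply.
exact: lt_trans N2.
Qed.

(** Strong induction in time: from the bound [B / 2], [step_le] gives [B] for one more step, and De
    Giorgi's argument over the whole history brings it back to [B / 2]. Nothing deteriorates with
    [k]. *)
Lemma evol_bounds k : (forall x, 0 <= evol k x <= B / 2) /\
  w * \sum_x evol k x <= M0.
Proof.
have Bp := B_gt0; have B2 : B / 2 <= B by lra.
elim/ltn_ind: k => -[_|k IH].
  split=> // x; have /andP[-> h] := U0_bound x; apply: le_trans h _; lra.
have IHB j : (j <= k)%N -> forall x, 0 <= evol j x <= B.
  by move=> jk x; have [/(_ x)/andP[-> /le_trans->]] := IH j jk.
have IHM j : (j <= k)%N -> w * \sum_x evol j x <= M0.
  by move=> jk; have [] := IH j jk.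
have B0 x : 0 <= evol k.+1 x.
  rewrite -[evol k.+1]/(st (evol k)).
  by apply: (step_ge0 e ok); [exact: IHB|exact: IHM].
have BB x : evol k.+1 x <= B.
  have [Bk Mk] := IH k (leqnn _).
  rewrite -[evol k.+1]/(st (evol k)).
  by apply: (step_le e ok (c := B / 2)) => //; [rewrite divr_ge0// ltW|lra].
have MM : w * \sum_x evol k.+1 x <= M0.
  rewrite -[evol k.+1]/(st (evol k)).
  by apply: (step_mass e ok); [exact: IHB|exact: IHM].
split=> // x; rewrite B0 andTb.
apply: (@degiorgi k.+1) => //.
  move=> j; rewrite leq_eqVlt => /orP[/eqP->|]; last exact: IHB.
  by move=> y; rewrite B0 BB.
by move=> j; rewrite leq_eqVlt => /orP[/eqP->//|]; exact: IHM.
Qed.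

End degiorgi.

(** * Energy, moment and time-translate estimates *)

Section estimates.
Context (R : realType) (X : finZmodType) (n : nat) (e : 'I_n -> X).
Variables (phi psi : R -> R) (B Lp P1 kap tau chi M0 w : R).
Hypothesis ok : scheme_ok n phi psi B Lp P1 kap tau chi M0 w.
Let B_gt0 : 0 < B. Proof. exact: so_B_gt0 ok. Qed.
Let Lp_gt0 : 0 < Lp. Proof. exact: so_Lp_gt0 ok. Qed.
Let P1_ge0 : 0 <= P1. Proof. exact: so_P1_ge0 ok. Qed.
Let kap_gt0 : 0 < kap. Proof. exact: so_kap_gt0 ok. Qed.
Let tau_gt0 : 0 < tau. Proof. exact: so_tau_gt0 ok. Qed.
Let chi_gt0 : 0 < chi. Proof. exact: so_chi_gt0 ok. Qed.
Let M0_gt0 : 0 < M0. Proof. exact: so_M0_gt0 ok. Qed.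
Let w_gt0 : 0 < w. Proof. exact: so_w_gt0 ok. Qed.

Variable U : nat -> X -> R.
Hypotheses (US : forall k, U k.+1 = step e phi psi kap tau chi M0 w (U k))
  (UB : forall k x, 0 <= U k x <= B) (UM : forall k, w * \sum_x U k x <= M0).
Local Notation V k := (phi \o U k).

Let src k x := tau * (rate chi M0 w (U k) * psi (U k x)).
Let c := tau * chi * M0 * P1.

Let USE k x : U k.+1 x = diffuse e phi kap (U k) x + src k x.
Proof. by rewrite US. Qed.

Let U_ge0 k x : 0 <= U k x. Proof. by have /andP[] := UB k x. Qed.
Let U_le k x : U k x <= B. Proof. by have /andP[] := UB k x. Qed.

Let src_ge0 k x : 0 <= src k x.
Proof.
have /andP[? _] := rate_bounds ok (U_ge0 k) (UM k).
by rewrite /src mulr_ge0 ?(ltW tau_gt0)// mulr_ge0//; exact: (so_psi_ge0 ok).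
Qed.

Let src_le k x : src k x <= c * U k x.
Proof. exact: (source_le ok x (UB k) (UM k)). Qed.

Let c_ge0 : 0 <= c.
Proof. by rewrite /c !mulr_ge0// ltW. Qed.

(** The case [l = 0] of [diffuse_energy], where the mixed form is bounded below by the form of [V k]
    divided by [Lp]. *)
Lemma energy_step k :
  w * (\sum_x U k.+1 x ^+ 2) + kap / Lp * (w * dform e (V k) (V k)) <=
  w * (\sum_x U k x ^+ 2) + 2 * (tau * chi * M0 * P1) * B * M0.
Proof.
have vB x : 0 <= U k x /\ 0 + U k x <= B by rewrite add0r.
have en := diffuse_energy e ok (lexx 0) vB.
have lip := dform_prod_lip e ok (lexx 0) vB.
move: en lip; rewrite /=.
have -> : (fun x => phi (0 + U k x)) = V k by apply/funext => x; rewrite add0r.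
move=> en lip.
have h1 : \sum_x U k.+1 x ^+ 2 <=
    \sum_x (U k x + kap * lap e (V k) x) ^+ 2 + 2 * c * B * \sum_x U k x.
  rewrite mulr_sumr -big_split/=; apply: ler_sum => x _.
  rewrite -lerBlDl subr_sqr.
  have -> : U k.+1 x - (U k x + kap * lap e (V k) x) = src k x.
    by rewrite USE /diffuse addrC addKr.
  rewrite (_ : 2 * c * B * _ = (c * U k x) * (2 * B)); last by ring.
  have d0 := diffuse_ge0 e ok x (UB k).
  have dB : diffuse e phi kap (U k) x <= B.
    by apply: (diffuse_le e ok) => //; exact: ltW.
  apply: ler_pM => //; first by rewrite addr_ge0.
  by have := U_le k.+1 x; rewrite /diffuse in dB *; lra.
have h2 : kap / Lp * dform e (V k) (V k) <= kap * dform e (U k) (V k).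
  by rewrite -mulrA; apply: ler_wpM2l; [exact: ltW|rewrite ler_pdivrMl].
have : w * (\sum_x U k.+1 x ^+ 2 + kap / Lp * dform e (V k) (V k)) <=
   w * (\sum_x U k x ^+ 2 + 2 * c * B * \sum_x U k x).
  by apply: ler_wpM2l; [exact: ltW|lra].
rewrite mulrDr [_ * (_ / _ * _)]mulrCA => /le_trans; apply.
rewrite mulrDr lerD2l mulrCA; apply: ler_wpM2l => //.
by rewrite !mulr_ge0// ltW.
Qed.

Lemma energy_sum K :
  \sum_(k < K) kap * (w * dform e (V k) (V k)) <=
  Lp * (B * M0 + K%:R * (2 * (tau * chi * M0 * P1) * B * M0)).
Proof.
rewrite -ler_pdivrMl//.
suff H : w * (\sum_x U K x ^+ 2) +
    Lp^-1 * (\sum_(k < K) kap * (w * dform e (V k) (V k))) <=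
    B * M0 + K%:R * (2 * (tau * chi * M0 * P1) * B * M0).
  apply: le_trans H; rewrite lerDr mulr_ge0// ?(ltW w_gt0)//.
  by apply: sumr_ge0 => x _; exact: sqr_ge0.
elim: K => [|K IH].
  rewrite big_ord0 mulr0 addr0 mul0r addr0.
  apply: (@le_trans _ _ (B * (w * \sum_x U 0%N x))); last first.
    by apply: ler_wpM2l; [exact: ltW|exact: UM].
  rewrite mulrCA; apply: ler_wpM2l; first exact: ltW.
  rewrite mulr_sumr; apply: ler_sum => x _; rewrite expr2.
  by apply: ler_wpM2r.
rewrite big_ord_recr/= -natr1.
have := energy_step K; rewrite -/c; move: IH.
move: (\sum_(k < K) _) => S.
move: (w * (\sum_x U K.+1 x ^+ 2)) (w * (\sum_x U K x ^+ 2)) => a b.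
move: (w * dform _ _ _) => d; rewrite -/c.
rewrite (_ : kap / Lp * d = Lp^-1 * (kap * d)); last by rewrite mulrCA mulrA.
rewrite mulrDr; move: (Lp^-1 * _) (Lp^-1 * _) => p q.
rewrite [(K%:R + 1) * _]mulrDl mul1r.
lra.
Qed.

(** Discrete Gronwall. The Laplacian is moved onto [h], to be taken as the squared distance to the
    origin, and what it produces there is bounded by the mass since [phi (U k x)] is at most
    [Lp * U k x]. *)
Lemma moment_bound (h : X -> R) (eps : R) k : (forall x, 0 <= h x) ->
  (forall x, lap e h x <= 2 * n%:R * eps ^+ 2) -> tau = kap * eps ^+ 2 ->
  w * (\sum_x U k x * h x) <= expR (k%:R * (tau * chi * M0 * P1)) *
    (w * (\sum_x U 0%N x * h x) + k%:R * (2 * n%:R * tau * Lp * M0)).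
Proof.
move=> h0 hl tauE; rewrite -/c.
have st k' : w * (\sum_x U k'.+1 x * h x) <=
    expR c * (w * (\sum_x U k' x * h x) + 2 * n%:R * tau * Lp * M0).
  set m := w * (\sum_x U k' x * h x).
  have m0 : 0 <= m.
    by rewrite mulr_ge0 ?(ltW w_gt0)//; apply: sumr_ge0 => x _; rewrite mulr_ge0.
  have q0 : 0 <= 2 * n%:R * tau * Lp * M0 by rewrite !mulr_ge0// ltW.
  apply: (@le_trans _ _ ((1 + c) * m + 2 * n%:R * tau * Lp * M0)); last first.
    rewrite mulrDr; apply: lerD.
      by apply: ler_wpM2r => //; exact: expR_ge1Dx.
    by rewrite ler_peMl// -expR0 ler_expR.
  apply: (@le_trans _ _ (w * (\sum_x ((1 + c) * (U k' x * h x)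
     + kap * (lap e (V k') x * h x))))).
    apply: ler_wpM2l; first exact: ltW.
    apply: ler_sum => x _; rewrite USE /diffuse.
    have := ler_wpM2r (h0 x) (src_le k' x).
    rewrite /lap -/(lap e (V k') x); move: (lap e _ x) => l; lra.
  rewrite big_split/= -!mulr_sumr mulrDr mulrCA lerD2l.
  rewrite sum_lapC.
  have pL x : 0 <= V k' x <= Lp * U k' x.
    have := so_phi_lip ok (lexx 0) (U_ge0 k' x) (U_le k' x).
    rewrite (so_phi0 ok) !subr0 /= => ->; rewrite andbT.
    by rewrite -(so_phi0 ok) (so_phi_mono ok).
  apply: (@le_trans _ _ (w * (kap * \sum_x Lp * U k' x * (2 * n%:R * eps ^+ 2)))).
    apply: ler_wpM2l; first exact: ltW.
    apply: ler_wpM2l; first exact: ltW.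
    apply: ler_sum => x _; have /andP[p0 pl] := pL x.
    apply: (@le_trans _ _ (V k' x * (2 * n%:R * eps ^+ 2))).
      exact: ler_wpM2l.
    by apply: ler_wpM2r => //; rewrite mulr_ge0 ?sqr_ge0// mulr_ge0.
  rewrite -mulr_suml -mulr_sumr.
  rewrite [leLHS](_ : _ = 2 * n%:R * tau * Lp * (w * \sum_x U k' x)); last first.
    by rewrite tauE; ring.
  by apply: ler_wpM2l => //; rewrite !mulr_ge0// ltW.
elim: k => [|k IH]; first by rewrite !mul0r expR0 mul1r addr0.
apply: le_trans (st k) _.
have q0 : 0 <= 2 * n%:R * tau * Lp * M0 by rewrite !mulr_ge0// ltW.
have e0 := expR_ge0 (k%:R * c).
have e1 : 1 <= expR (k%:R * c).
  by rewrite -[X in X <= _]expR0 ler_expR mulr_ge0.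
have -> : expR (k.+1%:R * c) = expR c * expR (k%:R * c).
  by rewrite -natr1 mulrDl mul1r addrC expRD.
rewrite -[leRHS]mulrA; apply: ler_wpM2l; first exact: expR_ge0.
rewrite -[k.+1%:R]natr1 [(k%:R + 1) * _]mulrDl mul1r addrA [leRHS]mulrDr.
by apply: lerD => //; exact: ler_peMl.
Qed.

Let dform_young (f g h : X -> R) :
  - dform e f (g \- h) <= dform e f f + 2^-1 * dform e g g + 2^-1 * dform e h h.
Proof.
rewrite /dform -sumrN !mulr_sumr -!big_split/=; apply: ler_sum => i _.
rewrite -sumrN !mulr_sumr -!big_split/=; apply: ler_sum => x _.
rewrite /dif/=.
move: (f _ - f _) (g (_ + _)) (g x) (h (_ + _)) (h x) => a b1 b2 c1 c2.
rewrite -subr_ge0.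
have := sqr_ge0 (a + (b1 - b2)); have := sqr_ge0 (a - (c1 - c2)).
by rewrite !expr2; lra.
Qed.

(** The increment over [l] steps telescopes into single steps; in each, summation by parts pairs the
    differences of [V (k + j)] with those of [V (k + l)] minus [V k], and Young's inequality leaves
    energies only. Hence a factor [l] in front of a bound that is uniform in the mesh. *)
Lemma time_translate K l : let E := \sum_(k < K + l) kap * (w * dform e (V k) (V k)) in
  is_true (
  \sum_(k < K) w * (\sum_x (U (k + l)%N x - U k x) * (V (k + l)%N x - V k x)) <=
  l%:R * (2 * E + K%:R * (tau * chi * M0 * P1) * M0 * phi B)).
Proof.
move=> E; rewrite -/c.
have phiB x : 0 <= x -> x <= B -> 0 <= phi x <= phi B.
  move=> x0 xB; rewrite (so_phi_mono ok x0 xB) andbT -(so_phi0 ok).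
  exact: (so_phi_mono ok).
have d0 k : 0 <= kap * (w * dform e (V k) (V k)).
  by rewrite !mulr_ge0 ?(ltW kap_gt0) ?(ltW w_gt0)//; exact: dform_ge0.
pose d k := kap * (w * dform e (V k) (V k)).
have one (k j : nat) : (k < K)%N -> (j < l)%N ->
    w * (\sum_x (U (k + j).+1 x - U (k + j)%N x) * (V (k + l)%N x - V k x)) <=
    d (k + j)%N + 2^-1 * d (k + l)%N + 2^-1 * d k + c * M0 * phi B.
  move=> kK jl.
  have -> : \sum_x (U (k + j).+1 x - U (k + j)%N x) * (V (k + l)%N x - V k x) =
     kap * (- dform e (V (k + j)%N) (V (k + l)%N \- V k))
     + \sum_x src (k + j)%N x * (V (k + l)%N x - V k x).
    rewrite -sum_lap mulr_sumr -big_split/=; apply: eq_bigr => x _.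
    by rewrite USE /diffuse /=; ring.
  rewrite mulrDr; apply: lerD.
    apply: (@le_trans _ _ (w * (kap * (dform e (V (k + j)%N) (V (k + j)%N)
       + 2^-1 * dform e (V (k + l)%N) (V (k + l)%N) + 2^-1 * dform e (V k) (V k))))).
      apply: ler_wpM2l; first exact: ltW.
      by apply: ler_wpM2l; [exact: ltW|exact: dform_young].
    by rewrite le_eqVlt; apply/orP; left; apply/eqP; rewrite /d; ring.
  apply: (@le_trans _ _ (w * \sum_x c * phi B * U (k + j)%N x)).
    apply: ler_wpM2l; first exact: ltW.
    apply: ler_sum => x _.
    apply: (@le_trans _ _ (src (k + j)%N x * phi B)).
      apply: ler_wpM2l => //.
      have /andP[_ h1] := phiB _ (U_ge0 (k + l)%N x) (U_le (k + l)%N x).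
      have /andP[h2 _] := phiB _ (U_ge0 k x) (U_le k x).
      by rewrite /=; lra.
    rewrite [leRHS]mulrAC; apply: ler_wpM2r => //.
    by have /andP[] := phiB B (ltW B_gt0) (lexx B).
  rewrite -mulr_sumr mulrCA [leRHS]mulrAC; apply: ler_wpM2l => //.
  rewrite mulr_ge0//; by have /andP[] := phiB B (ltW B_gt0) (lexx B).
have dE (a : nat) : (a <= l)%N -> \sum_(k < K) d (k + a)%N <= E.
  move=> al; rewrite -(big_mkord xpredT (fun k => d (k + a)%N)).
  have -> : \sum_(0 <= k < K) d (k + a)%N = \sum_(a <= k < K + a) d k.
    by rewrite -[in RHS](add0n a) big_addn addnK.
  have aKl : (a <= K + l)%N by rewrite (leq_trans al)// leq_addl.
  have KaKl : (K + a <= K + l)%N by rewrite leq_add2l.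
  rewrite /E -(big_mkord xpredT d) [leRHS](big_cat_nat (n := a))//=.
  rewrite [X in _ <= _ + X](big_cat_nat (n := (K + a)%N)) ?leq_addl//=.
  rewrite addrCA lerDl addr_ge0//; apply: sumr_ge0 => k _; exact: d0.
have tel k : \sum_x (U (k + l)%N x - U k x) * (V (k + l)%N x - V k x) =
    \sum_(j < l) \sum_x (U (k + j).+1 x - U (k + j)%N x) * (V (k + l)%N x - V k x).
  rewrite exchange_big/=; apply: eq_bigr => x _; rewrite -mulr_suml; congr (_ * _).
  rewrite -(big_mkord xpredT (fun j => U (k + j).+1 x - U (k + j)%N x)).
  under eq_bigr do rewrite -addnS.
  by rewrite (telescope_sumr (fun j => U (k + j)%N x))// addn0.
clearbody d.
apply: (@le_trans _ _ (\sum_(k < K) \sum_(j < l)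
   (d (k + j)%N + 2^-1 * d (k + l)%N + 2^-1 * d k + c * M0 * phi B))).
  apply: ler_sum => k _; rewrite tel mulr_sumr; apply: ler_sum => j _.
  exact: one.
rewrite exchange_big/=; set Z := (X in _ <= _ * X).
have -> : l%:R * Z = \sum_(j < l) Z by rewrite sumr_const card_ord mulr_natl.
apply: ler_sum => j _; rewrite /Z.
rewrite !big_split/= -!mulr_sumr sumr_const card_ord -[_ *+ K]mulr_natl.
have h1 := dE j (ltnW (ltn_ord j)); have h2 := dE l (leqnn l).
have h3 : \sum_(k < K) d k <= E.
  by apply: le_trans (dE 0%N (leq0n l)); under [leRHS]eq_bigr do rewrite addn0.
rewrite (_ : K%:R * c * _ * _ = K%:R * (c * M0 * phi B)); last by ring.
lra.
Qed.

(** Abel summation in time. The test function is taken at the new time [k.+1], so that the explicit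
    scheme enters without remainder and [U k] meets a forward difference. *)
Lemma discrete_weak (Psi : nat -> X -> R) K :
  \sum_(k < K) (kap * (w * dform e (V k) (Psi k.+1))
    - tau * (rate chi M0 w (U k) * (w * \sum_x psi (U k x) * Psi k.+1 x))
    - w * \sum_x U k x * (Psi k.+1 x - Psi k x)) =
  w * (\sum_x U 0%N x * Psi 0%N x) - w * (\sum_x U K x * Psi K x).
Proof.
elim: K => [|K IH]; first by rewrite big_ord0 subrr.
rewrite big_ord_recr/= IH.
have -> : w * (\sum_x U K.+1 x * Psi K.+1 x) =
  w * (\sum_x U K x * Psi K.+1 x) - kap * (w * dform e (V K) (Psi K.+1))
  + tau * (rate chi M0 w (U K) * (w * \sum_x psi (U K x) * Psi K.+1 x)).
  rewrite -[dform _ _ _]opprK -sum_lap.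
  rewrite !mulrN opprK mulrCA [X in _ + X](_ : _ = w * \sum_x src K x * Psi K.+1 x).
    rewrite !mulr_sumr -!big_split/=; apply: eq_bigr => x _.
    by rewrite USE /diffuse; ring.
  by rewrite /src !mulr_sumr; apply: eq_bigr => x _; ring.
have -> : \sum_x U K x * (Psi K.+1 x - Psi K x) =
    (\sum_x U K x * Psi K.+1 x) - \sum_x U K x * Psi K x.
  by rewrite -sumrB; apply: eq_bigr => x _; rewrite mulrBr.
by ring.
Qed.

End estimates.

(** * Sampling on coarse grids *)

Lemma sum_le_cover (R : numDomainType) (I J : finType) (P : pred I) (f : I -> J)
    (a : I -> R) (b : J -> R) : (forall j, 0 <= b j) ->
  {in P &, injective f} -> (forall i, P i -> a i <= b (f i)) ->
  \sum_(i | P i) a i <= \sum_j b j.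
Proof.
move=> b0 inj ab; apply: (@le_trans _ _ (\sum_(i | P i) b (f i))).
  exact: ler_sum.
rewrite -(@big_imset _ _ _ _ _ f P b)//=.
rewrite [leRHS](bigID (mem (imset f (mem P))))/= lerDl.
exact: sumr_ge0.
Qed.

Section grid.
Context (N n : nat).
Local Notation X := 'rV['I_N.+1]_n.

Definition unitv (i : 'I_n) : X := \row_j (if j == i then inZp 1 else 0).

Lemma inZpD a b : inZp (a + b) = inZp a + inZp b :> 'I_N.+1.
Proof. by apply: val_inj; rewrite /= modnDm. Qed.

Lemma unitv_mulrn i k j :
  (unitv i *+ k) 0 j = if j == i then inZp k else 0 :> 'I_N.+1.
Proof.
elim: k => [|k IH]; first by rewrite mulr0n mxE; case: ifP => // _; apply: val_inj; rewrite /= mod0n.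
rewrite mulrS mxE IH mxE (inZpD 1 k); case: ifP => // _; by rewrite addr0.
Qed.

Lemma latvec_coord (j : 'I_n -> nat) (b : 'I_n -> bool) i :
  latvec unitv j b 0 i = if b i then - inZp (j i) else inZp (j i).
Proof.
rewrite /latvec summxE (bigD1 i)//= big1 ?addr0.
  by case: (b i); rewrite ?mxE unitv_mulrn eqxx.
by move=> k ki; case: (b k); rewrite ?mxE unitv_mulrn eq_sym (negbTE ki) ?oppr0.
Qed.

Lemma latvec_inj K : (K <= N.+1)%N ->
  injective (fun j : {ffun 'I_n -> 'I_K} => \sum_i unitv i *+ j i).
Proof.
move=> KN j1 j2 E; apply/ffunP => i; apply: val_inj.
have E' : latvec unitv (fun i => j1 i) (fun=> false) =
  latvec unitv (fun i => j2 i) (fun=> false) by exact: E.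
have := congr1 (fun x : X => x 0 i : nat) E'.
by rewrite !latvec_coord /= !modn_small// (leq_trans (ltn_ord _)).
Qed.

Variables (s N' : nat).
Hypothesis (NE : N.+1 = (N' * s)%N).

(** Keeps the block of side [s] that contains [x] and replaces the offset inside it by [rho]; all
    points of a block share one sample point. *)
Definition resample (rho : {ffun 'I_n -> 'I_s}) (x : X) : X :=
  \row_i inZp ((x 0%R i %/ s) * s + rho i).

Lemma resample_val (rho : {ffun 'I_n -> 'I_s}) x i :
  resample rho x 0%R i = ((x 0%R i %/ s) * s + rho i)%N :> nat.
Proof.
rewrite mxE /= modn_small// [X in (_ < X)%N]NE.
have s0 : (0 < s)%N by case: (s) (rho i) => [[]|].
have : (x 0%R i %/ s < N')%N by rewrite ltn_divLR// -NE.
have := ltn_ord (rho i).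
move: (x 0%R i %/ s)%N (nat_of_ord (rho i)) => a b bs aN.
apply: (@leq_trans (a.+1 * s)); first by rewrite mulSn addnC ltn_add2r.
by rewrite leq_mul2r aN orbT.
Qed.

(** The displacement from [x] to its sample point, as a sign and a size per coordinate. Blocks tile
    the torus and do not wrap around, so it is a [latvec] of entries at most [s]. *)
Definition offs (rho : {ffun 'I_n -> 'I_s}) (x : X) : {ffun 'I_n -> bool * 'I_s.+1} :=
  [ffun i => ((rho i < x 0%R i %% s)%N,
     inord (if (rho i < x 0%R i %% s)%N then (x 0%R i %% s - rho i) else
        (rho i - x 0%R i %% s))%N)].

Lemma resample_latvec (rho : {ffun 'I_n -> 'I_s}) x : resample rho x =
  x + latvec unitv (fun i => (offs rho x i).2) (fun i => (offs rho x i).1).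
Proof.
apply/rowP => i; apply: val_inj.
rewrite -[LHS]/(nat_of_ord (resample rho x 0 i)) resample_val.
rewrite [in RHS]mxE latvec_coord !ffunE /=.
have s0 : (0 < s)%N by case: (s) (rho i) => [[]|].
have rs := ltn_ord (rho i); have xs : (x 0%R i %% s < s)%N by rewrite ltn_mod.
have xE := divn_eq (x 0%R i) s; have xN := ltn_ord (x 0%R i).
have rN : (x 0%R i %/ s * s + rho i < N.+1)%N.
  by rewrite -resample_val ltn_ord.
set q := (x 0%R i %/ s * s)%N in xE rN *; set m := (x 0%R i %% s)%N in xs xE *.
move: (nat_of_ord (rho i)) rs rN => r rs rN.
have [h|h] := ltnP r m; rewrite /= inordK; try lia.
  rewrite [((m - r) %% _)%N]modn_small; last lia.
  rewrite [((N.+1 - _) %% _)%N]modn_small; last lia.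
  have -> : (x 0%R i + (N.+1 - (m - r)) = N.+1 + (q + r))%N by lia.
  by rewrite modnDl modn_small.
rewrite [((r - m) %% _)%N]modn_small; last lia.
by rewrite modn_small; lia.
Qed.

Lemma resample_inj x : injective (fun rho : {ffun 'I_n -> 'I_s} => resample rho x).
Proof.
move=> r1 r2 E; apply/ffunP => i; apply: val_inj => /=.
have := congr1 (fun y : X => y 0 i : nat) E; rewrite /= !resample_val; lia.
Qed.

End grid.

Section sampling.
Context (R : realType) (N n : nat).
Local Notation X := 'rV['I_N.+1]_n.
Variables (s N' st K' : nat) (phi : R -> R) (B delta Md ET ES : R).
Variable U : nat -> X -> R.
Local Notation V k := (phi \o U k).
Local Notation e := (@unitv N n).
Local Notation K := (K' * st)%N.
Hypotheses (NE : N.+1 = (N' * s)%N) (s_gt0 : (0 < s)%N) (st_gt0 : (0 < st)%N)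
  (UB : forall k x, 0 <= U k x <= B)
  (delta_gt0 : 0 < delta) (Md_ge0 : 0 <= Md)
  (mod2 : forall a b, 0 <= a <= B -> 0 <= b <= B ->
     `|a - b| <= delta + Md * (phi a - phi b) ^+ 2)
  (mod1 : forall a b, 0 <= a <= B -> 0 <= b <= B ->
     0 <= (a - b) * (phi a - phi b) /\
     `|a - b| <= delta + Md * ((a - b) * (phi a - phi b)))
  (HT : forall l, (l < st)%N ->
     \sum_(k < K) \sum_x (U (k + l)%N x - U k x) * (V (k + l)%N x - V k x) <= ET)
  (HS : \sum_(k < K) dform e (V k) (V k) <= ES).

Definition retime (r k : nat) := (k %/ st * st + r)%N.

Let retime_lt (r : 'I_st) (k : 'I_K) : (retime r k < K)%N.
Proof.
rewrite /retime; have : (k %/ st < K')%N by rewrite ltn_divLR.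
have := ltn_ord r; move: (k %/ st)%N => a rs aK.
apply: (@leq_trans (a.+1 * st)); first by rewrite mulSn addnC ltn_add2r.
by rewrite leq_mul2r aK orbT.
Qed.

Let G k k' := \sum_x (U k' x - U k x) * (V k' x - V k x).

Let G_ge0 k k' : 0 <= G k k'.
Proof. by apply: sumr_ge0 => x _; have [] := mod1 (UB k' x) (UB k x). Qed.

Let Gsym k k' : G k k' = G k' k.
Proof. by apply: eq_bigr => x _; rewrite -[LHS]mulrNN !opprB. Qed.

(** A pair of times is encoded by its order, its earlier member and its gap, which is less than
    [st]. The encoding is injective, so the double sum is at most twice the sum of the translates of
    all these gaps. *)
Let time_sum : \sum_(k < K) \sum_(r < st) G k (retime r k) <= 2 * st%:R * ET.
Proof.
rewrite pair_big/=.
pose f (z : 'I_K * 'I_st) : bool * 'I_K * 'I_st.-1.+1 :=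
  let k' := Ordinal (retime_lt z.2 z.1) in
  ((z.1 <= k')%N, (if (z.1 <= k')%N then z.1 else k'),
   inord (if (z.1 <= k')%N then k' - z.1 else z.1 - k')%N).
have diff (k : 'I_K) (r : 'I_st) : (retime r k - k < st)%N /\ (k - retime r k < st)%N.
  have ks : (k %% st < st)%N by rewrite ltn_mod.
  have kE := divn_eq k st; have := ltn_ord r; rewrite /retime; lia.
apply: (@le_trans _ _ (\sum_(z : bool * 'I_K * 'I_st.-1.+1) G z.1.2 (z.1.2 + z.2)%N)).
  apply: (sum_le_cover (f := f)) => //.
  - move=> [k1 r1] [k2 r2] _ _; rewrite /f /= => -[].
    have [d1 d1'] := diff k1 r1; have [d2 d2'] := diff k2 r2.
    have rr1 : (r1 = retime r1 k1 %% st :> nat)%N.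
      by rewrite /retime modnMDl modn_small.
    have rr2 : (r2 = retime r2 k2 %% st :> nat)%N.
      by rewrite /retime modnMDl modn_small.
    move=> c; rewrite -c; case: ifPn => h1; rewrite c in h1 => E1 E2.
      have := congr1 (fun z : 'I__ => z : nat) E2; rewrite /= !inordK ?prednK// => E3.
      have k12 : k1 = k2 by exact: E1.
      congr pair => //; apply: val_inj; rewrite /= rr1 rr2; congr (_ %% _)%N.
      rewrite -k12 in c h1 E3 *; move: c; rewrite h1 => h3.
      by have h2 : (k1 <= retime r1 k1)%N by []; lia.
    have := congr1 (fun z : 'I__ => z : nat) E2; rewrite /= !inordK ?prednK// => E3.
    have k12 : retime r1 k1 = retime r2 k2 by case: E1.
    have kk : k1 = k2 by apply: val_inj => /=; lia.
    by congr pair => //; apply: val_inj; rewrite /= rr1 rr2 k12.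
  - move=> [k r] _; rewrite /f /=; have [d d'] := diff k r.
    case: ifPn => h; rewrite inordK ?prednK//.
      by rewrite subnKC.
    have h' : (retime r k <= k)%N by rewrite ltnW// ltnNge.
    by rewrite subnKC// Gsym.
rewrite -(pair_big xpredT xpredT (fun (a : bool * 'I_K) (b : 'I_st.-1.+1) => G a.2 (a.2 + b)%N))/=.
rewrite -(pair_big xpredT xpredT (fun (a : bool) (k : 'I_K) => \sum_(b < st.-1.+1) G k (k + b)%N))/=.
rewrite sumr_const card_bool -[leLHS]mulr_natl -[leRHS]mulrA; apply: ler_wpM2l => //.
rewrite exchange_big/= -[in leRHS](prednK st_gt0).
apply: (@le_trans _ _ (\sum_(l < st.-1.+1) ET)).
  by apply: ler_sum => l _; apply: HT; rewrite -[leqRHS](prednK st_gt0).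
by rewrite sumr_const card_ord mulr_natl.
Qed.

(** Distinct [rho] give distinct displacements from [x], so the sum over [rho] is at most the sum
    over all displacements of entries at most [s], to each of which [shiftn_latvec] applies. *)
Let space_sum k : \sum_x \sum_(rho : {ffun 'I_n -> 'I_s})
    (V k x - V k (resample rho x)) ^+ 2 <=
  (2 * s.+1)%:R ^+ n * (n%:R * s%:R ^+ 2 * dform e (V k) (V k)).
Proof.
pose D : finType := {ffun 'I_n -> bool * 'I_s.+1}.
apply: (@le_trans _ _ (\sum_x \sum_(d : D)
   (V k x - V k (x + latvec e (fun i => (d i).2) (fun i => (d i).1))) ^+ 2)).
  apply: ler_sum => x _.
  apply: (sum_le_cover (f := fun rho => offs rho x)) => //.
  - by move=> d; exact: sqr_ge0.
  - move=> r1 r2 _ _ E; apply: (resample_inj NE (x := x)).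
    by rewrite !(resample_latvec NE) E.
  - by move=> rho _; rewrite (resample_latvec NE).
rewrite exchange_big/=.
rewrite -natrX -[X in X%:R * _](_ : #|D| = _); last first.
  by rewrite card_ffun card_prod card_bool !card_ord.
rewrite mulr_natl -sumr_const; apply: ler_sum => d _.
apply: le_trans (@shiftn_latvec R _ _ e (fun i => (d i).2) (fun i => (d i).1) s (V k) _).
  rewrite le_eqVlt; apply/orP; left; apply/eqP; apply: eq_bigr => x _.
  by rewrite -sqrrN opprB.
by move=> i; rewrite -ltnS.
Qed.

(** The offsets are found by averaging: summed over all [r] and [rho], the error consists of
    translates in time and in space, which [HT] and [HS] control, so some offset does no worse than
    the mean. *)
Lemma sampling (P : pred X) : exists (r : 'I_st) (rho : {ffun 'I_n -> 'I_s}),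
  \sum_(k < K) \sum_(x | P x) `|U k x - U (retime r k) (resample rho x)| <=
  2 * delta * K%:R * #|P|%:R + Md * (2 * ET + 4 ^+ n * n%:R * s%:R ^+ 2 * ES).
Proof.
pose bd := 2 * delta * K%:R * #|P|%:R +
  Md * (2 * ET + 4 ^+ n * n%:R * s%:R ^+ 2 * ES).
pose O : finType := ('I_st * {ffun 'I_n -> 'I_s})%type.
pose err (o : O) := \sum_(k < K) \sum_(x | P x)
  `|U k x - U (retime o.1 k) (resample o.2 x)|.
have cO : #|{: O}| = (st * s ^ n)%N by rewrite card_prod card_ffun !card_ord.
have cO0 : (0 < #|{: O}|)%N by rewrite cO muln_gt0 st_gt0 expn_gt0 s_gt0.
suff : \sum_o err o <= #|{: O}|%:R * bd.
  move=> H; apply: contrapT => nex.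
  have lt1 o : bd < err o.
    by rewrite ltNge; apply/negP => h; apply: nex; exists o.1, o.2.
  have : #|{: O}|%:R * bd < \sum_o err o.
    rewrite mulr_natl -sumr_const; apply: ltr_sum; last by move=> o _; exact: lt1.
    by apply/hasP; move/card_gt0P: cO0 => [i _]; exists i; rewrite ?mem_index_enum.
  by rewrite ltNge H.
(* The move in time is measured by products of increments of [U] and [V], which [HT] bounds, and the
   move in space by squared increments of [V], which [HS] bounds. *)
have split1 o : err o <= \sum_(k < K) \sum_(x | P x)
     (delta + Md * ((U (retime o.1 k) x - U k x) * (V (retime o.1 k) x - V k x)))
   + \sum_(k < K) \sum_(x | P x) (delta + Md *
      (V (retime o.1 k) x - V (retime o.1 k) (resample o.2 x)) ^+ 2).
  rewrite -big_split/=; apply: ler_sum => k _.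
  rewrite -big_split/=; apply: ler_sum => x _.
  apply: le_trans (ler_distD (U (retime o.1 k) x) _ _) _; apply: lerD.
    by rewrite distrC; have [] := mod1 (UB (retime o.1 k) x) (UB k x).
  exact: mod2.
have cst (g : nat -> X -> R) : \sum_(k < K) \sum_(x | P x) (delta + Md * g k x) =
    delta * K%:R * #|P|%:R + Md * \sum_(k < K) \sum_(x | P x) g k x.
  under eq_bigr do rewrite big_split/= sumr_const -mulr_sumr.
  rewrite big_split/= sumr_const card_ord -mulr_sumr; congr (_ + _).
  by rewrite -[LHS]mulr_natr -[delta *+ _]mulr_natr mulrAC.
have split2 o : err o <= 2 * delta * K%:R * #|P|%:R
   + Md * (\sum_(k < K) G k (retime o.1 k))
   + Md * \sum_(k < K) \sum_x
      (V (retime o.1 k) x - V (retime o.1 k) (resample o.2 x)) ^+ 2.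
  apply: le_trans (split1 o) _.
  rewrite (cst (fun k x => (U (retime o.1 k) x - U k x) * (V (retime o.1 k) x - V k x))).
  rewrite (cst (fun k x => (V (retime o.1 k) x - V (retime o.1 k) (resample o.2 x)) ^+ 2)).
  have l1 : \sum_(k < K) \sum_(x | P x) (U (retime o.1 k) x - U k x) *
     (V (retime o.1 k) x - V k x) <= \sum_(k < K) G k (retime o.1 k).
    apply: ler_sum => k _; rewrite /G [leRHS](bigID P)/= lerDl.
    by apply: sumr_ge0 => x _; have [] := mod1 (UB (retime o.1 k) x) (UB k x).
  have l2 : \sum_(k < K) \sum_(x | P x)
       (V (retime o.1 k) x - V (retime o.1 k) (resample o.2 x)) ^+ 2 <=
     \sum_(k < K) \sum_x
       (V (retime o.1 k) x - V (retime o.1 k) (resample o.2 x)) ^+ 2.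
    apply: ler_sum => k _; rewrite [leRHS](bigID P)/= lerDl.
    by apply: sumr_ge0 => x _; exact: sqr_ge0.
  have := ler_wpM2l Md_ge0 l1; have := ler_wpM2l Md_ge0 l2; lra.
apply: le_trans (ler_sum _ (fun o _ => split2 o)) _.
rewrite !big_split/= sumr_const -!mulr_sumr -[_ *+ #|_|]mulr_natl.
have ts : \sum_(o : O) \sum_(k < K) G k (retime o.1 k) <= (s ^ n)%:R * (2 * st%:R * ET).
  rewrite -(pair_big xpredT xpredT (fun (r : 'I_st) (q : {ffun 'I_n -> 'I_s}) => \sum_(k < K) G k (retime r k)))/=.
  under eq_bigr do rewrite sumr_const card_ffun !card_ord -[_ *+ _]mulr_natl.
  rewrite -mulr_sumr exchange_big/=; apply: ler_wpM2l => //.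
have ss : \sum_(o : O) \sum_(k < K) \sum_x
      (V (retime o.1 k) x - V (retime o.1 k) (resample o.2 x)) ^+ 2 <=
   st%:R * ((2 * s.+1)%:R ^+ n * (n%:R * s%:R ^+ 2 * ES)).
  rewrite -(pair_big xpredT xpredT (fun (r : 'I_st) (q : {ffun 'I_n -> 'I_s}) =>
     \sum_(k < K) \sum_x (V (retime r k) x - V (retime r k) (resample q x)) ^+ 2))/=.
  pose g k := \sum_(q : {ffun 'I_n -> 'I_s}) \sum_x (V k x - V k (resample q x)) ^+ 2.
  have g0 k : 0 <= g k.
    by apply: sumr_ge0 => q _; apply: sumr_ge0 => x _; exact: sqr_ge0.
  apply: (@le_trans _ _ (\sum_(r < st) \sum_(k < K) g (retime r k))).
    by apply: ler_sum => r _; rewrite exchange_big.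
  apply: (@le_trans _ _ (st%:R * \sum_(k < K) g k)).
    rewrite pair_big/=.
    rewrite -[leRHS](_ : \sum_(z : 'I_K * 'I_st) g z.1 = _); last first.
      rewrite -(pair_big xpredT xpredT (fun (k : 'I_K) (r : 'I_st) => g k))/=.
      by under eq_bigr do rewrite sumr_const card_ord -[_ *+ _]mulr_natl;
         rewrite -mulr_sumr.
    pose f (z : 'I_st * 'I_K) : 'I_K * 'I_st :=
      (Ordinal (retime_lt z.1 z.2), Ordinal (ltn_pmod z.2 st_gt0)).
    apply: (sum_le_cover (f := f)) => //.
    move=> [r1 k1] [r2 k2] _ _ [] E1 E2.
    have rr1 : (r1 = retime r1 k1 %% st :> nat)%N by rewrite /retime modnMDl modn_small.
    have rr2 : (r2 = retime r2 k2 %% st :> nat)%N by rewrite /retime modnMDl modn_small.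
    have r12 : r1 = r2 by apply: val_inj; rewrite /= rr1 rr2 E1.
    congr pair => //; apply: val_inj => /=.
    have := E1; rewrite /retime r12 => /addIn E3.
    by rewrite (divn_eq k1 st) (divn_eq k2 st) E2 E3.
  apply: ler_wpM2l => //.
  apply: (@le_trans _ _ (\sum_(k < K) (2 * s.+1)%:R ^+ n * (n%:R * s%:R ^+ 2 * dform e (V k) (V k)))).
    by apply: ler_sum => k _; rewrite /g exchange_big/=; exact: space_sum.
  rewrite -!mulr_sumr; apply: ler_wpM2l; first by rewrite exprn_ge0.
  by apply: ler_wpM2l; rewrite // mulr_ge0// exprn_ge0.
have ES0 : 0 <= ES.
  by apply: le_trans HS; apply: sumr_ge0 => k _; exact: dform_ge0.
have s4 : (2 * s.+1)%:R ^+ n <= 4 ^+ n * s%:R ^+ n :> R.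
  rewrite -exprMn lerXn2r ?nnegrE ?mulr_ge0// -natrM ler_nat; lia.
have ss' : \sum_(o : O) \sum_(k < K) \sum_x
      (V (retime o.1 k) x - V (retime o.1 k) (resample o.2 x)) ^+ 2 <=
   st%:R * (s ^ n)%:R * (4 ^+ n * n%:R * s%:R ^+ 2 * ES).
  apply: le_trans ss _; rewrite -[leRHS]mulrA; apply: ler_wpM2l => //.
  rewrite natrX.
  apply: (@le_trans _ _ (4 ^+ n * s%:R ^+ n * (n%:R * s%:R ^+ 2 * ES))).
    by apply: ler_wpM2r => //; rewrite mulr_ge0// mulr_ge0// exprn_ge0.
  by rewrite le_eqVlt; apply/orP; left; apply/eqP; ring.
rewrite /bd !mulrDr cO natrM.
have := ler_wpM2l Md_ge0 ts; have := ler_wpM2l Md_ge0 ss'.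
lra.
Qed.

End sampling.

(** * Selection of Cauchy subsequences and midpoint hulls *)

Section cauchy_selection.
Context (R : realType).

Lemma ultra_finite (U : set_system nat) (F : finType) (c : nat -> F) :
  UltraFilter U -> exists f, U [set k | c k = f].
Proof.
move=> UU; have pU : ProperFilter U by exact: ultra_proper.
apply: contrapT => nex.
have all_f f : U [set k | c k <> f].
  have [h|h] := in_ultra_setVsetC [set k | c k = f] UU; last exact: h.
  by exfalso; apply: nex; exists f.
have : U [set k | forall f, f \in enum F -> c k <> f].
  elim: (enum F) => [|f s IH].
    by apply: filterS filterT => k _ f; rewrite in_nil.
  apply: filterS (filterI (all_f f) IH) => k [h1 h2] g.
  by rewrite inE => /orP[/eqP->|/h2].
move=> /filter_ex[k /(_ (c k))]; rewrite mem_enum => /(_ isT); exact.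
Qed.

(** An ultrafilter containing the neighbourhoods of infinity replaces diagonal extraction: for each
    radius one class of the finite code belongs to it, and finitely many such classes meet beyond
    every index. *)
Lemma totally_bounded_cauchy (D : nat -> nat -> R) (eta : nat -> R) :
  (forall k, 0 < eta k) ->
  (forall r, 0 < r -> exists (F : finType) (c : nat -> F) (q : nat),
     forall p p', (q <= p)%N -> (q <= p')%N -> c p = c p' -> D p p' <= r) ->
  exists s : nat -> nat, forall k, (k <= s k)%N /\
    forall l, (k <= l)%N -> D (s k) (s l) <= eta k.
Proof.
move=> eta0 tb.
have [U [UU Uoo]] := @ultraFilterLemma nat \oo _.
have pU : ProperFilter U by exact: ultra_proper.
have H k : exists S : set nat, U S /\ forall p p', S p -> S p' -> D p p' <= eta k.
  have [F [c [q Dq]]] := tb _ (eta0 k).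
  have [f Uf] := ultra_finite c UU.
  exists [set p | c p = f /\ (q <= p)%N]; split.
    by apply: filterI => //; apply: Uoo; exact: nbhs_infty_ge.
  by move=> p p' [cp qp] [cp' qp']; apply: Dq => //; rewrite cp cp'.
pose S k := sval (cid (H k)).
have US k : U (S k) by rewrite /S; case: cid => /= ? [].
have DS k p p' : S k p -> S k p' -> D p p' <= eta k.
  by rewrite /S; case: cid => /= ? [_]; apply.
have H2 k : exists p, (k <= p)%N /\ forall j, (j <= k)%N -> S j p.
  suff : U [set p | (k <= p)%N /\ forall j, (j <= k)%N -> S j p].
    by move/filter_ex.
  apply: filterI; first by apply: Uoo; exact: nbhs_infty_ge.
  suff : forall i, U [set p | forall j, (j <= i)%N -> S j p] by apply.
  elim=> [|i IH].
    by apply: filterS (US 0%N) => p Sp j; rewrite leqn0 => /eqP->.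
  apply: filterS (filterI IH (US i.+1)) => p [h1 h2] j.
  by rewrite leq_eqVlt => /orP[/eqP->//|]; exact: h1.
exists (fun k => sval (cid (H2 k))) => k; case: cid => p [kp Sp] /=; split=> // l kl.
case: cid => p' [lp' Sp'] /=.
by apply: (DS k); [exact: Sp|exact: Sp'].
Qed.

Lemma cauchy_subseq (D : nat -> nat -> R) (eta : nat -> R) :
  (forall k, 0 < eta k) ->
  (forall r, 0 < r -> exists q, forall p p', (q <= p)%N -> (q <= p')%N -> D p p' <= r) ->
  exists s : nat -> nat, forall k, (k <= s k)%N /\
    forall l, (k <= l)%N -> D (s k) (s l) <= eta k.
Proof.
move=> eta0 H; apply: totally_bounded_cauchy => // r /H[q Hq].
by exists unit, (fun=> tt), q => p p' qp qp' _; exact: Hq.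
Qed.

End cauchy_selection.

Section midpoint_hull.
Context (R : realType) (E : lmodType R) (S : nat -> E).

(** Closure under midpoints alone is enough for the parallelogram identity, and affine properties
    pass to the hull by a direct induction. *)
Inductive mid_hull (k : nat) : E -> Prop :=
| mid_hull_base j : (k <= j)%N -> mid_hull k (S j)
| mid_hull_mid a b : mid_hull k a -> mid_hull k b ->
    mid_hull k (2^-1 *: (a + b)).

Lemma mid_hullW k l a : (k <= l)%N -> mid_hull l a -> mid_hull k a.
Proof.
move=> kl; elim=> [j lj|x y _ kx _ ky]; first by apply: mid_hull_base; exact: leq_trans lj.
exact: mid_hull_mid.
Qed.

(* Almost minimal elements of the hulls of the tails form a Cauchy sequence, by
   the parallelogram identity. *)
Lemma mid_hull_cauchy (N : E -> R) (C : R) :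
  (forall a, mid_hull 0 a -> 0 <= N a) ->
  (forall a b, mid_hull 0 a -> mid_hull 0 b ->
     N (2^-1 *: (a + b)) + 4^-1 * N (a - b) = 2^-1 * N a + 2^-1 * N b) ->
  (forall j, N (S j) <= C) ->
  exists h : nat -> E, (forall k, mid_hull k (h k)) /\
    forall r, 0 < r -> exists q, forall k l, (q <= k)%N -> (q <= l)%N ->
      N (h k - h l) <= r.
Proof.
move=> N0 par NC.
have N0k k a : mid_hull k a -> 0 <= N a by move=> /(mid_hullW (leq0n k)); exact: N0.
pose A k := [set N a | a in mid_hull k].
have A0 k : has_inf (A k).
  split; first by exists (N (S k)), (S k) => //; exact: mid_hull_base.
  by exists 0 => _ [a ha <-]; exact: N0k ha.
pose d k := inf (A k).
have dN k a : mid_hull k a -> d k <= N a.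
  by move=> ha; apply: ge_inf; [exact: (A0 k).2|exists a].
have dC k : d k <= C.
  by apply: le_trans (NC k); apply: dN; exact: mid_hull_base.
have dmono k l : (k <= l)%N -> d k <= d l.
  move=> kl; apply: lb_le_inf; first exact: (A0 l).1.
  by move=> _ [a ha <-]; apply: dN; exact: mid_hullW ha.
have H k : exists a, mid_hull k a /\ N a <= d k + k.+1%:R^-1.
  have k0 : 0 < k.+1%:R^-1 :> R by rewrite invr_gt0.
  have [_ [a ha <-] lt] := inf_adherent k0 (A0 k).
  by exists a; split=> //; exact: ltW.
exists (fun k => sval (cid (H k))); split=> [k|r r0].
  by case: cid => a [].
have hd : has_sup (range d).
  by split; [exists (d 0%N), 0%N|exists C => _ [k _ <-]].
pose s := sup (range d).
have ds k : d k <= s by apply: ub_le_sup; [exact: hd.2|exists k].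
have r8 : 0 < r / 8 by rewrite divr_gt0.
have [_ [q1 _ <-] q1s] := sup_adherent r8 hd; rewrite -/s in q1s.
pose q2 := Num.truncn (8 / r).
have q2r : q2.+1%:R^-1 <= r / 8.
  rewrite -[leRHS]invrK lef_pV2 ?posrE ?invr_gt0// invf_div.
  by apply: ltW; exact: truncnS_gt.
have small k : (q1 + q2 <= k)%N -> k.+1%:R^-1 <= r / 8.
  move=> kq; apply: le_trans q2r.
  by rewrite lef_pV2 ?posrE// ler_nat ltnS (leq_trans _ kq)// leq_addl.
exists (q1 + q2)%N.
suff W k l : (k <= l)%N -> (q1 + q2 <= k)%N -> (q1 + q2 <= l)%N ->
    forall a b, mid_hull k a -> mid_hull l b -> N a <= d k + k.+1%:R^-1 ->
    N b <= d l + l.+1%:R^-1 -> N (a - b) <= r /\ N (b - a) <= r.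
  move=> k l kq lq; case: cid => a [ha Na]; case: cid => b [hb Nb] /=.
  by have [kl|/ltnW lk] := leqP k l; [have [] := W k l kl kq lq a b ha hb Na Nb|
    have [] := W l k lk lq kq b a hb ha Nb Na].
move=> kl kq lq a b ha hb Na Nb.
have hb' := mid_hullW kl hb.
have ha0 := mid_hullW (leq0n k) ha; have hb0 := mid_hullW (leq0n l) hb.
(* Midpoints stay in the hull of the earlier tail, so their energy is at least [d k]; as [d] is
   nearly constant beyond [q1], the parallelogram identity leaves little for the difference. *)
have m1 := dN _ _ (mid_hull_mid ha hb'); have m2 := dN _ _ (mid_hull_mid hb' ha).
have p1 := par a b ha0 hb0; have p2 := par b a hb0 ha0.
have sk := small k kq; have sl := small l lq.
have dk : s - r / 8 <= d k.
  by apply: le_trans (ltW q1s) _; apply: dmono; exact: leq_trans (leq_addr _ _) kq.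
have dl := ds l.
clear -r0 m1 m2 p1 p2 sk sl dk dl Na Nb; move: r0 m1 m2 p1 p2 sk sl dk dl Na Nb.
clearbody s d.
move: (N (2^-1 *: (a + b))) (N (2^-1 *: (b + a))) (N (a - b)) (N (b - a)) (N a) (N b)
  (d k) (d l) (k.+1%:R^-1) (l.+1%:R^-1) => x1 x2 x3 x4 x5 x6 x7 x8 y1 y2.
move=> *; split; lra.
Qed.

End midpoint_hull.

(** * Limits of functions and integrals *)

Lemma cvg_EFin_comp (R : realType) (u : nat -> R) (l : R) :
  u @ \oo --> l -> (EFin \o u) @ \oo --> l%:E.
Proof. by move=> ul; apply: cvg_EFin; [exact: nearW|exact: ul]. Qed.

Section ae_convergence.
Context d (T : measurableType d) (R : realType) (mu : {measure set T -> \bar R}).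
Implicit Types f g : nat -> T -> R.

(** By monotone convergence the sum of the series is integrable, hence finite almost everywhere. *)
Lemma ae_series_cvg f : (forall k, measurable_fun setT (f k)) ->
  (forall k z, 0 <= f k z) ->
  (forall k, (\int[mu]_z (f k z)%:E <= (2^-1 ^+ k)%:E)%E) ->
  \forall z \ae mu, cvgn (series (f ^~ z)).
Proof.
move=> mf f0 If.
pose F : T -> \bar R := fun z => (\sum_(0 <= k <oo) (f k z)%:E)%E.
have mF : measurable_fun setT F.
  apply: (@ge0_emeasurable_sum _ _ _ setT (fun k z => (f k z)%:E) xpredT).
    by move=> k z _ _; rewrite lee_fin.
  by move=> k _; exact/measurable_EFinP.
have F0 z : (0 <= F z)%E by apply: nneseries_ge0 => k _ _; rewrite lee_fin.
have iF : mu.-integrable setT F.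
  apply/integrableP; split=> //.
  under eq_integral do rewrite gee0_abs//.
  rewrite /F integral_nneseries//; last by move=> k z _; rewrite lee_fin.
    apply: (@le_lt_trans _ _ (\sum_(0 <= k <oo) (2^-1 ^+ k)%:E)%E).
      apply: lee_nneseries => // k _ _; apply: integral_ge0 => z _; rewrite lee_fin//.
    have := @cvg_geometric_eseries_half R 2 0.
    rewrite (_ : (fun _ => _) = (fun k => (2^-1 ^+ k)%:E)); last first.
      by apply/funext => k; rewrite addn1 natrX exprS exprVn invfM mulrA divff ?mul1r.
    by move/cvg_lim => ->//; rewrite ltry.
  by move=> k; exact/measurable_EFinP.
have := integrable_ae measurableT iF.
apply: filterS => z /(_ I) fin.
apply: nondecreasing_is_cvgn.
  move=> i j ij; rewrite -subr_ge0 sub_series_geq//.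
  by apply: sumr_ge0 => k _.
exists (fine (F z)) => _ [i _ <-]; rewrite -lee_fin fineK//.
rewrite /series /= -sumEFin; apply: nneseries_lim_ge => k _ _.
by rewrite lee_fin.
Qed.

Lemma ae_cvg0 f : (forall k, measurable_fun setT (f k)) ->
  (forall k z, 0 <= f k z) ->
  (forall k, (\int[mu]_z (f k z)%:E <= (2^-1 ^+ k)%:E)%E) ->
  \forall z \ae mu, f ^~ z @ \oo --> 0.
Proof.
move=> mf f0 If; have := ae_series_cvg mf f0 If.
by apply: filterS => z; exact: cvg_series_cvg_0.
Qed.

Lemma cvg_of_summable (u e : nat -> R) : cvgn (series e) ->
  (forall k, 0 <= e k) ->
  (forall k, `|u k.+1 - u k| <= 2^-1 ^+ k + e k) -> cvgn u.
Proof.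
move=> ce e0 ue.
have cd : cvgn (series (fun k => u k.+1 - u k)).
  apply: normed_cvg.
  apply: (@series_le_cvg _ _ (fun k => 2^-1 ^+ k + e k)) => //.
  - by move=> k; exact: normr_ge0.
  - by move=> k /=; rewrite addr_ge0// exprn_ge0// invr_ge0.
  - have cg : cvgn (series (fun k => 2^-1 ^+ k : R)).
      have := @is_cvg_geometric_series R 1 2^-1.
      rewrite (_ : geometric 1 2^-1 = (fun k => 2^-1 ^+ k)); last first.
        by apply/funext => k /=; rewrite mul1r.
      by apply; rewrite ger0_norm ?invr_ge0// invf_lt1// ltr1n.
    rewrite (_ : series _ = series (fun k => 2^-1 ^+ k : R) \+ series e).
      exact: is_cvgD.
    by apply/funext => k; rewrite /series /= big_split.
have -> : u = (fun k => u 0%N + series (fun k => u k.+1 - u k) k).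
  by apply/funext => k; rewrite /series /= telescope_sumr// subrKC.
by apply: is_cvgD => //; exact: is_cvg_cst.
Qed.

(** A total substitute for the limit: measurable in a parameter without any convergence, equal to
    the limit where there is one and, being a lower limit, subject to the bounds of the sequence
    even where there is none. *)
Definition limval (u : nat -> R) : R := fine (limn_einf (EFin \o u)).

Lemma limvalE u (l : R) : u @ \oo --> l -> limval u = l.
Proof.
move=> ul; rewrite /limval.
have /cvg_limn_einf_sup[-> _] : (EFin \o u) @ \oo --> l%:E; last by [].
exact: cvg_EFin_comp.
Qed.

Lemma measurable_limval f : (forall k, measurable_fun setT (f k)) ->
  measurable_fun setT (fun z => limval (f ^~ z)).
Proof.
move=> mf; apply: (measurableT_comp (fine_measurable _)) => //.
apply: measurableT_comp => //.
apply: measurable_fun_limn_esup => k.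
by apply: measurableT_comp => //; exact/measurable_EFinP.
Qed.

Lemma limval_bounds u (a b : R) : (forall k, a <= u k <= b) ->
  (limval u)%:E = limn_einf (EFin \o u) /\ a <= limval u <= b.
Proof.
move=> uab.
have l1 : (a%:E <= limn_einf (EFin \o u))%E.
  rewrite limn_einf_lim; apply: lime_ge; first exact: is_cvg_einfs.
  apply: nearW => k; apply: le_ereal_inf_tmp => _ [j _ <-].
  by rewrite lee_fin; have /andP[] := uab j.
have l2 : (limn_einf (EFin \o u) <= b%:E)%E.
  rewrite limn_einf_lim; apply: lime_le; first exact: is_cvg_einfs.
  apply: nearW => k; apply: (@le_trans _ _ (u k)%:E).
    by apply: ereal_inf_lbound; exists k => //=.
  by rewrite lee_fin; have /andP[] := uab k.
have fn : limn_einf (EFin \o u) \is a fin_num.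
  by rewrite fin_numE; apply/andP; split; apply/eqP => E; move: l1 l2; rewrite E.
split; first by rewrite /limval fineK.
by rewrite -!lee_fin /limval fineK// l1 l2.
Qed.

Lemma fatou_le f (g : T -> R) (c : \bar R) : (forall k, measurable_fun setT (f k)) ->
  measurable_fun setT g -> (forall k z, 0 <= f k z) -> (forall z, 0 <= g z) ->
  (\forall z \ae mu, f ^~ z @ \oo --> g z) ->
  (\forall k \near \oo, (\int[mu]_z (f k z)%:E <= c)%E) ->
  (\int[mu]_z (g z)%:E <= c)%E.
Proof.
move=> mf mg f0 g0 fg fc.
have -> : (\int[mu]_z (g z)%:E = \int[mu]_z limn_einf (fun k => (f k z)%:E))%E.
  apply: ge0_ae_eq_integral => //.
  - exact/measurable_EFinP.
  - apply: measurableT_comp => //; apply: measurable_fun_limn_esup => k.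
    by apply: measurableT_comp => //; exact/measurable_EFinP.
  - by move=> z _; rewrite lee_fin.
  - move=> z _; rewrite limn_einf_lim; apply: lime_ge; first exact: is_cvg_einfs.
    apply: nearW => k; apply: le_ereal_inf_tmp => _ [j _ <-].
    by rewrite lee_fin.
  - apply: filterS fg => z /= fz _.
    have /cvg_limn_einf_sup[-> _]// : (EFin \o f ^~ z) @ \oo --> (g z)%:E.
    exact: cvg_EFin_comp.
apply: le_trans (fatou mu measurableT _ _) _.
- by move=> k; exact/measurable_EFinP.
- by move=> k z _; rewrite lee_fin.
rewrite limn_einf_lim; apply: lime_le; first exact: is_cvg_einfs.
near=> k; apply: (@le_trans _ _ (\int[mu]_z (f k z)%:E)%E).
  by apply: ereal_inf_lbound; exists k => //=.
by near: k.
Unshelve. all: by end_near. Qed.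

Lemma Rdominated f (h g : T -> R) : (forall k, measurable_fun setT (f k)) ->
  measurable_fun setT h -> (\forall z \ae mu, f ^~ z @ \oo --> h z) ->
  (forall k z, `|f k z| <= g z) -> mu.-integrable setT (EFin \o g) ->
  mu.-integrable setT (EFin \o h) /\
  (\int[mu]_z f k z) @[k --> \oo] --> \int[mu]_z h z.
Proof.
move=> mf mh fh fg ig.
have fh' : {ae mu, forall z, setT z -> (fun k => (f k z)%:E) @ \oo --> (h z)%:E}.
  by apply: filterS fh => z fz _; exact: cvg_EFin_comp.
have fg' : {ae mu, forall z k, setT z -> (`|(f k z)%:E| <= (g z)%:E)%E}.
  by apply: nearW => z k _; rewrite /= lee_fin.
have [ih _ cv] := dominated_convergence measurableT
  (fun k => (measurable_EFinP _ _).2 (mf k)) ((measurable_EFinP _ _).2 mh) fh' ig fg'.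
split=> //; apply: fine_cvg; rewrite fineK//; exact: integrable_fin_num.
Qed.

End ae_convergence.

(** * Step functions on space-time grids *)

Section finite_steps.
Context d (T : measurableType d) (R : realType) (mu : {measure set T -> \bar R}).
Variables (I : finType) (S : I -> set T) (a : I -> R).
Hypothesis mS : forall i, measurable (S i).

Lemma measurable_step : measurable_fun setT (fun z => \sum_i a i * \1_(S i) z).
Proof.
by apply: measurable_sum => i; apply: measurable_funM.
Qed.

Lemma step_weighted (g : T -> R) : mu.-integrable setT (EFin \o g) ->
  mu.-integrable setT (EFin \o (fun z => \sum_i a i * (g z * \1_(S i) z))) /\
  \int[mu]_z (\sum_i a i * (g z * \1_(S i) z)) =
  \sum_i a i * \int[mu]_(z in S i) g z.
Proof.
move=> ig.
have i1 i : mu.-integrable setT (fun z => (g z * \1_(S i) z)%:E).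
  have /(integrable_restrict mu (mS i) measurableT) : mu.-integrable (setT `&` S i) (EFin \o g).
    rewrite setTI; exact: integrableS ig.
  apply: eq_integrable => // z _; rewrite /= restrict_EFin patch_indic//.
have i2 i : mu.-integrable setT (fun z => (a i * (g z * \1_(S i) z))%:E).
  by under eq_fun do rewrite EFinM; exact: integrableZl.
have E : EFin \o (fun z => \sum_i a i * (g z * \1_(S i) z)) =
    (fun z => (\sum_i (a i * (g z * \1_(S i) z))%:E)%E).
  by apply/funext => z /=; rewrite sumEFin.
split; first by rewrite E; exact: integrable_sum.
rewrite /Rintegral -[X in fine (integral _ _ X)]/(EFin \o _) E integral_sum//.
rewrite -sum_fine; last by move=> i _; exact: integrable_fin_num.
apply: eq_bigr => i _.
rewrite -[LHS]/(\int[mu]_z (a i * (g z * \1_(S i) z))) RintegralZl//; last exact: i1.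
congr (_ * _); rewrite [RHS]Rintegral_mkcond; apply: eq_Rintegral => z _.
by rewrite patch_indic.
Qed.

Lemma step_integral (w : R) : (forall i, mu (S i) = w%:E) ->
  mu.-integrable setT (EFin \o (fun z => \sum_i a i * \1_(S i) z)) /\
  \int[mu]_z (\sum_i a i * \1_(S i) z) = w * \sum_i a i.
Proof.
move=> muS.
have i1 i : mu.-integrable setT (fun z => (\1_(S i) z)%:E).
  apply/integrableP; split; first exact/measurable_EFinP.
  under eq_integral do rewrite gee0_abs ?lee_fin//.
  by rewrite integral_indic// setIT muS ltry.
have i2 i : mu.-integrable setT (fun z => (a i * \1_(S i) z)%:E).
  by under eq_fun do rewrite EFinM; exact: integrableZl.
have E : EFin \o (fun z => \sum_i a i * \1_(S i) z) =
    (fun z => (\sum_i (a i * \1_(S i) z)%:E)%E).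
  by apply/funext => z /=; rewrite sumEFin.
split; first by rewrite E; exact: integrable_sum.
rewrite /Rintegral -[X in fine (integral _ _ X)]/(EFin \o _) E integral_sum//.
rewrite -sum_fine; last by move=> i _; exact: integrable_fin_num.
rewrite mulr_sumr; apply: eq_bigr => i _.
rewrite -[LHS]/(\int[mu]_z (a i * \1_(S i) z)) RintegralZl//; last exact: i1.
by rewrite /Rintegral integral_indic// setIT muS mulrC.
Qed.

End finite_steps.

Section continuum_grid.
Context (R : realType) (n : nat).
Local Notation Rn := 'rV[R]_n.
Local Notation mu := (lebesgue_rV R n).

(** One less than the number of points per axis, since the group structure is on ['I_N.+1];
    [2 * 4 ^ p] cells of side 2^-p fill a length [2 * 2 ^+ p]. *)
Definition gsize p := (2 * 4 ^ p).-1.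
Local Notation GX p := 'rV['I_(gsize p).+1]_n.

Lemma gsizeS p : (gsize p).+1 = (2 * 4 ^ p)%N.
Proof. by rewrite prednK// muln_gt0 expn_gt0. Qed.

Definition eps p : R := 2^-1 ^+ p.

Lemma eps_gt0 p : 0 < eps p.
Proof. by rewrite exprn_gt0// invr_gt0. Qed.

Lemma eps_le1 p : eps p <= 1.
Proof. by rewrite exprn_ile1// ?invr_ge0// invf_le1// ler1n. Qed.

Lemma epsE p : eps p * 2 ^+ p = 1.
Proof. by rewrite /eps -exprMn mulVf// expr1n. Qed.

Lemma gsizeE p : (gsize p).+1%:R * eps p = 2 * 2 ^+ p :> R.
Proof.
rewrite gsizeS natrM natrX (_ : 4%:R = 2 * 2 :> R); last by rewrite -natrM.
by rewrite exprMn -2!mulrA [2 ^+ p * eps p]mulrC epsE mulr1.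
Qed.

Definition gpos p (x : GX p) : Rn := \row_i (- 2 ^+ p + (x 0 i)%:R * eps p).

Definition inbox p (y : Rn) := [forall i, - 2 ^+ p <= y 0 i < 2 ^+ p].

(** Meaningful in the box only; outside it the value is arbitrary, and [spst] discards it. *)
Definition cell p (y : Rn) : GX p :=
  \row_i inord (Num.truncn ((y 0 i + 2 ^+ p) * 2 ^+ p)).

Definition cellset p (x : GX p) : set Rn :=
  [set y | forall i, gpos x 0 i <= y 0 i < gpos x 0 i + eps p].

Lemma cellsetP p (x : GX p) y : cellset x y <-> inbox p y /\ cell p y = x.
Proof.
have p2 : 0 < 2 ^+ p :> R by rewrite exprn_gt0.
split=> [H|[/forallP yb <-] i].
  split.
    apply/forallP => i; have := H i; rewrite mxE => /andP[h1 h2].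
    apply/andP; split.
      by apply: le_trans h1; rewrite lerDl mulr_ge0// ltW// eps_gt0.
    apply: lt_le_trans h2 _.
    have key : (x 0 i).+1%:R * eps p <= 2 * 2 ^+ p.
      rewrite -gsizeE; apply: ler_wpM2r; first exact/ltW/eps_gt0.
      by rewrite ler_nat.
    by move: key; rewrite -[(x 0 i).+1%:R]natr1 [(_ + 1) * _]mulrDl mul1r; lra.
  apply/rowP => i; rewrite mxE; have := H i; rewrite mxE => /andP[h1 h2].
  rewrite (@truncn_def _ _ (x 0 i)) ?inord_val//.
  have E : (y 0 i + 2 ^+ p) * 2 ^+ p * eps p = y 0 i + 2 ^+ p.
    by rewrite -mulrA [2 ^+ p * _]mulrC epsE mulr1.
  rewrite -[(x 0 i).+1%:R]natr1 -(ler_pM2r (eps_gt0 p)) -(ltr_pM2r (eps_gt0 p)) E [(_ + 1) * _]mulrDl.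
  by rewrite mul1r; apply/andP; split; lra.
rewrite !mxE; have /andP[h1 h2] := yb i.
set v := (y 0 i + 2 ^+ p) * 2 ^+ p.
have v0 : 0 <= v by rewrite mulr_ge0 ?(ltW p2)//; lra.
have /andP[k1 k2] := truncn_itv v0.
have vN : (Num.truncn v < (gsize p).+1)%N.
  rewrite -(ltr_nat R); apply: le_lt_trans k1 _.
  rewrite -(ltr_pM2r (eps_gt0 p)) gsizeE /v -mulrA [2 ^+ p * _]mulrC epsE; lra.
rewrite inordK//; move: k1 k2; rewrite -[(Num.truncn v).+1%:R]natr1.
have E : v * eps p = y 0 i + 2 ^+ p.
  by rewrite -mulrA [2 ^+ p * _]mulrC epsE mulr1.
rewrite -(ler_pM2r (eps_gt0 p)) -(ltr_pM2r (eps_gt0 p)) E [(_ + 1) * _]mulrDl mul1r.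
move=> k1 k2.
by apply/andP; split; lra.
Qed.

Lemma measurable_cellset p (x : GX p) : measurable (cellset x).
Proof.
rewrite (_ : cellset x = \bigcap_(i in setT)
   [set y : Rn | `[gpos x 0 i, (gpos x 0 i + eps p)[%classic (y 0 i)]); last first.
  apply/seteqP; split => y H i; first by move=> _ /=; rewrite in_itv/=; exact: H.
  by have := H i I; rewrite /= in_itv.
apply: fin_bigcap_measurable => // i _.
rewrite -[X in measurable X]setTI; exact: measurable_coord.
Qed.

Lemma mu_cellset p (x : GX p) : mu (cellset x) = (eps p ^+ n)%:E.
Proof.
rewrite (_ : cellset x = [set y : Rn | forall i,
   `[gpos x 0 i, (gpos x 0 i + eps p)[%classic (y 0 i)]); last first.
  by apply/seteqP; split => y H i; have := H i; rewrite /= in_itv.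
rewrite (lebesgue_rV_box (A := fun i => `[gpos x 0 i, (gpos x 0 i + eps p)[%classic))//.
under eq_bigr do rewrite lebesgue_measure_itv /= lte_fin ltrDl eps_gt0 -EFinB addrC addKr.
by rewrite prodEFin prodr_const card_ord.
Qed.

Definition spst p (a : GX p -> R) (y : Rn) := if inbox p y then a (cell p y) else 0.

Lemma spst_sum p a y : spst a y = \sum_(x : GX p) a x * \1_(cellset x) y.
Proof.
rewrite /spst; case: ifPn => yb; last first.
  rewrite big1// => x _; rewrite indicE memNset ?mulr0// => /cellsetP[].
  by rewrite (negbTE yb).
rewrite (bigD1 (cell p y))//= indicE mem_set; last exact/cellsetP.
rewrite mulr1 big1 ?addr0// => x xy; rewrite indicE memNset ?mulr0//.
by move=> /cellsetP[_ E]; rewrite E eqxx in xy.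
Qed.

Lemma measurable_spst p (a : GX p -> R) : measurable_fun setT (spst a).
Proof.
rewrite (_ : spst a = fun y => \sum_x a x * \1_(cellset x) y); last first.
  by apply/funext => y; exact: spst_sum.
by apply: measurable_step => x; exact: measurable_cellset.
Qed.

Lemma spst_integral p (a : GX p -> R) : mu.-integrable setT (EFin \o spst a) /\
  \int[mu]_y spst a y = eps p ^+ n * \sum_x a x.
Proof.
rewrite (_ : spst a = fun y => \sum_x a x * \1_(cellset x) y); last first.
  by apply/funext => y; exact: spst_sum.
by apply: step_integral => x; [exact: measurable_cellset|exact: mu_cellset].
Qed.

Lemma spst_weighted p (a : GX p -> R) (g : Rn -> R) :
  mu.-integrable setT (EFin \o g) ->
  mu.-integrable setT (fun y => (g y * spst a y)%:E) /\
  \int[mu]_y (g y * spst a y) = \sum_x a x * \int[mu]_(y in cellset x) g y.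
Proof.
move=> ig.
rewrite (_ : (fun y => _) = EFin \o (fun y => \sum_x a x * (g y * \1_(cellset x) y))).
  rewrite (_ : \int[mu]_y (g y * spst a y) =
    \int[mu]_y (\sum_x a x * (g y * \1_(cellset x) y))).
    by apply: step_weighted => // x; exact: measurable_cellset.
  apply: eq_Rintegral => y _; rewrite spst_sum mulr_sumr.
  by apply: eq_bigr => x _; rewrite mulrCA.
apply/funext => y /=; rewrite spst_sum mulr_sumr.
by congr EFin; apply: eq_bigr => x _; rewrite mulrCA.
Qed.

Variables (T : R) (A : nat).
Hypotheses (T_gt0 : 0 < T) (A_gt0 : (0 < A)%N).
Local Notation leb := (@lebesgue_measure R).
Local Notation P := (lebesgue_measure \x mu)%E.
Local Notation Z := (measurableTypeR R * Rn)%type.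

(** With this number of steps the ratio of [tau] to the squared mesh is [T / A] for every [p], so
    the CFL condition reduces to taking [A] large. *)
Definition nsteps p := (A * 4 ^ p)%N.
Definition tau p : R := T / (nsteps p)%:R.

Lemma nsteps_gt0 p : (0 < nsteps p)%N.
Proof. by rewrite muln_gt0 A_gt0 expn_gt0. Qed.

Lemma tau_gt0 p : 0 < tau p.
Proof. by rewrite divr_gt0// ltr0n nsteps_gt0. Qed.

Lemma nsteps_tau p : (nsteps p)%:R * tau p = T.
Proof. by rewrite mulrC divfK// pnatr_eq0 -lt0n nsteps_gt0. Qed.

Lemma tauE p : tau p = T / A%:R * eps p ^+ 2.
Proof.
rewrite /tau /nsteps natrM natrX invfM mulrA; congr (_ * _).
rewrite /eps -exprM mulnC exprM -exprVn; congr (_ ^+ _).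
by rewrite expr2 -invfM -natrM.
Qed.

Definition intime (t : R) := 0 < t < T.
Definition tcell p (t : R) := Num.truncn (t / tau p).
Definition tset p (k : nat) : set R :=
  [set t | intime t /\ tcell p t = k].

Lemma tcell_itv p t : 0 < t -> (tcell p t)%:R * tau p <= t < (tcell p t).+1%:R * tau p.
Proof.
move=> t0; have := truncn_itv (divr_ge0 (ltW t0) (ltW (tau_gt0 p))).
by rewrite ler_pdivlMr ?tau_gt0// ltr_pdivrMr ?tau_gt0.
Qed.

Lemma tcell_lt p t : intime t -> (tcell p t < nsteps p)%N.
Proof.
move=> /andP[t0 tT]; have /andP[h _] := tcell_itv p t0.
rewrite -(ltr_nat R) -(ltr_pM2r (tau_gt0 p)) nsteps_tau.
exact: le_lt_trans h tT.
Qed.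

Lemma tsetE p k : (k < nsteps p)%N ->
  tset p k = [set` if k == 0%N then `]0, (tau p)[%R
              else `[k%:R * tau p, k.+1%:R * tau p[%R].
Proof.
move=> kK; have tp := tau_gt0 p.
have kT : k.+1%:R * tau p <= T by rewrite -(nsteps_tau p) ler_pM2r// ler_nat.
apply/seteqP; split => t /=.
  move=> [/andP[t0 tT] <-]; have := tcell_itv p t0.
  by case: eqP => [->|_]; rewrite in_itv/= // mul1r t0 => /andP[].
have key : 0 < t -> k%:R * tau p <= t < k.+1%:R * tau p -> intime t /\ tcell p t = k.
  move=> t0 /andP[h1 h2]; rewrite /intime t0 (lt_le_trans h2 kT); split=> //.
  by apply: truncn_def; rewrite ler_pdivlMr// ltr_pdivrMr// h1.
case: eqP => [k0|/eqP k0]; rewrite in_itv/=.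
  by move=> /andP[t0 tt]; apply: key => //; rewrite k0 mul0r mul1r (ltW t0).
move=> /andP[h1 h2]; apply: key; last by rewrite h1.
by apply: lt_le_trans h1; rewrite mulr_gt0// ltr0n lt0n.
Qed.

Lemma measurable_tset p (k : 'I_(nsteps p)) : measurable (tset p k : set (measurableTypeR R)).
Proof. by rewrite tsetE//; exact: measurable_itv. Qed.

Lemma leb_tset p (k : 'I_(nsteps p)) : leb (tset p k) = (tau p)%:E.
Proof.
have tp := tau_gt0 p; rewrite tsetE// lebesgue_measure_itv; case: eqP => _ /=.
  by rewrite lte_fin tp -EFinB subr0.
rewrite lte_fin ltr_pM2r// ltr_nat ltnSn -EFinB -natr1 mulrDl mul1r.
by rewrite addrC addKr.
Qed.

Definition stst p (a : nat -> GX p -> R) (z : Z) :=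
  if intime z.1 then spst (a (tcell p z.1)) z.2 else 0.

Lemma stst_sum p (a : nat -> GX p -> R) z : stst a z =
  \sum_(i : 'I_(nsteps p) * GX p) a i.1 i.2 * \1_(tset p i.1 `*` cellset i.2) z.
Proof.
rewrite /stst; case: ifPn => zt; last first.
  rewrite big1// => -[k x] _; rewrite indicE memNset ?mulr0//= => -[[]].
  by rewrite (negbTE zt).
rewrite -(pair_big xpredT xpredT (fun (k : 'I_(nsteps p)) (x : GX p) =>
  a k x * \1_(tset p k `*` cellset x) z))/=.
rewrite (bigD1 (Ordinal (tcell_lt p zt)))//= [X in _ + X]big1 ?addr0.
  rewrite spst_sum; apply: eq_bigr => x _; congr (_ * _); rewrite !indicE.
  congr (_%:R); congr nat_of_bool; apply/idP/idP; rewrite !inE => H.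
    by split.
  by case: H.
move=> k kn; rewrite big1// => x _; rewrite indicE memNset ?mulr0//= => -[[_ E] _].
by move/eqP: kn; apply; apply: val_inj.
Qed.

Lemma measurable_tsetX p (i : 'I_(nsteps p) * GX p) :
  measurable (tset p i.1 `*` cellset i.2 : set Z).
Proof. by apply: measurableX; [exact: measurable_tset|exact: measurable_cellset]. Qed.

Lemma measurable_stst p (a : nat -> GX p -> R) : measurable_fun setT (stst a).
Proof.
rewrite (funext (stst_sum a)).
exact: (@measurable_step _ Z R ('I_(nsteps p) * GX p)%type
  (fun i => (tset p i.1 `*` cellset i.2 : set Z)) (fun i => a i.1 i.2)
  (@measurable_tsetX p)).
Qed.

Lemma stst_integral p (a : nat -> GX p -> R) : P.-integrable setT (EFin \o stst a) /\
  \int[P]_z stst a z = tau p * (eps p ^+ n * \sum_(k < nsteps p) \sum_x a k x).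
Proof.
rewrite (funext (stst_sum a)).
rewrite pair_big/= mulrA.
apply: (@step_integral _ Z R P ('I_(nsteps p) * GX p)%type (fun i => (tset p i.1 `*` cellset i.2 : set Z))
  (fun i => a i.1 i.2) (@measurable_tsetX p)) => -[k x] /=.
rewrite product_measure1E; [|exact: measurable_tset|exact: measurable_cellset].
by rewrite [X in (X * _)%E](leb_tset k) [X in (_ * X)%E](mu_cellset x) -EFinM.
Qed.

End continuum_grid.

(** * Powers *)

Section powers.
Context (R : realType).
Implicit Types a b m : R.

Lemma powR_split a m : 1 <= m -> 0 <= a -> a `^ m = a * a `^ (m - 1).
Proof.
move=> m1 a0; rewrite -[in LHS](subrKC 1 m) [LHS]powRD ?powRr1//.
by rewrite subrKC; apply/implyP => /eqP m0; move: m1; rewrite m0 ler10.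
Qed.

Lemma powR_superadd a b m : 1 <= m -> 0 <= a -> 0 <= b ->
  a `^ m + b `^ m <= (a + b) `^ m.
Proof.
move=> m1 a0 b0; have ab0 := addr_ge0 a0 b0.
rewrite (powR_split m1 a0) (powR_split m1 b0) (powR_split m1 ab0) mulrDl.
have m10 : 0 <= m - 1 by rewrite subr_ge0.
by apply: lerD; apply: ler_wpM2l => //; apply: ge0_ler_powR; rewrite ?nnegrE// ?lerDl ?lerDr.
Qed.

Lemma powR_dist a b m : 1 <= m -> 0 <= a -> 0 <= b ->
  `|a - b| `^ m <= `|a `^ m - b `^ m|.
Proof.
move=> m1.
have W (x y : R) : 0 <= x -> x <= y -> `|y - x| `^ m <= `|y `^ m - x `^ m|.
  move=> x0 xy; rewrite ger0_norm ?subr_ge0//.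
  apply: le_trans (ler_norm _); rewrite lerBrDr -[in leRHS](subrK x y).
  by apply: powR_superadd => //; rewrite subr_ge0.
move=> a0 b0; have [ab|/ltW ba] := leP a b; last exact: W.
by rewrite distrC [leRHS]distrC; exact: W.
Qed.

(** Bernoulli's inequality for the ratio [q = a / b] at an integer exponent [M] above [m] replaces
    the mean value theorem, at the price of [M] instead of [m] in the constant. *)
Lemma powR_lip a b m B : 1 <= m -> 0 <= a -> a <= b -> b <= B ->
  b `^ m - a `^ m <= (Num.truncn m).+1%:R * B `^ (m - 1) * (b - a).
Proof.
move=> m1 a0 ab bB.
have b0 : 0 <= b := le_trans a0 ab.
have [b0'|b_gt0] := eqVneq b 0.
  have -> : a = 0 by apply/eqP; rewrite eq_le a0 -b0' ab.
  by rewrite b0' subrr subrr mulr0.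
have {}b_gt0 : 0 < b by rewrite lt_neqAle eq_sym b_gt0.
set M := (Num.truncn m).+1.
have mM : m <= M%:R by rewrite ltW// truncnS_gt.
pose q := a / b.
have q0 : 0 <= q by rewrite divr_ge0.
have q1 : q <= 1 by rewrite ler_pdivrMr// mul1r.
have aE : a = b * q by rewrite mulrC divfK// gt_eqF.
have bern : 1 - M%:R * (1 - q) <= q ^+ M.
  elim: (M) => [|k IH]; first by rewrite mul0r subr0 expr0.
  rewrite exprS; apply: le_trans (ler_wpM2l q0 IH).
  rewrite -natr1 -subr_ge0.
  rewrite (_ : _ - _ = k%:R * (1 - q) ^+ 2); first by rewrite mulr_ge0// sqr_ge0.
  by ring.
have qm : q ^+ M <= q `^ m.
  rewrite -powR_mulrn//; have [->|qn0] := eqVneq q 0.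
    by rewrite !powR0 ?gt_eqF// (lt_le_trans ltr01).
  by rewrite -[leRHS]/(q `^ m); apply: ger_powR => //; rewrite lt_neqAle eq_sym qn0 q0.
rewrite [in leLHS]aE powRM// -{1}[b `^ m]mulr1 -mulrBr.
apply: (@le_trans _ _ (b `^ m * (M%:R * (1 - q)))).
  by apply: ler_wpM2l; [exact: powR_ge0|lra].
rewrite (powR_split m1 b0).
rewrite (_ : _ * (M%:R * _) = M%:R * b `^ (m - 1) * (b - b * q)); last by ring.
rewrite -aE; apply: ler_wpM2r; first by rewrite subr_ge0.
apply: ler_wpM2l => //; apply: ge0_ler_powR; rewrite ?nnegrE ?subr_ge0//.
exact: le_trans bB.
Qed.

Lemma powR_low a b m l : 1 <= m -> 0 <= l -> l <= a -> a <= b ->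
  l `^ (m - 1) * (b - a) <= b `^ m - a `^ m.
Proof.
move=> m1 l0 la ab; have a0 := le_trans l0 la; have b0 := le_trans a0 ab.
have m10 : 0 <= m - 1 by rewrite subr_ge0.
rewrite (powR_split m1 a0) (powR_split m1 b0).
have h1 : l `^ (m - 1) <= b `^ (m - 1).
  by apply: ge0_ler_powR; rewrite ?nnegrE//; exact: le_trans ab.
have h2 : a `^ (m - 1) <= b `^ (m - 1) by apply: ge0_ler_powR; rewrite ?nnegrE.
apply: (@le_trans _ _ (b `^ (m - 1) * (b - a))).
  by apply: ler_wpM2r; rewrite // subr_ge0.
have := ler_wpM2l a0 h2; lra.
Qed.

Lemma powR_le_lin a m B : 1 <= m -> 0 <= a -> a <= B ->
  a `^ m <= B `^ (m - 1) * a.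
Proof.
move=> m1 a0 aB; rewrite (powR_split m1 a0) mulrC; apply: ler_wpM2r => //.
by apply: ge0_ler_powR; rewrite ?nnegrE ?subr_ge0//; exact: le_trans aB.
Qed.

(** The inverse power need not be Lipschitz at 0, but by [powR_dist] two values more than [delta]
    apart have m-th powers at least delta^m apart. The gap is measured in two ways, by squares for
    differences in space and by products for differences in time. *)
Lemma powR_modulus m B delta : 1 <= m -> 0 < delta -> 0 < B ->
  exists Md, 0 <= Md /\ (forall a b, 0 <= a <= B -> 0 <= b <= B ->
     `|a - b| <= delta + Md * (a `^ m - b `^ m) ^+ 2 /\
     0 <= (a - b) * (a `^ m - b `^ m) /\
     `|a - b| <= delta + Md * ((a - b) * (a `^ m - b `^ m))).
Proof.
move=> m1 d0 B0; set D := delta `^ m.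
have D0 : 0 < D by rewrite powR_gt0.
exists (B / D ^+ 2 + D^-1).
have i1 : 0 <= B / D ^+ 2 by rewrite divr_ge0 ?sqr_ge0// ltW.
have i2 : 0 <= D^-1 by rewrite invr_ge0 ltW.
split=> [|a b /andP[a0 aB] /andP[b0 bB]]; first exact: addr_ge0.
have prod : (a - b) * (a `^ m - b `^ m) = `|a - b| * `|a `^ m - b `^ m|.
  have m0 : 0 <= m by exact: le_trans m1.
  have [ab|/ltW ba] := leP a b.
    have h : a `^ m <= b `^ m by apply: ge0_ler_powR; rewrite ?nnegrE.
    by rewrite !ler0_norm ?subr_le0// mulrNN.
  have h : b `^ m <= a `^ m by apply: ge0_ler_powR; rewrite ?nnegrE.
  by rewrite !ger0_norm ?subr_ge0.
have sq : (a `^ m - b `^ m) ^+ 2 = `|a `^ m - b `^ m| ^+ 2.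
  by rewrite real_normK ?num_real.
rewrite prod sq.
have dist := powR_dist m1 a0 b0.
set x := `|a - b| in dist *; set y := `|a `^ m - b `^ m| in dist *.
have x0 : 0 <= x by exact: normr_ge0.
have y0 : 0 <= y by exact: normr_ge0.
have xB : x <= B by rewrite /x ler_norml; lra.
have s1 : 0 <= (B / D ^+ 2 + D^-1) * y ^+ 2 by rewrite mulr_ge0 ?sqr_ge0// addr_ge0.
have s2 : 0 <= (B / D ^+ 2 + D^-1) * (x * y) by rewrite mulr_ge0 ?mulr_ge0// addr_ge0.
have [xd|dx] := leP x delta.
  by split; [lra|split; [exact: mulr_ge0|lra]].
have Dy : D <= y.
  apply: le_trans dist; apply: ge0_ler_powR; rewrite ?nnegrE ?(ltW d0) ?(ltW dx)//.
  exact: le_trans m1.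
have e1 : x <= B / D ^+ 2 * y ^+ 2.
  apply: le_trans xB _; rewrite mulrAC ler_pdivlMr ?exprn_gt0//.
  by apply: ler_wpM2l; [exact: ltW|rewrite lerXn2r ?nnegrE ?(ltW D0)].
have e2 : x <= D^-1 * (x * y).
  by rewrite ler_pdivlMl// mulrC; apply: ler_wpM2l.
have f1 : 0 <= D^-1 * y ^+ 2 by exact: mulr_ge0 i2 (sqr_ge0 _).
have f2 : 0 <= B / D ^+ 2 * (x * y) by exact: mulr_ge0 i1 (mulr_ge0 x0 y0).
split; first by rewrite mulrDl; lra.
by split; [exact: mulr_ge0|rewrite mulrDl; lra].
Qed.

(* The exponent condition [alpha < m + 2 / n] makes the diffusion dominate the
   reaction at high levels [B]. *)
Lemma exists_level (n : nat) (m alpha chi M0 b0 : R) : (0 < n)%N ->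
  1 <= m -> 1 <= alpha -> alpha < m + 2 / n%:R -> 0 < chi -> 0 < M0 ->
  exists B s0, [/\ 0 < B, b0 <= B / 4, 0 < s0 <= 1, 256 * M0 / B <= s0 ^+ n &
    256 * n%:R * (chi * M0 * B `^ (alpha - 1) * B) * s0 ^+ 2 <=
      2^-1 ^+ n.+2 * (B / 4) `^ (m - 1) * B].
Proof.
move=> n0 m1 a1 am chi0 M00.
have nR : 0 < n%:R :> R by rewrite ltr0n.
pose g := m + 2 / n%:R - alpha.
have g0 : 0 < g by rewrite subr_gt0.
pose C1 := 256 * n%:R * (chi * M0) * ((256 * M0) `^ (2 / n%:R)).
pose C2 := 2^-1 ^+ n.+2 * 4^-1 `^ (m - 1).
have C10 : 0 < C1 by rewrite !mulr_gt0// powR_gt0// mulr_gt0.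
have C20 : 0 < C2 by rewrite mulr_gt0 ?exprn_gt0 ?invr_gt0// powR_gt0// invr_gt0.
(* The entries with [b0] and [M0] give [b0 <= B / 4] and [s0 <= 1]. The last one gives C1 <= C2 B^g,
   which is the final inequality divided by B^(alpha - 2/n); the exponent [g] is positive by the
   condition on [alpha]. *)
pose B := Num.max (Num.max (4 * b0) (256 * M0)) (Num.max 1 ((C1 / C2) `^ g^-1)).
have B1 : 1 <= B by rewrite /B !le_max lexx !orbT.
have B0 : 0 < B by exact: lt_le_trans B1.
have Bb : 4 * b0 <= B by rewrite /B !le_max lexx.
have BM : 256 * M0 <= B by rewrite /B !le_max lexx !orbT.
have BC : (C1 / C2) `^ g^-1 <= B by rewrite /B !le_max lexx !orbT.
have Bg : C1 <= C2 * B `^ g.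
  rewrite mulrC -ler_pdivrMr//.
  have -> : C1 / C2 = ((C1 / C2) `^ g^-1) `^ g.
    by rewrite -powRrM mulVf ?gt_eqF// powRr1// divr_ge0 ?ltW.
  by apply: ge0_ler_powR; rewrite ?nnegrE ?powR_ge0 ?(ltW B0) ?(ltW g0).
have q0 : 0 < 256 * M0 / B by rewrite divr_gt0// mulr_gt0.
(* The smallest admissible length, with equality in [256 * M0 / B <= s0 ^+ n]. *)
exists B, ((256 * M0 / B) `^ n%:R^-1); split=> //.
- lra.
- apply/andP; split; first exact: powR_gt0.
  have p1 : 1 `^ n%:R^-1 = 1 :> R by rewrite powR1.
  rewrite -[leRHS]p1.
  apply: ge0_ler_powR; rewrite ?nnegrE ?invr_ge0 ?(ltW q0)//.
  by rewrite ler_pdivrMr// mul1r.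
- by rewrite -powR_mulrn ?powR_ge0// -powRrM mulVf ?gt_eqF// powRr1// ltW.
have -> : ((256 * M0 / B) `^ n%:R^-1) ^+ 2 =
    (256 * M0) `^ (2 / n%:R) * B `^ (- (2 / n%:R)).
  rewrite -powR_mulrn ?powR_ge0// -powRrM.
  rewrite powRM ?invr_ge0 ?(ltW B0) ?mulr_ge0 ?(ltW M00)//.
  rewrite [n%:R^-1 * 2]mulrC; congr (_ * _).
  by rewrite -[B^-1]powR_inv1 ?(ltW B0)// -powRrM mulN1r.
have -> : (B / 4) `^ (m - 1) = B `^ (m - 1) * 4^-1 `^ (m - 1).
  by rewrite powRM ?invr_ge0 ?(ltW B0).
have E : B `^ (alpha - 1) * B `^ (- (2 / n%:R)) * B `^ g = B `^ (m - 1).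
  have Bn (t : R) : (t == 0) ==> (B != 0) by rewrite (gt_eqF B0) implybT.
  rewrite -!powRD ?Bn//.
  by congr (_ `^ _); rewrite /g; ring.
rewrite -E.
have h0 : 0 <= B `^ (alpha - 1) * B `^ (- (2 / n%:R)) * B.
  by rewrite !mulr_ge0 ?powR_ge0 ?(ltW B0).
have := ler_wpM2l h0 Bg; rewrite /C1 /C2.
set x1 := B `^ g; set x2 := B `^ (alpha - 1); set x3 := B `^ (- _).
set x4 := 4^-1 `^ (m - 1); set x5 := (256 * M0) `^ _; set x6 := 2^-1 ^+ n.+2.
clearbody x1 x2 x3 x4 x5 x6; clear => h.
apply: le_trans (_ : _ <= x2 * x3 * B * (256 * n%:R * (chi * M0) * x5)) _.
  by rewrite le_eqVlt; apply/orP; left; apply/eqP; ring.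
apply: le_trans h _.
by rewrite le_eqVlt; apply/orP; left; apply/eqP; ring.
Qed.

End powers.

(** * Grid geometry *)

Section refinement.
Context (R : realType) (n : nat).
Local Notation Rn := 'rV[R]_n.
Local Notation GX p := 'rV['I_(gsize p).+1]_n.

Let four : 4%:R = 2 * 2 :> R.
Proof. by rewrite -natrM. Qed.

Lemma truncn_div (x : R) (s : nat) : 0 <= x -> (0 < s)%N ->
  Num.truncn (x / s%:R) = (Num.truncn x %/ s)%N.
Proof.
move=> x0 s0; have sR : 0 < s%:R :> R by rewrite ltr0n.
have /andP[h1 h2] := truncn_itv x0.
apply: truncn_def; rewrite ler_pdivlMr// ltr_pdivrMr// -!natrM.
apply/andP; split.
  by apply: le_trans h1; rewrite ler_nat leq_trunc_div.
by apply: lt_le_trans h2 _; rewrite ler_nat ltn_ceil.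
Qed.

Lemma cell_val p (y : Rn) i : inbox p y ->
  cell p y 0 i = Num.truncn ((y 0 i + 2 ^+ p) * 2 ^+ p) :> nat.
Proof.
move=> /forallP/(_ i)/andP[h1 h2]; rewrite mxE inordK//.
have p2 : 0 < 2 ^+ p :> R by rewrite exprn_gt0.
rewrite -(ltr_nat R) gsizeS natrM natrX.
apply: le_lt_trans (_ : _ <= (y 0 i + 2 ^+ p) * 2 ^+ p) _.
  by rewrite truncn_le// mulr_ge0 ?(ltW p2)//; lra.
rewrite four exprMn mulrA ltr_pM2r//; lra.
Qed.

Lemma cell_gpos p (x : GX p) : inbox p (gpos R x) /\ cell p (gpos R x) = x.
Proof. by apply/cellsetP => i; rewrite lexx ltrDl eps_gt0. Qed.

(** In every coordinate the corner of the box of index [q] lies 2^p - 2^q inside that of the larger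
    box, which is 2^(p+q) - 4^q cells of side 2^-q. *)
Lemma coarse_cell p q (y : Rn) i : (q <= p)%N -> inbox q y -> inbox p y ->
  (cell p y 0%R i %/ 2 ^ (p - q) = cell q y 0%R i + (2 ^ (p + q) - 4 ^ q))%N.
Proof.
move=> qp bq bp; rewrite (cell_val _ bp) (cell_val _ bq).
have p2 : 0 < 2 ^+ p :> R by rewrite exprn_gt0.
have q2 : 0 < 2 ^+ q :> R by rewrite exprn_gt0.
have /forallP/(_ i)/andP[h1 h2] := bp; have /forallP/(_ i)/andP[h3 h4] := bq.
rewrite -truncn_div ?expn_gt0//; last by rewrite mulr_ge0 ?(ltW p2)//; lra.
have v0 : 0 <= (y 0 i + 2 ^+ q) * 2 ^+ q by rewrite mulr_ge0 ?(ltW q2)//; lra.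
have le4 : (4 ^ q <= 2 ^ (p + q))%N.
  by rewrite (_ : 4 = 2 * 2)%N// expnMn expnD leq_mul2r leq_exp2l// qp orbT.
have -> : (y 0 i + 2 ^+ p) * 2 ^+ p / (2 ^ (p - q))%:R =
    (y 0 i + 2 ^+ q) * 2 ^+ q + (2 ^ (p + q) - 4 ^ q)%:R.
  have -> : 2 ^+ p = 2 ^+ q * 2 ^+ (p - q) :> R by rewrite -exprD subnKC.
  rewrite natrB// !natrX four exprMn exprD.
  have -> : 2 ^+ p = 2 ^+ q * 2 ^+ (p - q) :> R by rewrite -exprD subnKC.
  by field; rewrite expf_neq0.
have /andP[k1 k2] := truncn_itv v0.
apply: truncn_def; rewrite natrD lerD2r k1 -addSn natrD ltrD2r.
exact: k2.
Qed.

(** The box of index [r] in terms of integer grid indices, so that its grid points can be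
    counted. *)
Definition inr p r (x : GX p) :=
  [forall i, (4 ^ p - 2 ^ (p + r) <= x 0%R i < 4 ^ p + 2 ^ (p + r))%N].

Lemma inbox_inr p r (y : Rn) : (r <= p)%N -> inbox p y ->
  inbox r y = inr r (cell p y).
Proof.
move=> rp bp; apply: eq_forallb => i; rewrite (cell_val _ bp).
have p2 : 0 < 2 ^+ p :> R by rewrite exprn_gt0.
have /forallP/(_ i)/andP[h1 h2] := bp.
have v0 : 0 <= (y 0 i + 2 ^+ p) * 2 ^+ p by rewrite mulr_ge0 ?(ltW p2)//; lra.
have le4 : (2 ^ (p + r) <= 4 ^ p)%N.
  by rewrite (_ : 4 = 2 * 2)%N// expnMn expnD leq_mul2l leq_exp2l// rp orbT.
have E4 : (4 ^ p)%:R = 2 ^+ p * 2 ^+ p :> R.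
  by rewrite natrX four exprMn.
have E2 : (2 ^ (p + r))%:R = 2 ^+ p * 2 ^+ r :> R by rewrite natrX exprD.
congr (_ && _).
  rewrite truncn_ge_nat// natrB// E4 E2 -mulrBr mulrC.
  by rewrite ler_pM2r//; apply/idP/idP; lra.
rewrite [RHS]ltnNge truncn_ge_nat// -ltNge natrD E4 E2 -mulrDr mulrC.
by rewrite ltr_pM2l//; apply/idP/idP; lra.
Qed.

Lemma card_inr p r : (#|[pred x : GX p | inr r x]| <= (2 * 2 ^ (p + r)) ^ n)%N.
Proof.
pose J : finType := {ffun 'I_n -> 'I_((2 * 2 ^ (p + r)).-1.+1)}.
have e1 : ((2 * 2 ^ (p + r)).-1.+1 = 2 * 2 ^ (p + r))%N.
  by rewrite prednK// muln_gt0 expn_gt0.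
have -> : ((2 * 2 ^ (p + r)) ^ n = #|{: J}|)%N by rewrite card_ffun !card_ord e1.
pose f (x : GX p) : J := [ffun i => inord (x 0%R i - (4 ^ p - 2 ^ (p + r)))%N].
have inj : {in [pred x : GX p | inr r x] &, injective f}.
  move=> x1 x2 /forallP b1 /forallP b2 /ffunP E; apply/rowP => i; apply: val_inj => /=.
  have := congr1 (fun z : 'I__ => z : nat) (E i); rewrite !ffunE.
  have /andP[h1 h2] := b1 i; have /andP[h3 h4] := b2 i.
  move: e1 h1 h2 h3 h4; move: (4 ^ p)%N (2 ^ (p + r))%N => a b e1 h1 h2 h3 h4.
  rewrite !inordK; [lia|rewrite e1; lia|rewrite e1; lia].
rewrite -(card_in_imset inj); exact: max_card.
Qed.

Lemma unit_shift_val N (x : 'rV['I_N.+1]_n) (i j : 'I_n) :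
  (x + unitv N i) 0 j = (if j == i then ((x 0%R j).+1 %% N.+1)%N else x 0%R j) :> nat.
Proof.
rewrite !mxE; case: ifP => _; last by rewrite addr0.
by rewrite /= modnDmr addn1.
Qed.

Definition sqpos p (x : GX p) : R := sqeucl (gpos R x).

(** Equality away from the seam. At the seam the right neighbour wraps from [2 ^+ p] to [- 2 ^+ p],
    with the same square, and the left one to [2 ^+ p - eps R p], whose square is smaller than that
    of the missing neighbour. *)
Lemma lap_sqpos p (x : GX p) :
  lap (@unitv (gsize p) n) (@sqpos p) x <= 2 * n%:R * eps R p ^+ 2.
Proof.
pose q (c : nat) : R := (- 2 ^+ p + c%:R * eps R p) ^+ 2.
have one i : sqpos (x + unitv _ i) + sqpos (x - unitv _ i) - 2 * sqpos x <= 2 * eps R p ^+ 2.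
  rewrite /sqpos /sqeucl.
  rewrite (bigD1 i)//= [X in _ + X - _ <= _](bigD1 i)//= [X in _ - 2 * X <= _](bigD1 i)//=.
  have e1 (s : GX p) : s 0 = unitv _ i 0 \/ s 0 = (- unitv _ i) 0 ->
     \sum_(j < n | j != i) gpos R (x + s) 0 j ^+ 2 = \sum_(j < n | j != i) gpos R x 0 j ^+ 2.
    move=> sE; apply: eq_bigr => j ji; rewrite !mxE; congr ((_ + _%:R * _) ^+ 2).
    have -> : s 0 j = 0.
      by case: sE => ->; rewrite !mxE (negbTE ji)// oppr0.
    by rewrite addr0.
  rewrite (e1 (unitv _ i)); last by left.
  rewrite (e1 (- unitv _ i)); last by right.
  have N1 := gsizeE R p; have NS := gsizeS p.
  have e0 := eps_gt0 R p; have p2 : 0 < 2 ^+ p :> R by rewrite exprn_gt0.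
  have xi := ltn_ord (x 0 i).
  have q1 : gpos R (x + unitv _ i) 0 i ^+ 2 = q (x 0 i).+1.
    rewrite mxE unit_shift_val eqxx /q.
    have [h|h] := ltnP (x 0 i).+1 (gsize p).+1; first by rewrite modn_small.
    have -> : (x 0%R i).+1 = (gsize p).+1 by apply/eqP; rewrite eqn_leq h xi.
    by rewrite modnn mul0r N1; ring.
  have q2 : gpos R (x - unitv _ i) 0 i ^+ 2 <= (- 2 ^+ p + ((x 0 i)%:R - 1) * eps R p) ^+ 2.
    have [y yE] : exists y : GX p, x = y + unitv _ i by exists (x - unitv _ i); rewrite subrK.
    rewrite yE addrK unit_shift_val eqxx mxE.
    have yi := ltn_ord (y 0 i).
    have [h|h] := ltnP (y 0 i).+1 (gsize p).+1.
      by rewrite modn_small// -[(y 0 i).+1%:R]natr1 addrK.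
    have -> : (y 0%R i).+1 = (gsize p).+1 by apply/eqP; rewrite eqn_leq h yi.
    have yN : (y 0 i)%:R * eps R p = 2 * 2 ^+ p - eps R p.
      have yg : (y 0%R i).+1 = (gsize p).+1 by apply/eqP; rewrite eqn_leq h yi.
      have : (y 0 i).+1%:R * eps R p = 2 * 2 ^+ p by rewrite yg N1.
      by rewrite -[(y 0 i).+1%:R]natr1 [(_ + 1) * _]mulrDl mul1r; lra.
    rewrite modnn yN sub0r mulN1r -subr_ge0.
    rewrite (_ : _ - _ = 4 * 2 ^+ p * eps R p); last by ring.
    by rewrite !mulr_ge0// ltW.
  have q3 : gpos R x 0 i ^+ 2 = q (x 0 i) by rewrite mxE.
  rewrite q1 q3; move: q2; rewrite /q -[(x 0 i).+1%:R]natr1.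
  move: (gpos R (x - _) 0 i) ((x 0 i)%:R) (\sum_(j < n | _) _) => g c S.
  move: (eps R p) (2 ^+ p) => e P h.
  have := h; rewrite -subr_ge0.
  rewrite (_ : _ - _ = (P + e - c * e) ^+ 2 - g ^+ 2); last by ring.
  move=> h'; rewrite -subr_ge0.
  rewrite (_ : _ - _ = (P + e - c * e) ^+ 2 - g ^+ 2)//; by ring.
apply: le_trans (ler_sum _ (fun i _ => one i)) _.
by rewrite sumr_const card_ord -[leLHS]mulr_natl mulrCA mulrA.
Qed.

Lemma sqpos_out p r (x : GX p) : (r <= p)%N -> ~~ inr r x -> (2 ^+ r) ^+ 2 <= sqpos x.
Proof.
move=> rp; have [bx cx] := cell_gpos x.
rewrite -[x in inr r x]cx -inbox_inr// negb_forall => /existsP[i].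
rewrite negb_and -!ltNge => H.
rewrite /sqpos /sqeucl (bigD1 i)//=; apply: ler_wpDr.
  by apply: sumr_ge0 => j _; exact: sqr_ge0.
have r0 : 0 <= 2 ^+ r :> R by rewrite exprn_ge0.
rewrite -[leRHS]real_normK ?num_real// lerXn2r ?nnegrE//.
case/orP: H => [h|]; last by rewrite -leNgt => h; apply: le_trans h (ler_norm _).
by rewrite -normrN; apply: le_trans (ler_norm _); rewrite lerNr ltW.
Qed.

End refinement.

(** * The approximations *)

(** [B] and [s0] are to come from [exists_level], without reference to [T]; [A] is then large in
    terms of [T] and [B]. The datum is bounded at every point, which truncation will arrange. *)
Record setup (R : realType) (n : nat) (m alpha chi M0 T B s0 : R) (A : nat)
    (u0 : 'rV[R]_n -> R) : Prop := Setup {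
  su_n : (0 < n)%N; su_m : 1 < m; su_alpha : 1 <= alpha; su_chi : 0 < chi;
  su_M0 : 0 < M0; su_T : 0 < T; su_B : 0 < B; su_s0 : 0 < s0 <= 1;
  su_s0_big : 256 * M0 / B <= s0 ^+ n;
  su_s0_small : 256 * n%:R * (chi * M0 * B `^ (alpha - 1) * B) * s0 ^+ 2 <=
    2^-1 ^+ n.+2 * (B / 4) `^ (m - 1) * B;
  su_A : (0 < A)%N;
  su_cfl : 4 * n%:R * (T / A%:R) * ((Num.truncn m).+1%:R * B `^ (m - 1)) <= 1;
  su_small : T / A%:R * chi * M0 * B `^ (alpha - 1) <= 2^-1;
  su_u0_meas : measurable_fun setT u0;
  su_u0_bound : forall x, 0 <= u0 x <= B / 4;
  su_u0_moment : (lebesgue_rV R n).-integrable setT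
    (fun x => (u0 x * (1 + sqeucl x))%:E);
  su_u0_mass : \int[lebesgue_rV R n]_x u0 x <= M0 }.

Section approximations.
Context (R : realType) (n : nat) (m alpha chi M0 T B s0 : R) (A : nat)
  (u0 : 'rV[R]_n -> R).
Hypothesis su : setup m alpha chi M0 T B s0 A u0.
Local Notation Rn := 'rV[R]_n.
Local Notation mu := (lebesgue_rV R n).
Local Notation GX p := 'rV['I_(gsize p).+1]_n.
Local Notation Z := (measurableTypeR R * Rn)%type.
Local Notation P := (lebesgue_measure \x mu)%E.
Local Notation K := (nsteps A).
Local Notation tau := (tau T A).
Local Notation eps := (eps R).
Local Notation w p := (eps p ^+ n).
Local Notation e p := (@unitv (gsize p) n).
Local Notation stst := (@stst R n T A _).

Definition phi (a : R) := a `^ m.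
Definition psi (a : R) := a `^ alpha.
Definition kap := T / A%:R.
Definition Lp := (Num.truncn m).+1%:R * B `^ (m - 1).
Definition P1 := B `^ (alpha - 1).

Definition init p (x : GX p) := (w p)^-1 * \int[mu]_(y in cellset x) u0 y.
Arguments init : clear implicits.

Definition U p k : GX p -> R :=
  evol (e p) phi psi kap (tau p) chi M0 (w p) (init p) k.
Arguments U : clear implicits.

Let n0 := su_n su.
Let T0 := su_T su.
Let A0 := su_A su.
Let B0 := su_B su.
Let M00 := su_M0 su.
Let chi0 := su_chi su.
Let m1 : 1 <= m. Proof. exact/ltW/(su_m su). Qed.

Lemma w_gt0 p : 0 < w p.
Proof. by rewrite exprn_gt0// eps_gt0. Qed.

Lemma kap_gt0 : 0 < kap.
Proof. by rewrite divr_gt0// ltr0n. Qed.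

Lemma Lp_gt0 : 0 < Lp.
Proof. by rewrite mulr_gt0// powR_gt0. Qed.

Lemma tau_kap p : tau p = kap * eps p ^+ 2.
Proof. exact: tauE. Qed.

Lemma phi_ge0 a : 0 <= phi a. Proof. exact: powR_ge0. Qed.

Lemma scheme p : scheme_ok n phi psi B Lp P1 kap (tau p) chi M0 (w p).
Proof.
have tp := tau_gt0 T0 A0 p.
split=> //.
- by rewrite /phi powR0// gt_eqF// (lt_le_trans ltr01).
- move=> a b a0 ab; apply: ge0_ler_powR; rewrite ?nnegrE//.
  + exact: le_trans m1.
  + exact: le_trans ab.
- by move=> a b a0 ab bB; exact: powR_lip.
- by move=> a _; exact: powR_ge0.
- by move=> a a0 aB; apply: powR_le_lin => //; exact: (su_alpha su).
- exact: Lp_gt0.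
- exact: powR_ge0.
- exact: kap_gt0.
- exact: w_gt0.
- exact: (su_cfl su).
- apply: le_trans (su_small su); rewrite tau_kap.
  apply: ler_wpM2r; first exact: powR_ge0.
  apply: ler_wpM2r; first exact: ltW.
  apply: ler_wpM2r; first exact: ltW.
  by rewrite ler_piMr ?(ltW kap_gt0)// exprn_ile1 ?eps_le1// ltW// eps_gt0.
Qed.

Lemma u0_integrable : mu.-integrable setT (EFin \o u0).
Proof.
apply: le_integrable (su_u0_moment su) => //.
  by apply/measurable_EFinP; exact: (su_u0_meas su).
move=> x _; have /andP[h _] := su_u0_bound su x; rewrite /= lee_fin.
have s0' : 0 <= sqeucl x by apply: sumr_ge0 => i _; exact: sqr_ge0.
by rewrite !ger0_norm ?mulr_ge0 ?addr_ge0// ler_peMr// lerDl.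
Qed.

Lemma cell_integrable p (x : GX p) (f : Rn -> R) :
  mu.-integrable setT (EFin \o f) -> mu.-integrable (cellset x) (EFin \o f).
Proof. by apply: integrableS => //; exact: measurable_cellset. Qed.

Lemma init_bound p x : 0 <= init p x <= B / 4.
Proof.
have w0 := w_gt0 p.
rewrite /init mulr_ge0 ?invr_ge0 ?(ltW w0)//=; last first.
  by apply: Rintegral_ge0 => y _; have /andP[] := su_u0_bound su y.
rewrite ler_pdivrMl//; apply: (@le_trans _ _ (\int[mu]_(y in cellset x) (B / 4))).
  apply: le_Rintegral => //; first exact: measurable_cellset.
  - by apply: cell_integrable; exact: u0_integrable.
  - apply: measurable_bounded_integrable => //.
    + exact: measurable_cellset.
    + by rewrite [X in (X < _)%E](mu_cellset R x) ltry.
    + exact: bounded_cst.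
  - by move=> y _; have /andP[] := su_u0_bound su y.
rewrite Rintegral_cst; last exact: measurable_cellset.
by rewrite [X in fine X](mu_cellset R x) mulrC.
Qed.

Lemma init_pairing p (a : GX p -> R) :
  mu.-integrable setT (fun y => (u0 y * spst a y)%:E) /\
  w p * \sum_x init p x * a x = \int[mu]_y (u0 y * spst a y).
Proof.
have [ia ->] := spst_weighted a u0_integrable; split=> //.
rewrite mulr_sumr; apply: eq_bigr => x _.
by rewrite /init mulrA mulrA mulfV ?mul1r ?gt_eqF ?w_gt0// mulrC.
Qed.

Lemma init_mass p : w p * \sum_x init p x <= M0.
Proof.
have [ia E] := init_pairing (fun _ : GX p => 1).
under eq_bigr do rewrite -[init _ _]mulr1.
rewrite E; apply: le_trans (su_u0_mass su).
apply: le_Rintegral => //; first exact: u0_integrable.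
move=> y _; have /andP[h _] := su_u0_bound su y.
by rewrite /spst; case: ifP => _; rewrite ?mulr1 ?mulr0.
Qed.

Lemma U_bounds p k : (forall x, 0 <= U p k x <= B / 2) /\
  w p * \sum_x U p k x <= M0.
Proof.
have /andP[s00 s01] := su_s0 su.
apply: (evol_bounds (scheme p) n0 (eps_gt0 R p) erefl (tau_kap p)
  s00 s01 (D := (B / 4) `^ (m - 1)) _ _ _ (su_s0_big su) (su_s0_small su)).
- by rewrite powR_gt0// divr_gt0.
- move=> k' k0 kE; apply: latvec_inj.
  rewrite -(ler_nat R) -(ler_pM2r (eps_gt0 R p)) gsizeE.
  apply: le_trans kE _; rewrite ler_peMr//.
  by apply: exprn_ege1; rewrite ler1n.
- move=> a b l4 ab bB; apply: powR_low => //.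
  by rewrite divr_ge0// ltW.
- exact: init_bound.
- exact: init_mass.
Qed.

Lemma U_B p k x : 0 <= U p k x <= B.
Proof.
have [/(_ x)/andP[-> h] _] := U_bounds p k; apply: le_trans h _.
by rewrite ler_pdivrMr// ler_peMr ?(ltW B0)// ler1n.
Qed.

Lemma U_mass p k : w p * \sum_x U p k x <= M0.
Proof. by have [] := U_bounds p k. Qed.

Lemma US p k : U p k.+1 = step (e p) phi psi kap (tau p) chi M0 (w p) (U p k).
Proof. by []. Qed.

Definition src_rate := chi * M0 * P1.

(** The time span is [2 * T], which accounts for one factor 2: translates by up to [K p] steps of
    the first [K p] iterates run past [T]. *)
Definition CE := Lp * (B * M0 + 4 * T * src_rate * B * M0).

Lemma energy_le p k : (k <= 2 * K p)%N ->
  \sum_(j < k) kap * (w p * dform (e p) (phi \o U p j) (phi \o U p j)) <= CE.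
Proof.
move=> kK; apply: le_trans (energy_sum (scheme p) (US p) (@U_B p) (@U_mass p) k) _.
apply: ler_wpM2l; first exact/ltW/Lp_gt0.
rewrite lerD2l.
have r0 : 0 <= src_rate by rewrite !mulr_ge0 ?powR_ge0// ltW.
rewrite (_ : k%:R * _ = (k%:R * tau p) * (2 * src_rate * B * M0)); last first.
  by rewrite /src_rate; ring.
rewrite (_ : 4 * T * _ * _ * _ = (2 * T) * (2 * src_rate * B * M0)); last by ring.
apply: ler_wpM2r.
  by rewrite mulr_ge0 ?(ltW M00)// mulr_ge0 ?(ltW B0)// mulr_ge0.
have -> : 2 * T = (2 * (K p)%:R) * tau p by rewrite -mulrA nsteps_tau.
apply: ler_wpM2r; first exact/ltW/tau_gt0.
by rewrite -natrM ler_nat.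
Qed.

Definition CT := 2 * CE + T * src_rate * M0 * phi B.

Lemma time_le p l : (l <= K p)%N ->
  \sum_(k < K p) w p * (\sum_x (U p (k + l)%N x - U p k x) *
    ((phi \o U p (k + l)%N) x - (phi \o U p k) x)) <= l%:R * CT.
Proof.
move=> lK; apply: le_trans (time_translate (scheme p) (US p) (@U_B p) (@U_mass p) (K p) l) _.
apply: ler_wpM2l => //; apply: lerD.
  by apply: ler_wpM2l => //; apply: energy_le; rewrite mul2n -addnn leq_add2l.
rewrite (_ : (K p)%:R * _ * _ * _ = ((K p)%:R * tau p) * src_rate * M0 * phi B).
  by rewrite nsteps_tau.
by rewrite /src_rate; ring.
Qed.

Definition CM := expR (T * src_rate) *
  (2 * n%:R * (\int[mu]_x (u0 x * (1 + sqeucl x))) + 2 * n%:R * T * Lp * M0).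

Lemma CM_moment p k : (k <= K p)%N ->
  w p * (\sum_x U p k x * @sqpos R n p x) <= CM.
Proof.
move=> kK; have tp := tau_gt0 T0 A0 p.
apply: le_trans (moment_bound (scheme p) (US p) (@U_B p) (@U_mass p) k
  (eps := eps p) _ (@lap_sqpos R n p) (tau_kap p)) _.
  by move=> x; apply: sumr_ge0 => i _; exact: sqr_ge0.
have r0 : 0 <= src_rate by rewrite !mulr_ge0 ?powR_ge0// ltW.
have kT : k%:R * tau p <= T.
  by rewrite -[leRHS](nsteps_tau T A0 p); apply: ler_wpM2r; [exact: ltW|rewrite ler_nat].
have Lp0 := Lp_gt0.
apply: ler_pM; first exact: expR_ge0.
- apply: addr_ge0.
    rewrite mulr_ge0 ?(ltW (w_gt0 p))//; apply: sumr_ge0 => x _; apply: mulr_ge0.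
      by have /andP[] := U_B 0%N x.
    by apply: sumr_ge0 => i _; exact: sqr_ge0.
  by rewrite mulr_ge0// mulr_ge0 ?(ltW M00)// mulr_ge0 ?(ltW Lp0)// mulr_ge0 ?(ltW tp).
- rewrite ler_expR (_ : k%:R * _ = (k%:R * tau p) * src_rate); last by rewrite /src_rate; ring.
  exact: ler_wpM2r.
apply: lerD; last first.
  rewrite (_ : k%:R * _ = (k%:R * tau p) * (2 * n%:R * Lp * M0)); last by ring.
  rewrite (_ : 2 * _ * T * _ * _ = T * (2 * n%:R * Lp * M0)); last by ring.
  by apply: ler_wpM2r => //; rewrite mulr_ge0 ?(ltW M00)// mulr_ge0 ?(ltW Lp0).
have [ia ->] := init_pairing (@sqpos R n p).
rewrite -RintegralZl//; last exact: (su_u0_moment su).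
apply: le_Rintegral => //.
  by have := integrableZl measurableT (2 * n%:R) (su_u0_moment su).
move=> y _; have /andP[h _] := su_u0_bound su y.
rewrite mulrCA; apply: ler_wpM2l => //.
have sq0 : 0 <= sqeucl y by apply: sumr_ge0 => i _; exact: sqr_ge0.
have n1 : 1 <= n%:R :> R by rewrite ler1n.
rewrite /spst; case: ifPn => yb; last by rewrite !mulr_ge0// addr_ge0.
have /(_ (conj yb erefl)) cy := (@cellsetP R n p (cell p y) y).2.
(* Each coordinate of the corner of a cell is within 1 of that of [y], so its square is at most
   [2 + 2 * y 0 i ^+ 2]. *)
apply: (@le_trans _ _ (\sum_(i < n) (2 + 2 * y 0 i ^+ 2))).
  apply: ler_sum => i _; have /andP[h1 h2] := cy i.
  have e1 := eps_le1 R p.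
  move: (gpos R _ 0 i) (y 0 i) h1 h2 => g z h1 h2.
  have : 0 <= z - g < 1 by lra.
  move=> /andP[d0 d1].
  have : (z - g) ^+ 2 <= 1 by rewrite exprn_ile1// ltW.
  have := sqr_ge0 (2 * z - g); rewrite -subr_ge0 => q1 q2.
  rewrite -subr_ge0; have : g ^+ 2 = 2 * z ^+ 2 + 2 * (z - g) ^+ 2 - (2 * z - g) ^+ 2 by ring.
  by move=> ->; lra.
rewrite big_split/= sumr_const card_ord -mulr_sumr -/(sqeucl y) -[2 *+ n]mulr_natr.
rewrite mulrDr mulr1 lerD2l -mulrA [n%:R * _]mulrC mulrA ler_peMr//.
by rewrite mulr_ge0.
Qed.

End approximations.

(** * Total boundedness in L1 *)

Lemma sum_thirds (R : realFieldType) (eta x1 x2 x3 : R) : x1 <= eta / 9 ->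
  x2 <= eta / 3 -> x3 <= eta / 3 -> 2 * x1 + x2 + x1 + x3 <= eta.
Proof. lra. Qed.

Section compactness.
Context (R : realType) (n : nat) (m alpha chi M0 T B s0 : R) (A : nat)
  (u0 : 'rV[R]_n -> R).
Hypothesis su : setup m alpha chi M0 T B s0 A u0.
Local Notation Rn := 'rV[R]_n.
Local Notation mu := (lebesgue_rV R n).
Local Notation GX p := 'rV['I_(gsize p).+1]_n.
Local Notation Z := (measurableTypeR R * Rn)%type.
Local Notation PP := (lebesgue_measure \x mu)%E.
Local Notation K := (nsteps A).
Local Notation tau := (tau T A).
Local Notation eps := (eps R).
Local Notation w p := (eps p ^+ n).
Local Notation stst := (@stst R n T A _).
Local Notation U p := (@U R n m alpha chi M0 T A u0 p).
Local Notation phi := (@phi R m).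

Let T0 := su_T su.
Let A0 := su_A su.
Let B0 := su_B su.

Lemma tcell_coarse p q (t : R) : (q <= p)%N -> 0 < t ->
  tcell T A q t = (tcell T A p t %/ 4 ^ (p - q))%N.
Proof.
move=> qp t0; rewrite /tcell -truncn_div ?expn_gt0//; last first.
  by rewrite divr_ge0 ?(ltW t0)// ltW// tau_gt0.
congr (Num.truncn _); rewrite -mulrA -invfM; congr (_ / _).
have -> : tau p = T / (K q * 4 ^ (p - q))%:R.
  by rewrite /tau /nsteps -mulnA -expnD subnKC.
by rewrite natrM invfM mulrA divfK// pnatr_eq0 -lt0n expn_gt0.
Qed.

Lemma cell_class p q (x x' : GX p) : (q <= p)%N ->
  inbox q (gpos R x) -> inbox q (gpos R x') ->
  cell q (gpos R x) = cell q (gpos R x') ->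
  forall i, (x 0%R i %/ 2 ^ (p - q) = x' 0%R i %/ 2 ^ (p - q))%N.
Proof.
move=> qp b b' E i.
have [bp cp] := @cell_gpos R n p x; have [bp' cp'] := @cell_gpos R n p x'.
rewrite -[in LHS]cp -[in RHS]cp' (coarse_cell i qp b bp) (coarse_cell i qp b' bp').
by rewrite E.
Qed.

Lemma inr_sub p r q (x : GX p) : (r <= q)%N -> inr r x -> inr q x.
Proof.
move=> rq /forallP H; apply/forallP => i; have /andP[h1 h2] := H i.
have le2 : (2 ^ (p + r) <= 2 ^ (p + q))%N by rewrite leq_exp2l// leq_add2l.
by apply/andP; split; [apply: leq_trans h1; apply: leq_sub2l|
  apply: leq_trans h2 _; rewrite leq_add2l].
Qed.

Lemma inbox_cells p q (y : Rn) : (q <= p)%N -> inbox p y -> inbox q y ->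
  inbox q (gpos R (cell p y)) /\ cell q (gpos R (cell p y)) = cell q y.
Proof.
move=> qp bp bq; have [bp' cp'] := @cell_gpos R n p (cell p y).
have bq' : inbox q (gpos R (cell p y)).
  by rewrite (inbox_inr qp bp') cp' -(inbox_inr qp bp).
split=> //; apply/rowP => i; apply: val_inj => /=; apply/eqP.
rewrite -(eqn_add2r (2 ^ (p + q) - 4 ^ q)%N).
by rewrite -(coarse_cell i qp bq' bp') -(coarse_cell i qp bq bp) cp'.
Qed.

(** The grids are nested, so the distance of two step functions is again a step function on the
    finer grid, and its integral becomes a finite sum. *)
Lemma stst_dist p (a : nat -> GX p -> R) (q : nat) (b : nat -> GX q -> R) (r : nat) :
  (r <= q)%N -> (q <= p)%N -> (forall k x, ~~ inr r x -> b k x = 0) ->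
  forall z : Z, `|stst a z - stst b z| = stst (fun k x =>
    `|a k x - (if inr r x then b (k %/ 4 ^ (p - q))%N (cell q (gpos R x)) else 0)|) z.
Proof.
move=> rq qp b0 [t y]; rewrite !/stst /=; case: ifPn => [/andP[t0 tT]|_]; last first.
  by rewrite subrr normr0.
rewrite /spst; case: ifPn => bp.
  have bqE : inbox q y = inr q (cell p y) by rewrite (inbox_inr qp bp).
  have brE : inbox r y = inr r (cell p y) by rewrite (inbox_inr (leq_trans rq qp) bp).
  rewrite -tcell_coarse//; have [ir|nir] := boolP (inr r (cell p y)).
    have bq : inbox q y by rewrite bqE (inr_sub rq ir).
    by have [_ ->] := inbox_cells qp bp bq; rewrite bq.
  by case: ifPn => // bq; rewrite b0 ?subr0// -(inbox_inr rq bq) brE.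
have -> : inbox q y = false.
  apply/negbTE; apply: contra bp => /forallP H; apply/forallP => i.
  have /andP[h1 h2] := H i.
  have le2 : 2 ^+ q <= 2 ^+ p :> R by apply: ler_weXn2l => //; rewrite ler1n.
  by apply/andP; split; [apply: le_trans h1; rewrite lerN2|exact: lt_le_trans h2 le2].
by rewrite subrr normr0.
Qed.

(** Mass far away is small by the second moment. Inside the box of index [r], the density is
    replaced on each coarse block by one sample rounded to a multiple of [delta]; samples lie in
    [[0, B]], so the number of codes does not depend on the fine grid. *)
Lemma approx_code (eta : R) : 0 < eta ->
  exists (q : nat) (F : finType) (W : F -> Z -> R),
  (forall c, PP.-integrable setT (EFin \o W c)) /\
  forall p, (q <= p)%N -> exists c : F,
    \int[PP]_z `|stst (U p) z - W c z| <= eta.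
Proof.
move=> eta0; have m1 : 1 <= m by exact/ltW/(su_m su).
have kap0 := kap_gt0 su.
(* choose the region [r], the resolution [delta] of the codes and the block size [q] *)
have CM0 : 0 <= CM m alpha chi M0 T B u0.
  apply: le_trans (CM_moment su (leq0n (K 0))).
  rewrite mulr_ge0 ?(ltW (w_gt0 _ _ _))//; apply: sumr_ge0 => x _; apply: mulr_ge0.
    by have /andP[] := U_B su 0%N x.
  by apply: sumr_ge0 => i _; exact: sqr_ge0.
pose r := (Num.truncn (3 * (T * CM m alpha chi M0 T B u0) / eta)).+1.
have rE : T * (CM m alpha chi M0 T B u0 / (2 ^+ r) ^+ 2) <= eta / 3.
  rewrite mulrA ler_pdivrMr ?exprn_gt0// -ler_pdivrMl ?divr_gt0// invf_div.
  have h : 3 * (T * CM m alpha chi M0 T B u0) / eta <= r%:R by rewrite ltW// truncnS_gt.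
  apply: le_trans (_ : _ <= r%:R) _; first by rewrite mulrAC.
  rewrite -exprM -natrX ler_nat; apply: ltnW; apply: leq_trans (ltn_expl r (isT : 1 < 2)%N) _.
  by rewrite leq_exp2l// leq_pmulr.
pose V : R := T * (2 * 2 ^+ r) ^+ n.
have V0 : 0 < V by rewrite mulr_gt0// exprn_gt0// mulr_gt0// exprn_gt0.
pose delta := eta / 9 / V.
have d0 : 0 < delta by rewrite !divr_gt0.
have [Md [Md0 modl]] := powR_modulus m1 d0 B0.
(* The coefficient in the sampling error: weighted by [tau p * w p], that error becomes
   [CC * eps q ^+ 2], which does not depend on [p]. *)
pose CC := Md * (2 * kap T A * CT m alpha chi M0 T B + 4 ^+ n * n%:R * (CE m alpha chi M0 T B)).
pose q := maxn r (Num.truncn (3 * CC / eta)).+1.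
have qE : CC * eps q ^+ 2 <= eta / 3.
  have [CC0|CC0] := leP CC 0.
    apply: (@le_trans _ _ 0); last by rewrite divr_ge0// ltW.
    by rewrite mulr_le0_ge0// sqr_ge0.
  have h : 3 * CC / eta <= q%:R.
    apply: le_trans (_ : _ <= (Num.truncn (3 * CC / eta)).+1%:R) _.
      by rewrite ltW// truncnS_gt.
    by rewrite ler_nat leq_maxr.
  rewrite /eps -exprM exprVn ler_pdivrMr ?exprn_gt0// -ler_pdivrMl ?divr_gt0// invf_div.
  apply: le_trans (_ : _ <= q%:R) _; first by rewrite mulrAC.
  rewrite -natrX ler_nat; apply: ltnW; apply: leq_trans (ltn_expl q (isT : 1 < 2)%N) _.
  by rewrite leq_exp2l// leq_pmulr.
have rq : (r <= q)%N by rewrite leq_maxl.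
pose Q := Num.truncn (B / delta).
pose F : finType := {ffun 'I_(K q) * GX q -> 'I_Q.+1}.
pose Wq (c : F) (k : nat) (x : GX q) : R :=
  if inr r x then (if insub k is Some j then delta * (c (j, x))%:R else 0) else 0.
exists q, F, (fun c => stst (Wq c)); split.
  by move=> c; have [] := stst_integral T0 A0 (Wq c).
move=> p qp.
have rp := leq_trans rq qp.
pose s := (2 ^ (p - q))%N; pose st := (4 ^ (p - q))%N.
have s1 : (0 < s)%N by rewrite expn_gt0.
have st1 : (0 < st)%N by rewrite expn_gt0.
have NE : ((gsize p).+1 = (2 * 2 ^ (p + q)) * s)%N.
  rewrite gsizeS -mulnA -expnD -addnA subnKC// (_ : 4 = 2 * 2)%N// expnMn.
  by rewrite -expnD.
have KE : (K p = K q * st)%N by rewrite /nsteps -mulnA -expnD subnKC.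
have wp := w_gt0 R n p; have tp := tau_gt0 T0 A0 p.
pose ET := (w p)^-1 * (st%:R * CT m alpha chi M0 T B).
pose ES := (kap T A * w p)^-1 * CE m alpha chi M0 T B.
have HT l : (l < st)%N -> \sum_(k < K q * st) \sum_x (U p (k + l)%N x - U p k x) *
    ((phi \o U p (k + l)%N) x - (phi \o U p k) x) <= ET.
  move=> ls; rewrite /ET ler_pdivlMl// mulr_sumr -KE.
  have lK : (l <= K p)%N.
    by rewrite KE; apply: leq_trans (ltnW ls) _; rewrite leq_pmull// nsteps_gt0.
  apply: le_trans (time_le su lK) _; apply: ler_wpM2r; last by rewrite ler_nat ltnW.
  have CE0 : 0 <= CE m alpha chi M0 T B.
    by apply: le_trans (energy_le su (leq0n (2 * K 0))); rewrite big_ord0.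
  have r0 : 0 <= src_rate alpha chi M0 B.
    by rewrite !mulr_ge0 ?powR_ge0// ltW// ?(su_chi su) ?(su_M0 su).
  apply: addr_ge0; first exact: mulr_ge0.
  apply: mulr_ge0; last exact: powR_ge0.
  by apply: mulr_ge0; [apply: mulr_ge0 => //; exact: ltW|exact: ltW (su_M0 su)].
have HS : \sum_(k < K q * st) dform (@unitv (gsize p) n) (phi \o U p k) (phi \o U p k) <= ES.
  rewrite /ES -KE ler_pdivlMl; last exact: mulr_gt0.
  rewrite mulr_sumr.
  under eq_bigr do rewrite -mulrA.
  by apply: (energy_le su); rewrite leq_pmull.
have [ro [rho samp]] := sampling NE s1 st1 (U_B su (p := p)) d0 Md0
  (fun a b ha hb => (modl a b ha hb).1) (fun a b ha hb => (modl a b ha hb).2)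
  HT HS (fun x : GX p => inr r x).
pose val0 (kx : 'I_(K p) * GX p) := U p (retime st ro kx.1) (resample rho kx.2).
pose good (jc : 'I_(K q) * GX q) (kx : 'I_(K p) * GX p) :=
  [&& (kx.1 %/ st == jc.1)%N, inr r kx.2 & cell q (gpos R kx.2) == jc.2].
(* Any fine cell of the block may be picked, because the sampled value depends on the block only. *)
pose c : F := [ffun jc => inord (if [pick kx | good jc kx] is Some kx
   then Num.truncn (val0 kx / delta) else 0%N)].
exists c.
pose err (k : nat) (x : GX p) :=
  `|U p k x - (if inr r x then Wq c (k %/ st)%N (cell q (gpos R x)) else 0)|.
have -> : \int[PP]_z `|stst (U p) z - stst (Wq c) z| = \int[PP]_z stst err z.
  apply: eq_Rintegral => z _; rewrite (stst_dist _ rq qp)//.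
  by move=> k x; rewrite /Wq => /negbTE ->.
have [_ ->] := stst_integral T0 A0 err.
have sqq (k : 'I_(K p)) (x : GX p) : inr r x ->
    `|U p (retime st ro k) (resample rho x) - Wq c (k %/ st)%N (cell q (gpos R x))| <= delta.
  move=> ix; have [bx cx] := @cell_gpos R n p x.
  have bq : inbox q (gpos R x) by rewrite (inbox_inr qp bx) cx (inr_sub rq ix).
  have br : inr r (cell q (gpos R x)).
    by rewrite -(inbox_inr rq bq) (inbox_inr rp bx) cx.
  have kq : (k %/ st < K q)%N by rewrite ltn_divLR// -KE.
  rewrite /Wq br insubT/= ffunE; case: pickP => [[k' x']|/(_ (k, x))]; last first.
    by rewrite /good /= !eqxx ix.
  move=> /and3P[/= /eqP kk ix' /eqP xx].
  have [bx' cx'] := @cell_gpos R n p x'.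
  have bq' : inbox q (gpos R x') by rewrite (inbox_inr qp bx') cx' (inr_sub rq ix').
  have -> : val0 (k', x') = U p (retime st ro k) (resample rho x).
    rewrite /val0 /= /retime kk; congr (U p _ _).
    apply/rowP => i; apply: val_inj; rewrite -![LHS]/(nat_of_ord _) -[RHS]/(nat_of_ord _).
    by rewrite !(resample_val NE) (cell_class qp bq' bq xx).
  have /andP[v0 vB] := U_B su (retime st ro k) (resample rho x).
  set v := U p _ _ in v0 vB *.
  have vd : 0 <= v / delta by rewrite divr_ge0// ltW.
  rewrite inordK; last by rewrite ltnS le_truncn// ler_pM2r// invr_gt0.
  have /andP[t1 t2] := truncn_itv vd.
  rewrite ler_pdivlMr// in t1; rewrite ltr_pdivrMr// -natr1 mulrDl mul1r in t2.
  rewrite [delta * _]mulrC; move: t1 t2; clearbody v.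
  move: ((Num.truncn (v / delta))%:R * delta) => td; clear; move=> t1 t2.
  by rewrite ler_norml; apply/andP; split; lra.
have card : w p * #|[pred x : GX p | inr r x]|%:R <= (2 * 2 ^+ r) ^+ n.
  have := @card_inr n p r; rewrite -(ler_nat R) => /(ler_wpM2l (ltW wp)).
  move=> /le_trans; apply; rewrite natrX -exprMn natrM natrX exprD.
  rewrite le_eqVlt; apply/orP; left; apply/eqP; congr (_ ^+ _).
  by rewrite mulrCA [eps p * _]mulrA epsE mul1r.
have main : \sum_(k < K p) \sum_x err k x <=
   (2 * delta * (K p)%:R * #|[pred x : GX p | inr r x]|%:R
     + Md * (2 * ET + 4 ^+ n * n%:R * s%:R ^+ 2 * ES))
   + delta * (K p)%:R * #|[pred x : GX p | inr r x]|%:R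
   + \sum_(k < K p) (w p)^-1 * (CM m alpha chi M0 T B u0 / (2 ^+ r) ^+ 2).
  have bnd k : (k <= K p)%N -> \sum_(x | ~~ inr r x) U p k x <=
      (w p)^-1 * (CM m alpha chi M0 T B u0 / (2 ^+ r) ^+ 2).
    move=> kK; rewrite ler_pdivlMl// ler_pdivlMr ?exprn_gt0//.
    apply: le_trans (CM_moment su kK).
    rewrite -mulrA; apply: ler_wpM2l; first exact: ltW.
    rewrite mulr_suml [leRHS](bigID (fun x => inr r x))/= addrC; apply: ler_wpDr.
      apply: sumr_ge0 => x _; apply: mulr_ge0; first by have /andP[] := U_B su k x.
      by apply: sumr_ge0 => i _; exact: sqr_ge0.
    apply: ler_sum => x ox; apply: ler_wpM2l; first by have /andP[] := U_B su k x.
    exact: sqpos_out.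
  apply: (@le_trans _ _ (\sum_(k < K p) (\sum_(x | inr r x)
      (`|U p k x - U p (retime st ro k) (resample rho x)| + delta)
      + (w p)^-1 * (CM m alpha chi M0 T B u0 / (2 ^+ r) ^+ 2)))).
    apply: ler_sum => k _; rewrite (bigID (fun x => inr r x))/=; apply: lerD.
      apply: ler_sum => x ix; rewrite /err ix.
      apply: le_trans (ler_distD (U p (retime st ro k) (resample rho x)) _ _) _.
      by rewrite lerD2l; exact: sqq.
    apply: le_trans (bnd k (ltnW (ltn_ord k))).
    apply: ler_sum => x ox; rewrite /err (negbTE ox) subr0 ger0_norm//.
    by have /andP[] := U_B su k x.
  rewrite big_split/= lerD2r.
  under eq_bigr do rewrite big_split/= sumr_const.
  rewrite big_split/= sumr_const card_ord; apply: lerD.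
    by move: samp; rewrite -KE.
  by rewrite -[leLHS]mulr_natr -[delta *+ _]mulr_natr mulrAC.
have tw : 0 <= tau p * w p by rewrite ltW// mulr_gt0.
rewrite mulrA; apply: le_trans (ler_wpM2l tw main) _.
rewrite sumr_const card_ord.
have e1 : tau p * w p * (delta * (K p)%:R * #|[pred x : GX p | inr r x]|%:R) <= eta / 9.
  rewrite (_ : _ * _ = delta * ((K p)%:R * tau p) * (w p * #|[pred x : GX p | inr r x]|%:R)).
    rewrite nsteps_tau//; apply: le_trans (_ : _ <= delta * T * (2 * 2 ^+ r) ^+ n) _.
      by apply: ler_wpM2l => //; rewrite mulr_ge0 ?ltW.
    by rewrite -mulrA -/V /delta divfK// gt_eqF.
  by ring.
have e2 : tau p * w p * (Md * (2 * ET + 4 ^+ n * n%:R * s%:R ^+ 2 * ES)) <= eta / 3.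
  apply: le_trans qE; rewrite le_eqVlt; apply/orP; left; apply/eqP.
  have es : eps p ^+ 2 * st%:R = eps q ^+ 2.
    rewrite /st natrX (_ : 4%:R = 2 ^+ 2 :> R); last by rewrite -natrX.
    rewrite -exprM mulnC exprM -exprMn; congr (_ ^+ _).
    rewrite /eps -{1}(subnKC qp) exprD -mulrA -exprMn mulVf// expr1n mulr1//.
  have ss : s%:R ^+ 2 = st%:R :> R.
    by rewrite /s /st -natrX -expnM mulnC expnM.
  rewrite ss /ET /ES tau_kap /CC -es.
  by field; rewrite !gt_eqF.
have e3 : tau p * w p * ((w p)^-1 * (CM m alpha chi M0 T B u0 / (2 ^+ r) ^+ 2) *+ K p) <= eta / 3.
  apply: le_trans rE; rewrite -[_ *+ K p]mulr_natl.
  move: (CM _ _ _ _ _ _ _ / _) => cm.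
  rewrite [leLHS](_ : _ = ((K p)%:R * tau p) * (w p * (w p)^-1) * cm).
    by rewrite nsteps_tau// mulfV ?mulr1// gt_eqF.
  by move: (tau p) ((w p)^-1) (w p) => x y z; ring.
apply: le_trans (sum_thirds e1 e2 e3).
rewrite le_eqVlt; apply/orP; left; apply/eqP.
move: (Md * _) ((w p)^-1 * _ *+ _) (tau p * w p) => x1 x2 x3.
by ring.
Qed.

Lemma ub_totally_bounded (eta : R) : 0 < eta ->
  exists (F : finType) (c : nat -> F) (q : nat),
    forall p p', (q <= p)%N -> (q <= p')%N -> c p = c p' ->
    \int[PP]_z `|stst (U p) z - stst (U p') z| <= eta.
Proof.
move=> eta0; have [q [F [W [iW H]]]] := approx_code (divr_gt0 eta0 (ltr0n R 2)).
have [c0 _] := H q (leqnn q).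
pose c p : F := if pselect (q <= p)%N is left qp then sval (cid (H p qp)) else c0.
exists F, c, q => p p' qp qp' cc.
have h p1 : (q <= p1)%N -> \int[PP]_z `|stst (U p1) z - W (c p1) z| <= eta / 2.
  by move=> q1; rewrite /c; case: pselect => // q1'; case: cid.
have iU p1 : PP.-integrable setT (EFin \o stst (U p1)).
  by have [] := stst_integral T0 A0 (U p1).
have iabs (f g : Z -> R) : PP.-integrable setT (EFin \o f) ->
    PP.-integrable setT (EFin \o g) -> PP.-integrable setT (fun z => (`|f z - g z|)%:E).
  move=> fi gi; have := integrable_abse (integrableB measurableT fi gi).
  by apply: eq_integrable => // z _; rewrite /= -EFinB.
apply: (@le_trans _ _ (\int[PP]_z (`|stst (U p) z - W (c p) z| + `|stst (U p') z - W (c p') z|))).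
  apply: le_Rintegral => //; first exact: iabs.
    have := integrableD measurableT (iabs _ _ (iU p) (iW (c p))) (iabs _ _ (iU p') (iW (c p'))).
    by apply: eq_integrable => // z _; rewrite /= EFinD.
  move=> z _; rewrite cc [`|stst (U p') z - _|]distrC.
  exact: ler_distD.
rewrite RintegralD//; [|exact: iabs|exact: iabs].
have := h p qp; have := h p' qp'; lra.
Qed.

End compactness.

(** * Sampled test functions *)

Section line_derivative.
Context (R : realType) (V : normedModType R).
Implicit Types (f : V -> R) (x v : V).

Let quotient_line f x v (s : R) :
  (fun h : R => h^-1 *: (((fun r : R => f (x + r *: v)) \o shift s) (h *: (1 : R)) -
     f (x + s *: v))) =
  (fun h : R => h^-1 *: ((f \o shift (x + s *: v)) (h *: v) - f (x + s *: v))).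
Proof.
apply/funext => h; congr (_ *: (f _ - _)).
by rewrite /shift/= scalerDl addrCA [_ *: 1]mulr1.
Qed.

Lemma derive_line f x v (s : R) : differentiable f (x + s *: v) ->
  is_derive s 1 (fun r : R => f (x + r *: v)) ('D_v f (x + s *: v)).
Proof.
move=> d; have df : derivable f (x + s *: v) v by exact: diff_derivable.
split.
  by rewrite /derivable quotient_line.
by rewrite /derive quotient_line.
Qed.

Lemma mvt_line f x v (h : R) : (forall y, differentiable f y) -> 0 < h ->
  exists c, 0 < c < h /\ f (x + h *: v) - f x = h * 'D_v f (x + c *: v).
Proof.
move=> df h0.
have dl s := derive_line (df (x + s *: v)).
have cont : {within `[0, h], continuous (fun r : R => f (x + r *: v))}.
  apply: continuous_subspaceT => s; apply: differentiable_continuous.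
  by apply/derivable1_diffP; have [] := dl s.
have [c cI E] := @MVT R (fun r : R => f (x + r *: v)) (fun r => 'D_v f (x + r *: v))
  0 h h0 (fun s _ => dl s) cont.
exists c; move: cI; rewrite in_itv/= => ->; split=> //.
by move: E; rewrite scale0r addr0 subr0 mulrC.
Qed.

End line_derivative.

Section pair_derivative.
Context (R : realType) (V : normedModType R) (phi : R -> V -> R).
Let Phi (z : R * V) := phi z.1 z.2.

Lemma derive_space t y v : 'D_v (phi t) y = 'D_((0, v) : R * V) Phi (t, y).
Proof.
have E : (fun h : R => h^-1 *: ((phi t \o shift y) (h *: v) - phi t y)) =
    (fun h : R => h^-1 *: ((Phi \o shift (t, y)) (h *: ((0, v) : R * V)) - Phi (t, y))).
  by apply/funext => h; rewrite /Phi /= scaler0 add0r.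
by rewrite /derive E.
Qed.

Lemma derive_time t y : derive1 (phi ^~ y) t = 'D_((1, 0) : R * V) Phi (t, y).
Proof.
have E : (fun h : R => h^-1 *: ((phi ^~ y \o shift t) (h *: (1 : R)) - phi t y)) =
    (fun h : R => h^-1 *: ((Phi \o shift (t, y)) (h *: ((1, 0) : R * V)) - Phi (t, y))).
  by apply/funext => h; rewrite /Phi /= scaler0 add0r.
by rewrite derive1E /derive E.
Qed.

End pair_derivative.

Section sampled.
Context (R : realType) (n : nat) (T : R) (A : nat).
Hypotheses (T0 : 0 < T) (A0 : (0 < A)%N).
Local Notation Rn := 'rV[R]_n.
Local Notation mu := (lebesgue_rV R n).
Local Notation GX p := 'rV['I_(gsize p).+1]_n.
Local Notation Z := (measurableTypeR R * Rn)%type.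
Local Notation PP := (lebesgue_measure \x mu)%E.
Local Notation K := (nsteps A).
Local Notation tau := (tau T A).
Local Notation eps := (eps R).
Local Notation stst := (@stst R n T A _).

Definition near_cell p (k : nat) (x : GX p) (q : R * Rn) :=
  k%:R * tau p <= q.1 <= k.+1%:R * tau p /\
  forall i, `|q.2 0 i - gpos R x 0 i| <= eps p.

Lemma eps_cvg0 : eps @ \oo --> 0.
Proof.
by apply: cvg_expr; rewrite ger0_norm ?invr_ge0// invf_lt1// ltr1n.
Qed.

Lemma tau_cvg0 : tau @ \oo --> 0.
Proof.
rewrite (_ : tau = fun p => T / A%:R * (eps p * eps p)); last first.
  by apply/funext => p; rewrite tauE expr2.
rewrite -(mulr0 (T / A%:R)); apply: cvgM; first exact: cvg_cst.
by rewrite -[X in _ --> X](mulr0 0); apply: cvgM; exact: eps_cvg0.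
Qed.

Lemma near_cell_cvg (q : nat -> R * Rn) (z : Z) : intime T z.1 ->
  (\forall p \near \oo, near_cell (tcell T A p z.1) (cell p z.2) (q p)) ->
  (\forall p \near \oo, inbox p z.2) -> q @ \oo --> (z : R * Rn).
Proof.
move=> zt nq nb.
have c1 : (fst \o q) @ \oo --> z.1.
  apply/cvgrPdist_le => e e0; have /cvgrPdist_le/(_ e e0) te := tau_cvg0.
  near=> p.
  have [/andP[h1 h2] _] : near_cell (tcell T A p z.1) (cell p z.2) (q p) by near: p.
  have /andP[t0 _] := zt.
  have /andP[h3 h4] := tcell_itv T0 A0 p t0.
  have : `|0 - tau p| <= e by near: p.
  rewrite sub0r normrN ger0_norm ?(ltW (tau_gt0 T0 A0 p))// => te'.
  move: h2 h4; rewrite -natr1 mulrDl mul1r => h2 h4.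
  by rewrite /= ler_norml; apply/andP; split; lra.
have c2 : (snd \o q) @ \oo --> (z.2 : Rn).
  apply/cvg_ballP => e e0.
  have e20 : 0 < e / 2 by rewrite divr_gt0.
  have /cvgrPdist_le/(_ _ e20) te := eps_cvg0.
  near=> p.
  have [_ h] : near_cell (tcell T A p z.1) (cell p z.2) (q p) by near: p.
  have bz : inbox p z.2 by near: p.
  have : `|0 - eps p| <= e / 2 by near: p.
  rewrite sub0r normrN ger0_norm ?(ltW (eps_gt0 R p))// => te'.
  have /(_ (conj bz erefl)) cz := (@cellsetP R n p (cell p z.2) z.2).2.
  split=> // i0 i; rewrite (ord1 i0) /ball/= ltr_norml.
  have /andP[h1 h2] := cz i; have := h i.
  by rewrite ler_norml => /andP[h3 h4]; apply/andP; split; lra.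
have h : (fun p => (((fst \o q) p, (snd \o q) p) : R * Rn)) @ \oo --> ((z.1, z.2) : R * Rn).
  exact: (@cvg_pair nat R Rn \oo (nbhs (z.1 : R)) (nbhs (z.2 : Rn)) _ _ _
    (fst \o q) (snd \o q) c1 c2).
have E : (fun p => (((fst \o q) p, (snd \o q) p) : R * Rn)) = q.
  by apply/funext => p /=; case: (q p).
move: h; rewrite E; clear -z; by case: z.
Unshelve. all: by end_near. Qed.

Lemma inbox_near (y : Rn) : \forall p \near \oo,
  inbox p y /\ forall i, `|gpos R (cell p y) 0 i| + eps p < 2 ^+ p.
Proof.
pose S := \sum_i `|y 0 i| + 2.
have yS i : `|y 0 i| + 2 <= S.
  by rewrite lerD2r (bigD1 i)//= lerDl; apply: sumr_ge0.
near=> p.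
have Sp : S < 2 ^+ p.
  apply: lt_trans (_ : _ < p%:R) _; last by rewrite -natrX ltr_nat ltn_expl.
  by near: p; exact: nbhs_infty_gtr.
have bp : inbox p y.
  apply/forallP => i; have := le_lt_trans (yS i) Sp.
  have := ler_norm (y 0 i); have := ler_norm (- y 0 i); rewrite normrN => *.
  by apply/andP; split; lra.
split=> // i.
have /(_ (conj bp erefl)) cz := (@cellsetP R n p (cell p y) y).2.
have /andP[h1 h2] := cz i; have e1 := eps_le1 R p; have e0 := eps_gt0 R p.
have := le_lt_trans (yS i) Sp.
have : `|gpos R (cell p y) 0 i| <= `|y 0 i| + 1.
  rewrite ler_norml; have := ler_norm (y 0 i); have := ler_norm (- y 0 i).
  by rewrite normrN => *; apply/andP; split; lra.
move=> h3 h4; lra.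
Unshelve. all: by end_near. Qed.

(** The entries of [a] are values of [D] at unspecified points close to the cells, as the mean value
    theorem supplies them. Cells at the seam, where a shift wraps around, are covered by the
    vanishing condition alone. One step function on the grid of index [N] dominates all finer
    ones. *)
Lemma sampled_cvg (D : R * Rn -> R) (r : R) (p0 : nat) (a : forall p, nat -> GX p -> R) :
  continuous D ->
  (forall p k x, (p0 <= p)%N -> (k < K p)%N -> (exists i, r < `|gpos R x 0 i|) -> a p k x = 0) ->
  (forall p k x, (p0 <= p)%N -> (k < K p)%N -> (forall i, `|gpos R x 0 i| + eps p < 2 ^+ p) ->
    exists q, near_cell k x q /\ a p k x = D q) ->
  exists (M : R) (N : nat),
   (forall p (z : Z), (N <= p)%N ->
      `|stst (a p) z| <= stst (fun k (x : GX N) => M) z) /\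
   (forall z : Z, intime T z.1 -> (fun p => stst (a p) z) @ \oo --> D z).
Proof.
move=> cD a0 aD.
pose N := maxn p0 (Num.truncn (`|r| + 3)).+1.
have rN : `|r| + 3 < 2 ^+ N.
  apply: lt_trans (truncnS_gt _) _; rewrite -natrX ltr_nat.
  by apply: leq_ltn_trans (leq_maxr p0 _) _; exact: ltn_expl.
have N0 p : (N <= p)%N -> (p0 <= p)%N by apply: leq_trans; exact: leq_maxl.
pose C : set (R * Rn) := `[0, T]%classic `*`
  [set y : Rn | forall i, `[- (`|r| + 2), `|r| + 2]%classic (y 0 i)].
have cC : compact C.
  apply: compact_setX; first exact: segment_compact.
  by apply: (@rV_compact R n (fun=> `[- (`|r| + 2), `|r| + 2]%classic)) => i; exact: segment_compact.
have cDC : {within C, continuous D} by exact: continuous_subspaceT.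
have [M0 [_ HM]] := compact_bounded (continuous_compact cDC cC).
pose M := `|M0| + 1.
have DM q : C q -> `|D q| <= M.
  move=> Cq; apply: (HM M); [rewrite /M; have := ler_norm M0; lra|by exists q].
exists M, N; split; last first.
  move=> z zt; have [/andP[t0 tT]] := zt.
  have nb := inbox_near z.2.
  have ex p : exists q, (p0 <= p)%N -> (forall i, `|gpos R (cell p z.2) 0 i| + eps p < 2 ^+ p) ->
      near_cell (tcell T A p z.1) (cell p z.2) q /\
      a p (tcell T A p z.1) (cell p z.2) = D q.
    have [[h0 h]|h] := pselect ((p0 <= p)%N /\
        forall i, `|gpos R (cell p z.2) 0 i| + eps p < 2 ^+ p).
      have [q [h1 h2]] := aD p _ _ h0 (tcell_lt T0 A0 p zt) h; exists q => _ _; split=> //.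
    by exists (0, 0) => h1 h2; case: h; split.
  pose q p := sval (cid (ex p)).
  have qP p : (p0 <= p)%N -> (forall i, `|gpos R (cell p z.2) 0 i| + eps p < 2 ^+ p) ->
      near_cell (tcell T A p z.1) (cell p z.2) (q p) /\
      a p (tcell T A p z.1) (cell p z.2) = D (q p).
    by rewrite /q; case: cid.
  have nb0 : \forall p \near \oo, (p0 <= p)%N by exact: nbhs_infty_ge.
  have qz : q @ \oo --> (z : R * Rn).
    apply: near_cell_cvg => //.
      by apply: filterS2 nb nb0 => p [_ h] /qP/(_ h)[].
    by apply: filterS nb => p [].
  have Dq : (D \o q) @ \oo --> D z.
    by apply: continuous_cvg => //; exact: cD.
  apply: cvg_trans Dq; apply: near_eq_cvg.
  apply: filterS2 nb nb0 => p [bp h] /qP/(_ h)[_ E].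
  by rewrite /= /stst zt /spst bp E.
move=> p [t y] Np; rewrite !/stst /=; case: ifPn => [zt|_]; last by rewrite normr0.
have M00 : 0 <= M by rewrite /M addr_ge0.
rewrite /spst; case: ifPn => bp; last by rewrite normr0; case: ifP.
have [inC|nC] := boolP [exists i, r < `|gpos R (cell p y) 0 i|].
  rewrite a0 ?normr0//; [by case: ifP|exact: N0|exact: tcell_lt|].
  exact/existsP.
have gr i : `|gpos R (cell p y) 0 i| <= r.
  by rewrite leNgt; apply: contra nC => h; apply/existsP; exists i.
have e1 := eps_le1 R p; have rr := ler_norm r.
have le2 : 2 ^+ N <= 2 ^+ p :> R by apply: ler_weXn2l => //; rewrite ler1n.
have /(_ (conj bp erefl)) cz := (@cellsetP R n p (cell p y) y).2.
have bN : inbox N y.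
  apply/forallP => i; have /andP[h1 h2] := cz i.
  have := gr i; rewrite ler_norml => /andP[h3 h4]; apply/andP; split; lra.
rewrite bN.
have [q [[/andP[q1 q2] qx] ->]] : exists q, near_cell (tcell T A p t) (cell p y) q /\
   a p (tcell T A p t) (cell p y) = D q.
  apply: aD; [exact: N0|exact: tcell_lt|].
  by move=> i; have := gr i; lra.
apply: DM; split=> /=.
  have tp := tau_gt0 T0 A0 p; rewrite in_itv/=; apply/andP; split.
    by apply: le_trans q1; rewrite mulr_ge0// ltW.
  apply: le_trans q2 _; rewrite -[leRHS](nsteps_tau T A0 p) ler_pM2r// ler_nat.
  exact: tcell_lt.
move=> i; rewrite in_itv/=; have := qx i; have := gr i.
by rewrite !ler_norml => /andP[h1 h2] /andP[h3 h4]; apply/andP; split; lra.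
Qed.

End sampled.

(** * Fubini and almost every time slice *)

Section slices.
Context d1 d2 (T1 : measurableType d1) (T2 : measurableType d2) (R : realType).
Variable m1 : {sigma_finite_measure set T1 -> \bar R}.
Variable m2 : {sigma_finite_measure set T2 -> \bar R}.
Local Notation PP := (m1 \x m2)%E.
Implicit Types X : T1 * T2 -> R.

Lemma Rfubini X : PP.-integrable setT (EFin \o X) ->
  \int[m1]_t \int[m2]_y X (t, y) = \int[PP]_z X z.
Proof.
move=> iX; rewrite /Rintegral; congr fine.
have iF := integrable_fubini_F iX.
rewrite -[RHS](integral12_prod_meas1 iX).
have /integrableP[mF _] := iF.
apply: ae_eq_integral => //.
  by apply/measurable_EFinP; apply: (measurableT_comp (fine_measurable _)) => //.
have := integrable_ae measurableT iF; apply: filterS => t /(_ I) ft _.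
by rewrite /= fineK.
Qed.

Lemma slice_integrable X : PP.-integrable setT (EFin \o X) ->
  \forall t \ae m1, m2.-integrable setT (fun y => (X (t, y))%:E).
Proof.
move=> iX; have := integrable_ae measurableT
  (integrable_fubini_F (integrable_abse iX)).
have /integrableP[/measurable_EFinP mX _] := iX.
apply: filterS => t /(_ I) ft; apply/integrableP; split.
  by apply/measurable_EFinP; exact: measurableT_comp mX (measurable_pair1 t).
by move: ft; rewrite ge0_fin_numE//; apply: integral_ge0 => y _; exact: abse_ge0.
Qed.

(** By Tonelli the slice integrals are functions of [t] whose integrals decay geometrically, so
    [ae_cvg0] applies to them after division by [C]. *)
Lemma slice_ae_cvg0 (f : nat -> T1 * T2 -> R) (C : R) : 0 < C ->
  (forall k, measurable_fun setT (f k)) -> (forall k z, 0 <= f k z) ->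
  (forall k, (\int[PP]_z (f k z)%:E <= (C * 2^-1 ^+ k)%:E)%E) ->
  (\forall t \ae m1, forall k, m2.-integrable setT (fun y => (f k (t, y))%:E)) /\
  (\forall t \ae m1, (\int[m2]_y f k (t, y)) @[k --> \oo] --> 0).
Proof.
move=> C0 mf f0 If.
have iF k : PP.-integrable setT (EFin \o f k).
  apply/integrableP; split; first exact/measurable_EFinP.
  under eq_integral do rewrite gee0_abs ?lee_fin//.
  by apply: le_lt_trans (If k) _; rewrite ltry.
split.
  by apply/ae_foralln => k; exact: slice_integrable.
have mF k : measurable_fun setT (fun t => \int[m2]_y (f k (t, y))%:E)%E.
  apply: (measurable_fun_fubini_tonelli_F (EFin \o f k)) => [|z].
    by apply/measurable_EFinP; exact: mf.
  by rewrite /= lee_fin.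
have c0 : \forall t \ae m1, (C^-1 * \int[m2]_y f k (t, y)) @[k --> \oo] --> 0.
  apply: (@ae_cvg0 _ _ _ m1 (fun k t => C^-1 * \int[m2]_y f k (t, y))).
  - move=> k; apply: measurable_funM => //.
    by apply: (measurableT_comp (fine_measurable _)).
  - by move=> k t; rewrite mulr_ge0 ?invr_ge0 ?(ltW C0)//; apply: Rintegral_ge0.
  move=> k; under eq_integral do rewrite EFinM.
  rewrite ge0_integralZl_EFin//; first last.
  - by rewrite invr_ge0 ltW.
  - by apply/measurable_EFinP; apply: (measurableT_comp (fine_measurable _)).
  - by move=> t _; rewrite lee_fin; apply: Rintegral_ge0.
  rewrite -(@lee_pmul2l _ C%:E)//.
  rewrite muleA -EFinM mulfV ?gt_eqF// mul1e -EFinM.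
  apply: le_trans (If k).
  have me : measurable_fun setT (EFin \o f k) by apply/measurable_EFinP; exact: mf.
  have fe z : (0 <= (EFin \o f k) z)%E by rewrite /= lee_fin.
  rewrite -[X in (_ <= X)%E]/(\int[PP]_z (EFin \o f k) z)%E (fubini_tonelli1 _ me fe).
  apply: ge0_le_integral => //.
  - by move=> t _; rewrite lee_fin; apply: Rintegral_ge0.
  - by apply/measurable_EFinP; apply: (measurableT_comp (fine_measurable _)).
  - exact: mF.
  move=> t _; rewrite /Rintegral /fubini_F /=.
  have : (0 <= \int[m2]_y (f k (t, y))%:E)%E by apply: integral_ge0 => y _; rewrite lee_fin.
  by case: (\int[m2]_y _)%E => //= r _; rewrite leey.
apply: filterS c0 => t ct.
rewrite -(mulr0 C); rewrite (_ : (fun k => _) =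
  (fun k => C * (C^-1 * \int[m2]_y f k (t, y)))); first exact: cvgMr.
by apply/funext => k; rewrite mulrA mulfV ?gt_eqF// mul1r.
Qed.

End slices.

(** * Products of square-integrable functions *)

Section square_integrable.
Context d (T : measurableType d) (R : realType) (mu : {measure set T -> \bar R}).

Lemma integrable_sqr_mul (a b : T -> R) : measurable_fun setT a -> measurable_fun setT b ->
  mu.-integrable setT (fun z => (a z ^+ 2)%:E) -> mu.-integrable setT (fun z => (b z ^+ 2)%:E) ->
  mu.-integrable setT (fun z => (a z * b z)%:E).
Proof.
move=> ma mb ia ib; apply: le_integrable (integrableD measurableT ia ib) => //.
  by apply/measurable_EFinP; exact: measurable_funM.
move=> z _; rewrite /= lee_fin [leRHS]ger0_norm ?addr_ge0 ?sqr_ge0// ler_norml.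
have h1 := sqr_ge0 (a z + b z); have h2 := sqr_ge0 (a z - b z).
rewrite sqrrD in h1; rewrite sqrrB in h2.
have := sqr_ge0 (a z); have := sqr_ge0 (b z).
move: h1 h2; rewrite -[_ *+ 2]mulr_natl; move: (a z ^+ 2) (b z ^+ 2) (a z * b z) => x y p *.
by apply/andP; split; lra.
Qed.

(* Young's inequality replaces Cauchy-Schwarz *)
Lemma sqr_pairing_cvg0 (a b : nat -> T -> R) (C : R) :
  (forall k, measurable_fun setT (a k)) -> (forall k, measurable_fun setT (b k)) ->
  (forall k, mu.-integrable setT (fun z => (a k z ^+ 2)%:E)) ->
  (forall k, mu.-integrable setT (fun z => (b k z ^+ 2)%:E)) ->
  (forall k, \int[mu]_z (a k z ^+ 2) <= C) ->
  (\int[mu]_z (b k z ^+ 2)) @[k --> \oo] --> 0 ->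
  (\int[mu]_z (a k z * b k z)) @[k --> \oo] --> 0.
Proof.
move=> ma mb ia ib aC b0; apply/cvgrPdist_le => e e0.
pose C' := `|C| + 1.
have C0 : 0 < C' by rewrite ltr_wpDl.
(* The weight in Young's inequality: the half with [a k] costs at most [e / 2] by the bound [C], the
   other half as soon as the integral of [b k z ^+ 2] is at most [e * de]. *)
pose de := e / C'.
have d0 : 0 < de by rewrite divr_gt0.
have ed : 0 < e * de by rewrite mulr_gt0.
have /cvgrPdist_le/(_ _ ed) := b0; apply: filterS => k.
rewrite !sub0r !normrN ger0_norm; last by apply: Rintegral_ge0 => z _; exact: sqr_ge0.
move=> bk.
have iab := integrable_sqr_mul (ma k) (mb k) (ia k) (ib k).
have i2 := integrableD measurableT (integrableZl measurableT (de / 2) (ia k))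
   (integrableZl measurableT (de^-1 / 2) (ib k)).
apply: le_trans (le_normr_Rintegral measurableT iab) _.
apply: (@le_trans _ _ (\int[mu]_z (de / 2 * (a k z ^+ 2) + de^-1 / 2 * (b k z ^+ 2)))).
  apply: le_Rintegral => //.
    by have := integrable_abse iab; apply: eq_integrable.
  move=> z _; rewrite normrM.
  have : 0 <= (de * `|a k z| - `|b k z|) ^+ 2 by exact: sqr_ge0.
  rewrite -[a k z ^+ 2]real_normK ?num_real// -[b k z ^+ 2]real_normK ?num_real//.
  move: (`|a k z|) (`|b k z|) => x y h.
  have -> : de / 2 * x ^+ 2 + de^-1 / 2 * y ^+ 2 = x * y + de^-1 / 2 * (de * x - y) ^+ 2.
    by field; rewrite gt_eqF.
  by rewrite lerDl mulr_ge0// divr_ge0// invr_ge0 ltW.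
have iZ (c : R) (f : T -> R) : mu.-integrable setT (fun z => (f z)%:E) ->
    mu.-integrable setT (EFin \o (fun z => c * f z)).
  by move=> /(integrableZl measurableT c).
rewrite RintegralD//; [|exact: iZ|exact: iZ].
rewrite !RintegralZl//; [|exact: ib|exact: ia].
have h1 : de / 2 * \int[mu]_z (a k z ^+ 2) <= e / 2.
  rewrite mulrAC ler_pM2r ?invr_gt0// /de mulrAC ler_pdivrMr//.
  rewrite ler_pM2l//; apply: le_trans (aC k) _; apply: le_trans (ler_norm _) _.
  by rewrite lerDl.
have h2 : de^-1 / 2 * \int[mu]_z (b k z ^+ 2) <= e / 2.
  by rewrite mulrAC ler_pM2r ?invr_gt0// ler_pdivrMl// mulrC.
lra.
Qed.

End square_integrable.

(** A closed interval around [L] is closed under midpoints and [l] preserves them on the hull, so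
    the whole hull of a tail is mapped into it. *)
Lemma mid_hull_lim (R : realType) (E : lmodType R) (S : nat -> E) (l : E -> R) (L : R)
    (h : nat -> E) :
  (forall a b, mid_hull S 0 a -> mid_hull S 0 b -> l (2^-1 *: (a + b)) = 2^-1 * (l a + l b)) ->
  l (S j) @[j --> \oo] --> L -> (forall k, mid_hull S k (h k)) ->
  l (h k) @[k --> \oo] --> L.
Proof.
move=> lin lS hh; apply/cvgrPdist_le => e e0.
have /cvgrPdist_le/(_ _ e0)[q _ qP] := lS.
exists q => // k /= qk; suff H c : mid_hull S q c -> `|L - l c| <= e.
  by apply: H; exact: mid_hullW (hh k).
elim=> [j qj|a b ha Pa hb Pb].
  exact: qP.
have h0 c' : mid_hull S q c' -> mid_hull S 0 c' by exact: mid_hullW.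
rewrite lin; [|exact: h0|exact: h0].
by move: Pa Pb; rewrite !ler_norml => /andP[? ?] /andP[? ?]; apply/andP; split; lra.
Qed.

Lemma addZE (R : nzRingType) n (g v : 'rV[R]_n) (h : R) j :
  (g + h *: v) 0 j = g 0 j + h * v 0 j.
Proof. by rewrite !mxE. Qed.

Lemma deltaE (R : nzRingType) n (i j : 'I_n) :
  (delta_mx 0 i : 'rV[R]_n) 0 j = (j == i)%:R.
Proof. by rewrite mxE eqxx. Qed.

(** * Lattice shifts and sampled difference quotients *)

Section lattice_shift.
Context (R : realType) (n : nat).
Local Notation GX p := 'rV['I_(gsize p).+1]_n.
Local Notation eps := (eps R).

Lemma gpos_shift p (x : GX p) i :
  (forall j, j != i -> gpos R (x + unitv _ i) 0 j = gpos R x 0 j) /\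
  (gpos R (x + unitv _ i) = gpos R x + eps p *: delta_mx 0 i \/
   gpos R x 0 i = 2 ^+ p - eps p /\ gpos R (x + unitv _ i) 0 i = - 2 ^+ p).
Proof.
have off j : j != i -> gpos R (x + unitv _ i) 0 j = gpos R x 0 j.
  by move=> ji; rewrite [LHS]mxE [RHS]mxE unit_shift_val (negbTE ji).
split=> //.
have [h|h] := ltnP (x 0 i).+1 (gsize p).+1.
  left; apply/rowP => j; have [->|ji] := eqVneq j i; last first.
    by rewrite off// addZE deltaE (negbTE ji) mulr0 addr0.
  rewrite [LHS]mxE unit_shift_val eqxx modn_small// addZE deltaE eqxx mulr1.
  by rewrite mxE -[(x 0 i).+1%:R]natr1 mulrDl mul1r addrA.
right; have xg : (x 0%R i).+1 = (gsize p).+1 by apply/eqP; rewrite eqn_leq h ltn_ord.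
split; last by rewrite mxE unit_shift_val eqxx xg modnn mul0r addr0.
have : (x 0 i).+1%:R * eps p = 2 * 2 ^+ p by rewrite xg gsizeE.
by rewrite mxE -[(x 0 i).+1%:R]natr1 [(_ + 1) * _]mulrDl mul1r; lra.
Qed.

Lemma gpos_shift_in p (x : GX p) i : `|gpos R x 0 i| + eps p < 2 ^+ p ->
  gpos R (x + unitv _ i) = gpos R x + eps p *: delta_mx 0 i.
Proof.
move=> h; have [_ [//|[E _]]] := gpos_shift x i.
move: h; rewrite E => h; have := eps_gt0 R p; exfalso.
by have := ler_norm (2 ^+ p - eps p); lra.
Qed.

Lemma gpos_shift_out p (x : GX p) i (r : R) : r + 1 < 2 ^+ p ->
  (exists j, r + 1 < `|gpos R x 0 j|) -> exists j, r < `|gpos R (x + unitv _ i) 0 j|.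
Proof.
move=> rp [j hj]; have [off [sh|[_ sh]]] := gpos_shift x i.
  exists j; have [E|ji] := eqVneq j i; last by rewrite off//; lra.
  rewrite sh addZE deltaE E eqxx mulr1.
  have := ler_normB (gpos R x 0 i + eps p) (eps p); rewrite addrK -E.
  rewrite (ger0_norm (ltW (eps_gt0 R p))); have := eps_le1 R p; lra.
have [E|ji] := eqVneq j i.
  by exists i; rewrite sh normrN ger0_norm ?exprn_ge0//; lra.
by exists j; rewrite off//; lra.
Qed.

End lattice_shift.

Section lattice_test.
Context (R : realType) (n : nat) (T : R) (A : nat).
Hypotheses (T0 : 0 < T) (A0 : (0 < A)%N).
Local Notation Rn := 'rV[R]_n.
Local Notation mu := (lebesgue_rV R n).
Local Notation GX p := 'rV['I_(gsize p).+1]_n.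
Local Notation Z := (measurableTypeR R * Rn)%type.
Local Notation K := (nsteps A).
Local Notation tau := (tau T A).
Local Notation eps := (eps R).
Local Notation stst := (@stst R n T A _).

Variables (phi : R -> Rn -> R) (r : R).
Let Phi : R * Rn -> R := fun z => phi z.1 z.2.

(** Vanishing is asked up to and including [t = T], because test functions are evaluated at the end
    [k.+1%:R * tau p] of a time step. *)
Record lattice_test : Prop := LatticeTest {
  lt_diff : forall z, differentiable Phi z;
  lt_cont : forall v, continuous ('D_v Phi : R * Rn -> R);
  lt_supp : forall t (y : Rn), 0 <= t -> t <= T -> (exists i, r < `|y 0 i|) -> phi t y = 0 }.

Hypothesis ok : lattice_test.

Let p0 := (Num.truncn (`|r| + 1)).+1.

Let p0r p : (p0 <= p)%N -> r + 1 < 2 ^+ p.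
Proof.
move=> pp; apply: le_lt_trans (_ : `|r| + 1 < _); first by rewrite lerD2r ler_norm.
apply: lt_trans (truncnS_gt _) _; rewrite -natrX ltr_nat.
by apply: leq_ltn_trans pp _; exact: ltn_expl.
Qed.

Let supp0 t (y : Rn) : 0 <= t -> t <= T -> (exists i, r + 1 < `|y 0 i|) -> phi t y = 0.
Proof.
by move=> ? ? [i h]; apply: (lt_supp ok) => //; exists i; move: h; lra.
Qed.

Let time_in p k : (k <= K p)%N -> 0 <= k%:R * tau p <= T.
Proof.
have tp := tau_gt0 T0 A0 p.
move=> kK; rewrite mulr_ge0 ?(ltW tp)//= -[leRHS](nsteps_tau T A0 p).
by apply: ler_wpM2r; [exact: ltW|rewrite ler_nat].
Qed.

Let PhiC : continuous Phi.
Proof. by move=> z; apply: differentiable_continuous; exact: (lt_diff ok). Qed.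

Let step_in p k : k%:R * tau p <= k.+1%:R * tau p <= k.+1%:R * tau p.
Proof. by rewrite lexx andbT ler_wpM2r ?(ltW (tau_gt0 T0 A0 p))// ler_nat. Qed.

Lemma sampled_value :
  exists (M : R) (N : nat),
   (forall p (z : Z), (N <= p)%N ->
      `|stst (fun k (x : GX p) => phi (k.+1%:R * tau p) (gpos R x)) z| <=
      stst (fun k (x : GX N) => M) z) /\
   (forall z : Z, intime T z.1 ->
     (fun p => stst (fun k (x : GX p) => phi (k.+1%:R * tau p) (gpos R x)) z) @ \oo --> Phi z).
Proof.
apply: (sampled_cvg T0 A0 (D := Phi) (r := r + 1) (p0 := p0)) => //.
  move=> p k x _ kK o; have /andP[? ?] := time_in kK; exact: supp0.
move=> p k x _ kK o; exists (k.+1%:R * tau p, gpos R x); split=> //; split=> //.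
by move=> i; rewrite subrr normr0 ltW// eps_gt0.
Qed.

Lemma sampled_initial :
  exists (M : R) (N : nat),
   (forall p (z : Z), (N <= p)%N ->
      `|stst (fun k (x : GX p) => phi 0 (gpos R x)) z| <=
      stst (fun k (x : GX N) => M) z) /\
   (forall z : Z, intime T z.1 ->
     (fun p => stst (fun k (x : GX p) => phi 0 (gpos R x)) z) @ \oo --> phi 0 z.2).
Proof.
pose D (z : R * Rn) := phi 0 z.2.
apply: (sampled_cvg T0 A0 (D := D) (r := r + 1) (p0 := p0)).
- move=> z; apply: (@continuous_comp _ _ _ (fun z : R * Rn => ((0, z.2) : R * Rn)) Phi).
    apply: (@cvg_pair (R * Rn) R Rn (nbhs z) (nbhs (0 : R)) (nbhs z.2) _ _ _ (fun=> 0) snd).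
      exact: cvg_cst.
    exact: cvg_snd.
  exact: PhiC.
- by move=> p k x _ kK o; apply: supp0 => //; exact: ltW.
move=> p k x _ kK o; exists (k.+1%:R * tau p, gpos R x); split=> //; split=> //.
by move=> i; rewrite subrr normr0 ltW// eps_gt0.
Qed.

Lemma sampled_space i :
  exists (M : R) (N : nat),
   (forall p (z : Z), (N <= p)%N ->
      `|stst (fun k (x : GX p) => (phi (k.+1%:R * tau p) (gpos R (x + unitv _ i))
          - phi (k.+1%:R * tau p) (gpos R x)) / eps p) z| <=
      stst (fun k (x : GX N) => M) z) /\
   (forall z : Z, intime T z.1 ->
     (fun p => stst (fun k (x : GX p) => (phi (k.+1%:R * tau p) (gpos R (x + unitv _ i))
          - phi (k.+1%:R * tau p) (gpos R x)) / eps p) z) @ \oo -->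
      'D_((0, delta_mx 0 i) : R * Rn) Phi (z : R * Rn)).
Proof.
apply: (sampled_cvg T0 A0 (D := 'D_((0, delta_mx 0 i) : R * Rn) Phi) (r := r + 1) (p0 := p0)).
- exact: (lt_cont ok).
- move=> p k x pp kK o; have /andP[h1 h2] := time_in kK.
  rewrite [phi _ (gpos R x)]supp0// (lt_supp ok)// ?subr0 ?mul0r//.
  by apply: gpos_shift_out => //; exact: p0r.
move=> p k x _ kK o.
have [c [/andP[c0 ce] E]] := mvt_line (k.+1%:R * tau p, gpos R x) (0, delta_mx 0 i)
  (lt_diff ok) (eps_gt0 R p).
have pe (h : R) : (k.+1%:R * tau p, gpos R x) + h *: ((0, delta_mx 0 i) : R * Rn) =
    (k.+1%:R * tau p, gpos R x + h *: delta_mx 0 i).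
  by rewrite -[LHS]/(_ + h *: 0, _) scaler0 addr0.
exists (k.+1%:R * tau p, gpos R x + c *: delta_mx 0 i); split.
  split=> // j; rewrite addZE [delta_mx _ _ _ _]mxE eqxx/=.
  rewrite addrAC subrr add0r ger0_norm ?mulr_ge0 ?(ltW c0)//.
  by case: (j == i); rewrite ?mulr1 ?mulr0 ltW// eps_gt0.
rewrite -pe gpos_shift_in//; move: E; rewrite !pe /Phi /= => ->.
by rewrite mulrC mulKf// gt_eqF// eps_gt0.
Qed.

Lemma sampled_time :
  exists (M : R) (N : nat),
   (forall p (z : Z), (N <= p)%N ->
      `|stst (fun k (x : GX p) => (phi (k.+1%:R * tau p) (gpos R x)
          - phi (k%:R * tau p) (gpos R x)) / tau p) z| <=
      stst (fun k (x : GX N) => M) z) /\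
   (forall z : Z, intime T z.1 ->
     (fun p => stst (fun k (x : GX p) => (phi (k.+1%:R * tau p) (gpos R x)
          - phi (k%:R * tau p) (gpos R x)) / tau p) z) @ \oo -->
      'D_((1, 0) : R * Rn) Phi (z : R * Rn)).
Proof.
apply: (sampled_cvg T0 A0 (D := 'D_((1, 0) : R * Rn) Phi) (r := r + 1) (p0 := p0)).
- exact: (lt_cont ok).
- move=> p k x pp kK o; have /andP[h1 h2] := time_in kK.
  have /andP[h3 h4] := time_in (ltnW kK).
  by rewrite !supp0// subr0 mul0r.
move=> p k x _ kK o; have tp := tau_gt0 T0 A0 p.
have [c [/andP[c0 ce] E]] := mvt_line (k%:R * tau p, gpos R x) (1, 0) (lt_diff ok) tp.
have pe (h : R) : (k%:R * tau p, gpos R x) + h *: ((1, 0) : R * Rn) =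
    (k%:R * tau p + h, gpos R x).
  by rewrite -[LHS]/(_ + h * 1, _ + h *: 0) scaler0 addr0 mulr1.
have ks : k.+1%:R * tau p = k%:R * tau p + tau p by rewrite -natr1 mulrDl mul1r.
exists (k%:R * tau p + c, gpos R x); split.
  split=> [|j]; last by rewrite subrr normr0 ltW// eps_gt0.
  by rewrite ks /=; apply/andP; split; [rewrite lerDl ltW|rewrite lerD2l ltW].
rewrite -pe ks; move: E; rewrite !pe /Phi /= => ->.
by rewrite mulrC mulKf// gt_eqF.
Qed.

(** Mean value theorem along the segment from the corner of the cell to [y]: the partial derivatives
    are bounded on a compact set, and beyond it both values vanish. *)
Lemma sampling_error : exists C, 0 <= C /\
  forall p t (y : Rn), 0 <= t <= T -> inbox p y ->
    `|phi t y - phi t (gpos R (cell p y))| <= C * eps p.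
Proof.
pose Q : set (R * Rn) := `[0, T]%classic `*`
  [set y : Rn | forall i, `[- (`|r| + 2), `|r| + 2]%classic (y 0 i)].
have cQ : compact Q.
  apply: compact_setX; first exact: segment_compact.
  by apply: (@rV_compact R n (fun=> `[- (`|r| + 2), `|r| + 2]%classic)) => i; exact: segment_compact.
have bnd i : exists M, 0 <= M /\ forall z, Q z -> `|'D_((0, delta_mx 0 i) : R * Rn) Phi z| <= M.
  have cD : {within Q, continuous ('D_((0, delta_mx 0 i) : R * Rn) Phi)}.
    by apply: continuous_subspaceT; exact: (lt_cont ok).
  have [M0 [_ HM]] := compact_bounded (continuous_compact cD cQ).
  exists (`|M0| + 1); split; first by rewrite addr_ge0.
  move=> z Qz; apply: (HM (`|M0| + 1)); [have := ler_norm M0; lra|by exists z].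
pose M i := sval (cid (bnd i)).
have MP i : 0 <= M i /\ forall z, Q z -> `|'D_((0, delta_mx 0 i) : R * Rn) Phi z| <= M i.
  by rewrite /M; case: cid.
exists (\sum_i M i); split; first by apply: sumr_ge0 => i _; have [] := MP i.
move=> p t y /andP[t0 tT] yb.
have C0 : 0 <= \sum_i M i by apply: sumr_ge0 => i _; have [] := MP i.
have e0 := eps_gt0 R p; have e1 := eps_le1 R p.
have /(_ (conj yb erefl)) cz := (@cellsetP R n p (cell p y) y).2.
set g := gpos R (cell p y) in cz *.
have [far|near] := pselect (exists i, r + 1 < `|y 0 i|).
  rewrite supp0// sub0r normrN (lt_supp ok) ?normr0 ?mulr_ge0 ?(ltW e0)//.
  have [i hi] := far; exists i; have /andP[c1 c2] := cz i.
  have := ler_normB (g 0 i) (g 0 i - y 0 i); rewrite opprB addrC subrK.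
  have : `|g 0 i - y 0 i| <= 1 by rewrite ler_norml; apply/andP; split; lra.
  by move: hi; lra.
have yr i : `|y 0 i| <= r + 1 by rewrite leNgt; apply/negP => h; apply: near; exists i.
pose v := y - g.
have v01 i : 0 <= v 0 i <= eps p.
  have -> : v 0 i = y 0 i - g 0 i by rewrite /v [LHS]mxE [X in _ + X]mxE.
  by have /andP[c1 c2] := cz i; apply/andP; split; lra.
have [c [/andP[c0 c1] E]] := mvt_line ((t, g) : R * Rn) (0, v) (lt_diff ok) ltr01.
have pe (h : R) : (t, g) + h *: ((0, v) : R * Rn) = (t, g + h *: v).
  by rewrite -[LHS]/(_ + h *: 0, _) scaler0 addr0.
have gy : g + v = y by rewrite /v addrC subrK.
move: E; rewrite !pe scale1r gy mul1r {1 2}/Phi /= => ->.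
have vE : ((0, v) : R * Rn) = \sum_i v 0 i *: ((0, delta_mx 0 i) : R * Rn).
  rewrite {1}(row_sum_delta v).
  rewrite (big_morph (fun u : Rn => ((0, u) : R * Rn)) (id1 := 0) (op1 := +%R))//.
    by apply: eq_bigr => i _; rewrite -[RHS]/(v 0 i *: 0, _) scaler0.
  by move=> a b; rewrite -[RHS]/(0 + 0, _) addr0.
rewrite deriveE; last exact: (lt_diff ok).
rewrite vE linear_sum; apply: le_trans (ler_norm_sum _ _ _) _.
rewrite mulr_suml; apply: ler_sum => i _.
have /andP[v0 v1] := v01 i.
rewrite linearZ normrZ (ger0_norm v0) mulrC; apply: ler_pM => //.
rewrite -deriveE; last exact: (lt_diff ok).
have [_ ] := MP i; apply; split; first by rewrite /= in_itv/= t0.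
move=> j; rewrite /= in_itv/= addZE.
have /andP[w0 w1] := v01 j; have /andP[z0 z1] := cz j.
have := yr j; have := ler_norm r; rewrite ler_norml => h1 /andP[h2 h3].
have u0 : 0 <= c * v 0 j by rewrite mulr_ge0// ltW.
have u1 : c * v 0 j <= eps p.
  by apply: le_trans w1; rewrite ler_piMl// ltW.
by apply/andP; split; lra.
Qed.

End lattice_test.

(** * Limits of pairings *)

Lemma cvg_norm_le (R : realType) (u : nat -> R) (l g : R) (N : nat) :
  u @ \oo --> l -> (forall k, (N <= k)%N -> `|u k| <= g) -> `|l| <= g.
Proof.
move=> ul ug; have h : (`|u k|) @[k --> \oo] --> `|l| by exact: cvg_norm.
rewrite -(cvg_lim (@Rhausdorff R) h); apply: limr_le; first by apply/cvg_ex; exists `|l|.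
by exists N.
Qed.

Section pairing_limits.
Context d (T : measurableType d) (R : realType) (mu : {measure set T -> \bar R}).

Lemma integrable_mul_bounded (a b : T -> R) (M : R) : mu.-integrable setT (EFin \o a) ->
  measurable_fun setT b -> (forall z, `|b z| <= M) ->
  mu.-integrable setT (EFin \o (fun z => a z * b z)).
Proof.
move=> ia mb bM; have /integrableP[/measurable_EFinP ma _] := ia.
have ia' := integrableZl measurableT M (integrable_abse ia).
apply: le_integrable ia' => //.
  by apply/measurable_EFinP; exact: measurable_funM.
move=> z _; rewrite /= lee_fin normrM [leRHS]ger0_norm; last first.
  by rewrite mulr_ge0// (le_trans _ (bM z)).
by rewrite mulrC ler_wpM2r.
Qed.

(** The product splits into [(a k - a0) * b k], small in L1 since [b k] is bounded, and [a0 * b k],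
    to which dominated convergence applies. *)
Let L1_pairing_all (a : nat -> T -> R) (a0 : T -> R) (b : nat -> T -> R) (b0 : T -> R) (M : R) :
  (forall k, mu.-integrable setT (EFin \o a k)) -> mu.-integrable setT (EFin \o a0) ->
  (\int[mu]_z `|a k z - a0 z|) @[k --> \oo] --> 0 ->
  (forall k, measurable_fun setT (b k)) -> measurable_fun setT b0 ->
  (forall k z, `|b k z| <= M) -> (\forall z \ae mu, b ^~ z @ \oo --> b0 z) ->
  (\int[mu]_z (a k z * b k z)) @[k --> \oo] --> \int[mu]_z (a0 z * b0 z).
Proof.
move=> ia ia0 aa mb mb0 bM bb0.
have /integrableP[/measurable_EFinP ma0 _] := ia0.
have i1 k := integrable_mul_bounded (ia k) (mb k) (bM k).
have i2 k := integrable_mul_bounded ia0 (mb k) (bM k).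
have id k : mu.-integrable setT (EFin \o (fun z => a k z - a0 z)).
  by have := integrableB measurableT (ia k) ia0.
have i3 k := integrable_mul_bounded (id k) (mb k) (bM k).
rewrite (_ : (fun k => _) = (fun k => \int[mu]_z ((a k z - a0 z) * b k z) +
    \int[mu]_z (a0 z * b k z))); last first.
  apply/funext => k; rewrite -RintegralD//.
  by apply: eq_Rintegral => z _; rewrite mulrBl subrK.
rewrite -[X in _ --> X]add0r; apply: cvgD; last first.
  have [] := @Rdominated _ _ _ mu (fun k z => a0 z * b k z) (fun z => a0 z * b0 z)
    (fun z => M * `|a0 z|) => //.
  - by move=> k; exact: measurable_funM.
  - exact: measurable_funM.
  - by apply: filterS bb0 => z bz; apply: cvgMr.
  - by move=> k z; rewrite normrM mulrC ler_wpM2r.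
  - exact: (integrableZl measurableT M (integrable_abse ia0)).
have iab k : mu.-integrable setT (EFin \o (fun z => `|a k z - a0 z|)).
  exact: integrable_abse (id k).
apply/cvgrPdist_le => e e0.
have e1 : 0 < e / (`|M| + 1) by rewrite divr_gt0// ltr_wpDl.
have /cvgrPdist_le/(_ _ e1) := aa; apply: filterS => k.
rewrite !sub0r !normrN ger0_norm; last by apply: Rintegral_ge0 => z _.
move=> h; apply: le_trans (le_normr_Rintegral measurableT (i3 k)) _.
apply: (@le_trans _ _ (\int[mu]_z ((`|M| + 1) * `|a k z - a0 z|))).
  apply: le_Rintegral => //; first exact: integrable_abse (i3 k).
    exact: (integrableZl measurableT (`|M| + 1) (iab k)).
  move=> z _; rewrite normrM mulrC ler_wpM2r//.
  by apply: le_trans (bM k z) _; apply: le_trans (ler_norm M) _; rewrite lerDl.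
rewrite RintegralZl//.
by rewrite mulrC -ler_pdivlMr// ltr_wpDl.
Qed.

Lemma L1_pairing_cvg (a : nat -> T -> R) (a0 : T -> R) (b : nat -> T -> R) (b0 : T -> R)
    (M : R) (N : nat) :
  (forall k, mu.-integrable setT (EFin \o a k)) -> mu.-integrable setT (EFin \o a0) ->
  (\int[mu]_z `|a k z - a0 z|) @[k --> \oo] --> 0 ->
  (forall k, measurable_fun setT (b k)) -> measurable_fun setT b0 ->
  (forall k z, (N <= k)%N -> `|b k z| <= M) -> (\forall z \ae mu, b ^~ z @ \oo --> b0 z) ->
  (\int[mu]_z (a k z * b k z)) @[k --> \oo] --> \int[mu]_z (a0 z * b0 z).
Proof.
move=> ia ia0 aa mb mb0 bM bb0; rewrite -(cvg_shiftn N).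
apply: (@L1_pairing_all (fun k => a (k + N)%N) a0 (fun k => b (k + N)%N) b0 M) => //.
- by rewrite (cvg_shiftn N (fun k => \int[mu]_z `|a k z - a0 z|)).
- by move=> k z; apply: bM; rewrite leq_addl.
by apply: filterS bb0 => z bz; rewrite (cvg_shiftn N (b ^~ z)).
Qed.

Lemma L2_dominated (b : nat -> T -> R) (b0 g : T -> R) (N : nat) :
  (forall k, measurable_fun setT (b k)) -> measurable_fun setT b0 ->
  (forall k z, (N <= k)%N -> `|b k z| <= g z) -> (forall z, b ^~ z @ \oo --> b0 z) ->
  mu.-integrable setT (fun z => (g z ^+ 2)%:E) ->
  (\int[mu]_z ((b k z - b0 z) ^+ 2)) @[k --> \oo] --> 0.
Proof.
move=> mb mb0 bg bb0 ig.
have b0g z : `|b0 z| <= g z.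
  by apply: (cvg_norm_le (bb0 z)) => k; exact: bg.
rewrite -(cvg_shiftn N).
have [] := @Rdominated _ _ _ mu (fun k z => (b (k + N)%N z - b0 z) ^+ 2) (fun=> 0)
    (fun z => 4 * g z ^+ 2) => //.
- by move=> k; apply: measurable_funX; exact: measurable_funB.
- apply: aeW => z.
  have c1 : b (k + N)%N z @[k --> \oo] --> b0 z by rewrite (cvg_shiftn N (b ^~ z)).
  have c : (b (k + N)%N z - b0 z) @[k --> \oo] --> 0.
    by rewrite -(subrr (b0 z)); apply: cvgB => //; exact: cvg_cst.
  rewrite (_ : (fun k => _) = (fun k => (b (k + N)%N z - b0 z) * (b (k + N)%N z - b0 z))).
    by rewrite -[X in _ --> X](mulr0 0); exact: cvgM.
  by apply/funext => k; rewrite expr2.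
- move=> k z; have h := bg (k + N)%N z (leq_addl _ _).
  rewrite ger0_norm ?sqr_ge0// (_ : 4 * g z ^+ 2 = (2 * g z) ^+ 2); last first.
    by rewrite exprMn -natrX.
  rewrite -[leLHS]real_normK ?num_real//.
  rewrite ler_pXn2r// ?nnegrE// ?mulr_ge0// ?(le_trans _ h)//.
  by apply: le_trans (ler_normB _ _) _; have := b0g z; move: h; lra.
- exact: (integrableZl measurableT 4 ig).
by move=> _; rewrite Rintegral_cst// mul0r.
Qed.

End pairing_limits.

Section test_functions.
Context (R : realType) (n : nat) (T : R) (A : nat).
Hypotheses (T0 : 0 < T) (A0 : (0 < A)%N).
Local Notation Rn := 'rV[R]_n.
Local Notation GX p := 'rV['I_(gsize p).+1]_n.
Local Notation Z := (measurableTypeR R * Rn)%type.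
Local Notation stst := (@stst R n T A _).

(** As limits of step functions, a test function and its derivatives receive their measurability and
    a bound by a single step function together. *)
Lemma stst_limit (a : forall p, nat -> GX p -> R) (D : R * Rn -> R) (M : R) (N : nat) :
  (forall p (z : Z), (N <= p)%N -> `|stst (a p) z| <= stst (fun k (x : GX N) => M) z) ->
  (forall z : Z, intime T z.1 -> (fun p => stst (a p) z) @ \oo --> D z) ->
  let D' := fun z : Z => if intime T z.1 then D z else 0 in
  [/\ measurable_fun setT D', forall z, (fun p => stst (a p) z) @ \oo --> D' z &
     forall z, `|D' z| <= stst (fun k (x : GX N) => M) z].
Proof.
move=> dom cv D'.
have cv' z : (fun p => stst (a p) z) @ \oo --> D' z.
  rewrite /D'; case: ifPn => [|zt]; first exact: cv.
  rewrite (_ : (fun p => _) = fun=> 0); first exact: cvg_cst.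
  by apply/funext => p; rewrite /stst (negbTE zt).
split=> //.
  rewrite (_ : D' = fun z => limval (fun p => stst (a p) z)).
    by apply: (measurable_limval (f := fun p => stst (a p))) => p; exact: measurable_stst.
  by apply/funext => z; rewrite (limvalE (cv' z)).
by move=> z; apply: (cvg_norm_le (cv' z)) => p; exact: dom.
Qed.

Lemma compact_radius (Q : set (R * Rn)) : compact Q ->
  exists r : R, forall z, Q z -> forall i, `|z.2 0 i| <= r.
Proof.
move=> cQ.
have bnd i : exists M : R, forall z, Q z -> `|z.2 0 i| <= M.
  have c : {within Q, continuous (fun z : R * Rn => z.2 0 i)}.
    apply: continuous_subspaceT => z.
    apply: (@continuous_comp _ _ _ (@snd R Rn) (fun y : Rn => y 0 i)); first exact: cvg_snd.
    exact: coord_continuous.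
  have [M0 [_ HM]] := compact_bounded (continuous_compact c cQ).
  exists (`|M0| + 1) => z Qz; apply: (HM (`|M0| + 1)); last by exists z.
  by have := ler_norm M0; lra.
pose M i := sval (cid (bnd i)).
have MP i z : Q z -> `|z.2 0 i| <= M i by rewrite /M; case: cid => M' h /h.
exists (\sum_i `|M i|) => z Qz i; apply: le_trans (MP i z Qz) _.
by apply: le_trans (ler_norm _) _; rewrite (bigD1 i)//= lerDl; exact: sumr_ge0.
Qed.

(** The support is compact and stays before [T], so [phi] vanishes at times just before [T], for
    each fixed [y], and at [T] itself by continuity. *)
Lemma C1_lattice (phi : R -> Rn -> R) : C1_test T%:E phi ->
  (exists r, lattice_test T phi r) /\ forall y, phi T y = 0.
Proof.
case=> dP cP [Q [cQ QT Q0]].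
have [r rQ] := compact_radius cQ.
have PhiC : continuous (fun z : R * Rn => phi z.1 z.2).
  by move=> z; apply: differentiable_continuous; exact: dP.
have endT y : phi T y = 0.
  have ct : continuous (fun t => phi t y).
    move=> t; apply: (@continuous_comp _ _ _ (fun t : R => ((t, y) : R * Rn))
      (fun z : R * Rn => phi z.1 z.2)); last exact: PhiC.
    apply: (@cvg_pair R R Rn (nbhs t) (nbhs t) (nbhs y) _ _ _ id (fun=> y)).
      exact: cvg_id.
    exact: cvg_cst.
  have op : open (~` Q) by apply: closed_openC; apply: compact_closed => //; exact: norm_hausdorff.
  have nQ : ~ Q (T, y) by move=> /QT/= [_]; rewrite ltxx.
  have ctT : ((t, y) : R * Rn) @[t --> T] --> (T, y).
    apply: (@cvg_pair R R Rn (nbhs T) (nbhs T) (nbhs y) _ _ _ id (fun=> y)).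
      exact: cvg_id.
    exact: cvg_cst.
  have nearQ : \forall t \near T, ~ Q (t, y).
    exact: (ctT (~` Q) (open_nbhs_nbhs (conj op nQ))).
  have lim : phi t y @[t --> T^'-] --> phi T y.
    by apply: cvg_at_left_filter; exact: ct.
  have lim0 : phi t y @[t --> T^'-] --> 0.
    apply: (@cvg_trans _ ((fun=> 0) @ T^'-)); last exact: cvg_cst.
    apply: near_eq_cvg; near=> t; apply/esym.
    apply: (Q0 (t, y)) => /=.
    - by apply/ltW; near: t; exact: nbhs_left_gt.
    - by rewrite lte_fin; near: t; exact: nbhs_left_lt.
    near: t; exact: cvg_within nearQ.
  by apply: (cvg_unique _ lim lim0); exact: norm_hausdorff.
split=> //; exists r; split=> // t y t0 tT [i hi].
move: tT; rewrite le_eqVlt => /predU1P[->//|tT].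
apply: (Q0 (t, y)) => //= Qz; have := rQ _ Qz i.
by move: hi => /=; rewrite ltNge => /negbTE ->.
Unshelve. all: by end_near. Qed.

Lemma smooth_lattice (psi : Rn -> R) : smooth_test psi ->
  exists r, lattice_test T (fun=> psi) r.
Proof.
case=> sm [Q [cQ Q0]].
have [r rQ] : exists r : R, forall y, Q y -> forall i, `|y 0 i| <= r.
  have cQ' : compact (`[0, 1]%classic `*` Q : set (R * Rn)).
    by apply: compact_setX => //; exact: segment_compact.
  have [r rQ] := compact_radius cQ'.
  exists r => y Qy i; apply: (rQ (0, y)); split=> //=.
  by rewrite in_itv/= lexx ler01.
exists r; split.
- move=> z; apply: (@differentiable_comp R _ _ _ (@snd R Rn) psi) => //.
    by apply: linear_differentiable => w; exact: cvg_snd.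
  exact: (sm [::] z.2).
- move=> v z.
  have E (z' : R * Rn) : 'D_v (fun z : R * Rn => psi z.2) z' = 'D_(v.2) psi z'.2.
    rewrite /derive.
    by rewrite (_ : (fun h : R => h^-1 *: _) =
      (fun h : R => h^-1 *: ((psi \o shift z'.2) (h *: v.2) - psi z'.2))).
  have cD : {for z.2, continuous ('D_(v.2) psi : Rn -> R)}.
    by apply: differentiable_continuous; exact: (sm [:: v.2]).
  rewrite /continuous_at E (_ : 'D_v _ = ('D_(v.2) psi : Rn -> R) \o snd); last exact/funext.
  by apply: (@continuous_comp _ _ _ (@snd R Rn) ('D_(v.2) psi : Rn -> R)) => //; exact: cvg_snd.
move=> t y _ _ [i hi]; apply: Q0 => Qy; have := rQ _ Qy i.
by rewrite leNgt hi.
Qed.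

End test_functions.

(** * Strong limits of convex combinations *)

Section fast_convergence.
Context d (T : measurableType d) (R : realType) (mu : {measure set T -> \bar R}).

Lemma integral_le_EFin (f : T -> R) (c : R) : mu.-integrable setT (EFin \o f) ->
  \int[mu]_z f z <= c -> (\int[mu]_z (f z)%:E <= c%:E)%E.
Proof.
move=> /(integrable_fin_num measurableT) fi fc.
by rewrite -[X in (X <= _)%E]/(\int[mu]_z (EFin \o f) z)%E -(fineK fi) lee_fin.
Qed.

Lemma ge0_integrable (f : T -> R) (c : R) : measurable_fun setT f -> (forall z, 0 <= f z) ->
  (\int[mu]_z (f z)%:E <= c%:E)%E ->
  mu.-integrable setT (EFin \o f) /\ \int[mu]_z f z <= c.
Proof.
move=> mf f0 fc.
have fi : mu.-integrable setT (EFin \o f).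
  apply/integrableP; split; first exact/measurable_EFinP.
  rewrite (eq_integral (fun z => (f z)%:E)); first by apply: le_lt_trans fc _; rewrite ltry.
  by move=> z _; rewrite /= ger0_norm.
by split=> //; rewrite -lee_fin /Rintegral fineK//; exact: integrable_fin_num.
Qed.

Lemma fast_limit (f e : nat -> T -> R) : (forall k, measurable_fun setT (f k)) ->
  (forall k, measurable_fun setT (e k)) -> (forall k z, 0 <= e k z) ->
  (forall k, (\int[mu]_z (e k z)%:E <= (2^-1 ^+ k)%:E)%E) ->
  (forall k z, `|f k.+1 z - f k z| <= 2^-1 ^+ k + e k z) ->
  \forall z \ae mu, f ^~ z @ \oo --> limval (f ^~ z).
Proof.
move=> mf me e0 Ie fe; have := ae_series_cvg me e0 Ie; apply: filterS => z cz.
have /cvg_ex[l fl] := cvg_of_summable (u := f ^~ z) cz (e0 ^~ z) (fe ^~ z).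
by rewrite (limvalE fl).
Qed.

Lemma integrable_sqr_lin (a b : T -> R) (c c' : R) : measurable_fun setT a ->
  measurable_fun setT b -> mu.-integrable setT (EFin \o (fun z => a z ^+ 2)) ->
  mu.-integrable setT (EFin \o (fun z => b z ^+ 2)) ->
  mu.-integrable setT (EFin \o (fun z => (c * a z + c' * b z) ^+ 2)).
Proof.
move=> ma mb ia ib.
have i2 := integrableD measurableT (integrableZl measurableT (2 * c ^+ 2) ia)
  (integrableZl measurableT (2 * c' ^+ 2) ib).
apply: le_integrable i2 => //.
  by apply/measurable_EFinP; apply: measurable_funX; apply: measurable_funD; exact: measurable_funM.
move=> z _; rewrite /= lee_fin ger0_norm ?sqr_ge0// ger0_norm; last first.
  by rewrite addr_ge0// mulr_ge0 ?sqr_ge0// mulr_ge0 ?sqr_ge0.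
rewrite -subr_ge0.
rewrite [X in _ <= X](_ : _ = (c * a z - c' * b z) ^+ 2) ?sqr_ge0//.
by move: (a z) (b z) => x y; ring.
Qed.

End fast_convergence.

Section mazur.
Context d (T : measurableType d) (R : realType) (mu : {measure set T -> \bar R}) (I : finType).
Local Notation E := (I -> T -> R^o).
Variables (S : nat -> E) (C : R).
Hypotheses (mS : forall j i, measurable_fun setT (S j i))
  (iS : forall j i, mu.-integrable setT (EFin \o (fun z => S j i z ^+ 2)))
  (CS : forall j, \sum_i \int[mu]_z (S j i z ^+ 2) <= C).

Let sq (a : E) := forall i, measurable_fun setT (a i) /\
  mu.-integrable setT (EFin \o (fun z => a i z ^+ 2)).

Let N (a : E) := \sum_i \int[mu]_z (a i z ^+ 2).

Let sq_lin a b (c c' : R) : sq a -> sq b -> sq (c *: a + c' *: b).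
Proof.
move=> sa sb i; have [ma ia] := sa i; have [mb ib] := sb i; split.
  by apply: measurable_funD; exact: measurable_funM.
exact: integrable_sqr_lin.
Qed.

Let midE (a b : E) : 2^-1 *: (a + b) = 2^-1 *: a + 2^-1 *: b.
Proof. by rewrite scalerDr. Qed.

Let subE (a b : E) : a - b = 1 *: a + (-1) *: b.
Proof. by rewrite scale1r scaleN1r. Qed.

Lemma mid_hull_sqr a : mid_hull S 0 a -> sq a.
Proof.
elim=> [j _ i|x y _ sx _ sy]; first by split; [exact: mS|exact: iS].
by rewrite midE; exact: sq_lin.
Qed.

Let par a b : sq a -> sq b ->
  N (2^-1 *: (a + b)) + 4^-1 * N (a - b) = 2^-1 * N a + 2^-1 * N b.
Proof.
move=> sa sb; rewrite /N !mulr_sumr -!big_split/=; apply: eq_bigr => i _.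
have [ma ia] := sa i; have [mb ib] := sb i.
have [_ im] := sq_lin 2^-1 2^-1 sa sb i; have [_ iB] := sq_lin 1 (-1) sa sb i.
rewrite midE subE.
have Z (f : T -> R) (c : R) : mu.-integrable setT (EFin \o f) ->
   mu.-integrable setT (EFin \o (fun z => c * f z)).
  by move=> h; exact: (integrableZl measurableT c h).
rewrite -!RintegralZl// -RintegralD//; last exact: Z.
rewrite -RintegralD//; [|exact: Z|exact: Z].
apply: eq_Rintegral => z _.
rewrite -[(2^-1 *: a + _) i z]/(2^-1 * a i z + 2^-1 * b i z).
rewrite -[(1 *: a + _) i z]/(1 * a i z + -1 * b i z).
by move: (a i z : R) (b i z : R) => x y; field.
Qed.

(** The limit is a function rather than a class: the [limval] of a fast subsequence of the
    near-minimal combinations, with Fatou's lemma turning the Cauchy property into convergence. The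
    last clause preserves zeros of the sequence, hence the vanishing outside the time interval. *)
Lemma mazur_L2 : exists (H : nat -> E) (G : I -> T -> R),
  [/\ forall k, mid_hull S k (H k), forall i, measurable_fun setT (G i),
      forall i, mu.-integrable setT (EFin \o (fun z => G i z ^+ 2)),
      forall i k, (\int[mu]_z ((H k i z - G i z) ^+ 2)%:E <= (2^-1 ^+ k)%:E)%E &
      forall i z, (forall k, H k i z = 0) -> G i z = 0].
Proof.
have hs a : mid_hull S 0 a -> sq a by exact: mid_hull_sqr.
have N0 a : 0 <= N a by apply: sumr_ge0 => i _; apply: Rintegral_ge0 => z _; exact: sqr_ge0.
have [h [hh cau]] := mid_hull_cauchy (fun a _ => N0 a)
  (fun a b ha hb => par (hs _ ha) (hs _ hb)) CS.
have eta0 k : 0 < (2^-1 ^+ k) ^+ 2 :> R by rewrite !exprn_gt0.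
have [q qP] := cauchy_subseq (D := fun k l => N (h k - h l)) eta0 cau.
pose H k := h (q k).
have hH k : mid_hull S k (H k) by apply: mid_hullW (hh (q k)); have [] := qP k.
have sH k : sq (H k) by apply: hs; exact: mid_hullW (leq0n k) (hH k).
have mH k i : measurable_fun setT (H k i) by have [] := sH k i.
have iHH k l i : mu.-integrable setT (EFin \o (fun z => (H k i z - H l i z) ^+ 2)).
  have [_] := sq_lin 1 (-1) (sH k) (sH l) i; rewrite -subE; exact.
have HH k l i : (k <= l)%N -> (\int[mu]_z ((H k i z - H l i z) ^+ 2)%:E <= ((2^-1 ^+ k) ^+ 2)%:E)%E.
  move=> kl; apply: integral_le_EFin => //.
  have [_ /(_ l kl)] := qP k; apply: le_trans.
  rewrite /N (bigD1 i)//= lerDl; apply: sumr_ge0 => j _.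
  by apply: Rintegral_ge0 => z _; exact: sqr_ge0.
have p1 k : 0 < 2^-1 ^+ k :> R by rewrite exprn_gt0.
pose G i z := limval (fun k => H k i z).
have cG i : \forall z \ae mu, (fun k => H k i z) @ \oo --> G i z.
  (* For [p = 2^-1 ^+ k] and [y >= 0] one has [y <= p + y ^+ 2 / p]; the integral of the second term
     is at most [p], since squared distances are at most [p ^+ 2]. *)
  apply: (@fast_limit _ _ _ mu (fun k => H k i)
    (fun k z => (2^-1 ^+ k)^-1 * (H k i z - H k.+1 i z) ^+ 2)) => //.
  - move=> k; apply: measurable_funM => //; apply: measurable_funX.
    exact: measurable_funB.
  - by move=> k z; rewrite mulr_ge0 ?sqr_ge0// invr_ge0 ltW.
  - move=> k; under eq_integral do rewrite EFinM.
    have h1 : 0 <= (2^-1 ^+ k)^-1 :> R by rewrite invr_ge0 ltW.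
    have /integrableP[h2 _] := iHH k k.+1 i.
    have h3 z : setT z -> (0 <= ((H k i z - H k.+1 i z) ^+ 2)%:E)%E by rewrite lee_fin sqr_ge0.
    rewrite ge0_integralZl_EFin//.
    apply: (@le_trans _ _ (((2^-1 ^+ k)^-1)%:E * ((2^-1 ^+ k) ^+ 2)%:E)%E).
      by apply: lee_wpmul2l; [rewrite lee_fin|exact: HH].
    by rewrite -EFinM expr2 mulKf// gt_eqF.
  move=> k z; rewrite distrC.
  move: (2^-1 ^+ k) (p1 k) (H k i z - H k.+1 i z) => p pp x.
  rewrite -[x ^+ 2]real_normK ?num_real//; move: `|x| (normr_ge0 x) => y y0.
  have h1 : 0 <= p^-1 * ((p - y) ^+ 2) by rewrite mulr_ge0 ?sqr_ge0// invr_ge0 ltW.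
  have h2 : p + p^-1 * y ^+ 2 = y + (y + p^-1 * ((p - y) ^+ 2)).
    by field; rewrite gt_eqF.
  by rewrite h2 lerDl addr_ge0.
have mG i : measurable_fun setT (G i).
  by apply: (measurable_limval (f := fun k => H k i)) => k; exact: mH.
have HG i k : (\int[mu]_z ((H k i z - G i z) ^+ 2)%:E <= ((2^-1 ^+ k) ^+ 2)%:E)%E.
  apply: (@fatou_le _ _ _ mu (fun l z => (H k i z - H l i z) ^+ 2)) => //.
  - by move=> l; apply: measurable_funX; exact: measurable_funB.
  - by apply: measurable_funX; exact: measurable_funB.
  - by move=> l z; exact: sqr_ge0.
  - by move=> z; exact: sqr_ge0.
  - apply: filterS (cG i) => z cz.
    have c : (H k i z - H l i z) @[l --> \oo] --> H k i z - G i z.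
      by apply: cvgB => //; exact: cvg_cst.
    rewrite (_ : (fun l => _) = fun l => (H k i z - H l i z) * (H k i z - H l i z)).
      by rewrite expr2; exact: cvgM.
    by apply/funext => l; rewrite expr2.
  by exists k => // l /= kl; exact: HH.
exists H, G; split=> //.
- move=> i; have [m0 i0] := sH 0%N i.
  have mB : measurable_fun setT (fun z => (H 0%N i z - G i z) ^+ 2).
    by apply: measurable_funX; exact: measurable_funB.
  have [iB _] := ge0_integrable mB (fun z => sqr_ge0 _) (HG i 0%N).
  have := integrable_sqr_lin 1 (-1) m0 (measurable_funB m0 (mG i)) i0 iB.
  apply: eq_integrable => // z _ /=; congr (_ ^+ 2)%:E; ring.
- move=> i k; apply: le_trans (HG i k) _; rewrite lee_fin expr2.
  apply: ler_piMl; first exact: ltW.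
  by rewrite exprn_ile1 ?invr_ge0// invf_le1// ler1n.
move=> i z H0; rewrite /G (_ : (fun k => _) = fun=> 0); last exact/funext.
by apply: limvalE; exact: cvg_cst.
Qed.

End mazur.

(** * Passage to the limit *)

Section step_functions.
Context (R : realType) (n : nat) (T : R) (A : nat).
Hypotheses (T0 : 0 < T) (A0 : (0 < A)%N).
Local Notation Rn := 'rV[R]_n.
Local Notation mu := (lebesgue_rV R n).
Local Notation GX p := 'rV['I_(gsize p).+1]_n.
Local Notation Z := (measurableTypeR R * Rn)%type.
Local Notation stst := (@stst R n T A _).

Lemma stst_slice p (a : nat -> GX p -> R) t (y : Rn) : intime T t ->
  stst a (t, y) = spst (a (tcell T A p t)) y.
Proof. by rewrite /stst /= => ->. Qed.

Lemma stst_out p (a : nat -> GX p -> R) (z : Z) : ~~ intime T z.1 -> stst a z = 0.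
Proof. by rewrite /stst => /negbTE ->. Qed.

Lemma stst_map p (h : R -> R) (a : nat -> GX p -> R) z : h 0 = 0 ->
  stst (fun k x => h (a k x)) z = h (stst a z).
Proof. by move=> h0; rewrite /stst /spst; case: (intime T z.1); case: (inbox p z.2). Qed.

Lemma stst_mul p (a b : nat -> GX p -> R) z :
  stst (fun k x => a k x * b k x) z = stst a z * stst b z.
Proof. by rewrite /stst /spst; case: (intime T z.1); case: (inbox p z.2); rewrite ?mulr0. Qed.

Lemma stst_slice_integrable p (a : nat -> GX p -> R) t :
  mu.-integrable setT (EFin \o (fun y => stst a (t, y))).
Proof.
have [zt|zt] := boolP (intime T t).
  have [h _] := spst_integral (a (tcell T A p t)).
  by apply: eq_integrable h => // y _ /=; rewrite stst_slice.
rewrite (_ : EFin \o _ = cst 0%E); first exact: integrable0.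
by apply/funext => y /=; rewrite stst_out.
Qed.

End step_functions.

Section limit.
Context (R : realType) (n : nat) (m alpha chi M0 T B s0 : R) (A : nat)
  (u0 : 'rV[R]_n -> R).
Hypothesis su : setup m alpha chi M0 T B s0 A u0.
Local Notation Rn := 'rV[R]_n.
Local Notation mu := (lebesgue_rV R n).
Local Notation GX p := 'rV['I_(gsize p).+1]_n.
Local Notation Z := (measurableTypeR R * Rn)%type.
Local Notation PP := (lebesgue_measure \x mu)%E.
Local Notation K := (nsteps A).
Local Notation tau := (tau T A).
Local Notation eps := (eps R).
Local Notation w p := (eps p ^+ n).
Local Notation stst := (@stst R n T A _).
Local Notation U p := (@U R n m alpha chi M0 T A u0 p).
Local Notation phi := (@phi R m).

Let T0 := su_T su.
Let A0 := su_A su.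
Let B0 := su_B su.

Lemma density_bounds p (z : Z) : 0 <= stst (U p) z <= B.
Proof.
rewrite /stst /spst; case: ifP => _; last by rewrite lexx (ltW B0).
by case: ifP => _; [exact: (U_B su)|rewrite lexx (ltW B0)].
Qed.

Lemma density_mass p t : \int[mu]_y stst (U p) (t, y) <= M0.
Proof.
have [zt|zt] := boolP (intime T t).
  rewrite (@eq_Rintegral _ _ _ mu _ (fun y => spst (U p (tcell T A p t)) y)).
    by have [_ ->] := spst_integral (U p (tcell T A p t)); exact: (U_mass su).
  by move=> y _; rewrite stst_slice.
rewrite (@eq_Rintegral _ _ _ mu _ (fun=> 0)); first by rewrite Rintegral_cst// mul0r (ltW (su_M0 su)).
by move=> y _; rewrite stst_out.
Qed.

(** Since [u] is a [limval] at every point, the bounds [0] and [B] hold everywhere and, by Fatou,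
    the mass bound holds for every [t] and not just almost every one, as a supremum over all times
    requires. *)
Lemma density_limit : exists (s : nat -> nat) (u : Z -> R),
  [/\ forall k, (k <= s k)%N,
      measurable_fun setT u /\ PP.-integrable setT (EFin \o u),
      forall z, 0 <= u z <= B /\ (~~ intime T z.1 -> u z = 0),
      forall t, mu.-integrable setT (EFin \o (fun y => u (t, y))) /\
        \int[mu]_y u (t, y) <= M0 &
      forall k, (\int[PP]_z (`|stst (U (s k)) z - u z|)%:E <= (2^-1 ^+ k)%:E)%E].
Proof.
have p1 k : 0 < 2^-1 ^+ k :> R by rewrite exprn_gt0.
have [s sP] := totally_bounded_cauchy
  (D := fun p p' => \int[PP]_z `|stst (U p) z - stst (U p') z|) p1 (ub_totally_bounded su).
pose f k := stst (U (s k)).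
have mf k : measurable_fun setT (f k) by exact: measurable_stst.
have fi k : PP.-integrable setT (EFin \o f k) by have [] := stst_integral T0 A0 (U (s k)).
have fd k l : PP.-integrable setT (EFin \o (fun z => `|f k z - f l z|)).
  have := integrable_abse (integrableB measurableT (fi k) (fi l)).
  by apply: eq_integrable => // z _; rewrite /= -EFinB.
have fkl k l : (k <= l)%N -> (\int[PP]_z (`|f k z - f l z|)%:E <= (2^-1 ^+ k)%:E)%E.
  by move=> kl; apply: integral_le_EFin => //; have [_] := sP k; exact.
have md k l : measurable_fun setT (fun z => `|f k z - f l z|).
  by apply: measurableT_comp => //; exact: measurable_funB.
pose u z := limval (fun k => f k z).
have ub z : (u z)%:E = limn_einf (EFin \o (fun k => f k z)) /\ 0 <= u z <= B.
  by apply: limval_bounds => k; exact: density_bounds.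
have mu' : measurable_fun setT u by apply: (measurable_limval (f := f)).
have cu : \forall z \ae PP, (fun k => f k z) @ \oo --> u z.
  apply: (@fast_limit _ _ _ PP f (fun k z => `|f k z - f k.+1 z|)) => //.
    by move=> k; exact: fkl.
  by move=> k z; rewrite distrC lerDr ltW.
have fu k : (\int[PP]_z (`|f k z - u z|)%:E <= (2^-1 ^+ k)%:E)%E.
  apply: (@fatou_le _ _ _ PP (fun l z => `|f k z - f l z|)) => //.
  - by apply: measurableT_comp => //; exact: measurable_funB.
  - by apply: filterS cu => z cz; apply: cvg_norm; apply: cvgB => //; exact: cvg_cst.
  by exists k => // l /= kl; exact: fkl.
have slice t : (\int[mu]_y (u (t, y))%:E <= M0%:E)%E.
  rewrite (eq_integral (fun y => limn_einf (fun k => (f k (t, y))%:E))); last first.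
    by move=> y _; have [-> _] := ub (t, y).
  have mft k : measurable_fun setT (fun y => f k (t, y)).
    exact: measurableT_comp (mf k) (measurable_pair1 _).
  apply: le_trans (fatou mu measurableT _ _) _.
  - by move=> k; exact/measurable_EFinP.
  - by move=> k y _; rewrite lee_fin; have /andP[] := density_bounds (s k) (t, y).
  rewrite limn_einf_lim; apply: lime_le; first exact: is_cvg_einfs.
  apply: nearW => k; apply: (@le_trans _ _ (\int[mu]_y (f k (t, y))%:E)%E).
    by apply: ereal_inf_lbound; exists k => //=.
  apply: integral_le_EFin; last exact: density_mass.
  exact: stst_slice_integrable.
exists s, u; split.
- by move=> k; have [] := sP k.
- split=> //.
  have mfu : measurable_fun setT (fun z => `|f 0%N z - u z|).
    by apply: measurableT_comp => //; exact: measurable_funB.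
  have [i1 _] := ge0_integrable mfu (fun z => normr_ge0 _) (fu 0%N).
  have := integrableD measurableT (fi 0%N) i1.
  apply: le_integrable => //; first exact/measurable_EFinP.
  move=> z _; have [_ /andP[u1 u2]] := ub z.
  have /andP[f1 _] := density_bounds (s 0%N) z.
  rewrite /= lee_fin ger0_norm// [leRHS]ger0_norm ?addr_ge0//.
  have := ler_norm (u z - f 0%N z); rewrite distrC -/(f 0%N z); lra.
- move=> z; have [_ h] := ub z; split=> // zt.
  rewrite /u (_ : (fun k => f k z) = fun=> 0); first by apply: limvalE; exact: cvg_cst.
  by apply/funext => k; rewrite /f stst_out.
- move=> t; apply: ge0_integrable => //.
  + exact: measurableT_comp mu' (measurable_pair1 _).
  + by move=> y; have [_ /andP[]] := ub (t, y).
exact: fu.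
Qed.

Definition grad p (i : 'I_n) (k : nat) (x : GX p) : R :=
  dif (@unitv (gsize p) n) i (phi \o U p k) x / eps p.

Lemma phi0 : phi 0 = 0.
Proof. by rewrite /phi powR0// gt_eqF// (lt_trans ltr01 (su_m su)). Qed.

(** The weight [tau p * w p / eps p ^+ 2] is [kap * w p], so the left-hand side is the very sum that
    [energy_le] bounds. *)
Lemma grad_energy p : \sum_i \int[PP]_z (stst (@grad p i) z ^+ 2) <= CE m alpha chi M0 T B.
Proof.
have e0 := eps_gt0 R p.
apply: le_trans (energy_le su (_ : (K p <= 2 * K p)%N)); last by rewrite leq_pmull.
have E i : \int[PP]_z (stst (@grad p i) z ^+ 2) =
   \sum_(k < K p) kap T A * (w p * \sum_x dif (@unitv (gsize p) n) i (phi \o U p k) x ^+ 2).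
  have [_] := stst_integral T0 A0 (fun k x => @grad p i k x * @grad p i k x).
  rewrite (@eq_Rintegral _ _ _ PP _ (fun z => stst (@grad p i) z ^+ 2)); last first.
    by move=> z _; rewrite stst_mul expr2.
  move=> ->; rewrite tau_kap !mulr_sumr; apply: eq_bigr => k _.
  rewrite !mulr_sumr; apply: eq_bigr => x _; rewrite /grad.
  by move: (dif _ _ _ _) => q; field; rewrite gt_eqF.
under eq_bigr do rewrite E.
rewrite exchange_big/= le_eqVlt; apply/orP; left; apply/eqP; apply: eq_bigr => k _.
by rewrite -!mulr_sumr /dform.
Qed.

End limit.

(** * Lipschitz functions of a sequence convergent in L1 *)

Section lipschitz_limits.
Context d (T : measurableType d) (R : realType) (mu : {measure set T -> \bar R}).
Variables (h : R -> R) (B L : R).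
Hypotheses (h0 : h 0 = 0) (mh : measurable_fun setT h) (B0 : 0 <= B) (L0 : 0 <= L)
  (hl : forall a b, 0 <= a <= B -> 0 <= b <= B -> `|h a - h b| <= L * `|a - b|).

Lemma lip_integrable (a : T -> R) : (forall z, 0 <= a z <= B) ->
  mu.-integrable setT (EFin \o a) -> mu.-integrable setT (EFin \o (fun z => h (a z))).
Proof.
move=> ab ia; have /integrableP[/measurable_EFinP ma _] := ia.
apply: le_integrable (integrableZl measurableT L ia) => //.
  by apply/measurable_EFinP; exact: measurableT_comp mh ma.
move=> z _; have := hl (ab z) (_ : 0 <= 0 <= B); rewrite lexx h0 !subr0 B0 => /(_ isT) H.
by rewrite /= lee_fin [leRHS]normrM (ger0_norm L0).
Qed.

Lemma lip_L1_cvg (f : nat -> T -> R) (a : T -> R) :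
  (forall k z, 0 <= f k z <= B) -> (forall z, 0 <= a z <= B) ->
  (forall k, mu.-integrable setT (EFin \o f k)) -> mu.-integrable setT (EFin \o a) ->
  (\int[mu]_z `|f k z - a z|) @[k --> \oo] --> 0 ->
  (\int[mu]_z `|h (f k z) - h (a z)|) @[k --> \oo] --> 0.
Proof.
move=> fb ab fi ai fa.
have id (g g' : T -> R) : mu.-integrable setT (EFin \o g) -> mu.-integrable setT (EFin \o g') ->
    mu.-integrable setT (EFin \o (fun z => `|g z - g' z|)).
  by move=> ig ig'; have := integrable_abse (integrableB measurableT ig ig').
apply: (@squeeze_cvgr _ _ _ _ (fun=> 0) (fun k => L * \int[mu]_z `|f k z - a z|)).
- apply: nearW => k; rewrite Rintegral_ge0//= -RintegralZl//; last exact: id.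
  apply: le_Rintegral => //.
  + by apply: id; exact: lip_integrable.
  + exact: (integrableZl measurableT L (id _ _ (fi k) ai)).
  by move=> z _; exact: hl.
- exact: cvg_cst.
by rewrite -(mulr0 L); exact: cvgMr.
Qed.

End lipschitz_limits.

(** * The weak gradient on almost every time slice *)

Section slices.
Context (R : realType) (n : nat) (m alpha chi M0 T B s0 : R) (A : nat)
  (u0 : 'rV[R]_n -> R).
Hypothesis su : setup m alpha chi M0 T B s0 A u0.
Local Notation Rn := 'rV[R]_n.
Local Notation mu := (lebesgue_rV R n).
Local Notation GX p := 'rV['I_(gsize p).+1]_n.
Local Notation Z := (measurableTypeR R * Rn)%type.
Local Notation PP := (lebesgue_measure \x mu)%E.
Local Notation K := (nsteps A).
Local Notation tau := (tau T A).
Local Notation eps := (eps R).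
Local Notation w p := (eps p ^+ n).
Local Notation stst := (@stst R n T A _).
Local Notation U p := (@U R n m alpha chi M0 T A u0 p).
Local Notation phi := (@phi R m).
Local Notation psi := (@psi R alpha).
Local Notation gradU p := (@grad R n m alpha chi M0 T A u0 p).

Let T0 := su_T su.
Let A0 := su_A su.
Let B0 := su_B su.

Lemma pow_lip (q : R) : 1 <= q -> forall a b, 0 <= a <= B -> 0 <= b <= B ->
  `|a `^ q - b `^ q| <= (Num.truncn q).+1%:R * B `^ (q - 1) * `|a - b|.
Proof.
move=> q1; have key a b : 0 <= a <= B -> 0 <= b <= B -> a <= b ->
    `|a `^ q - b `^ q| <= (Num.truncn q).+1%:R * B `^ (q - 1) * `|a - b|.
  move=> /andP[a0 aB] /andP[b0 bB] ab.
  rewrite distrC [`|a - b|]distrC !ger0_norm ?subr_ge0//; first exact: powR_lip.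
  by apply: ge0_ler_powR; rewrite ?nnegrE// (le_trans ler01).
move=> a b ha hb; have [/key|/ltW/key] := leP a b; first exact.
by rewrite distrC [`|a - b|]distrC; apply.
Qed.

Variables (s : nat -> nat) (u : Z -> R).
Hypotheses (sk : forall k, (k <= s k)%N)
  (mu' : measurable_fun setT u) (ui : PP.-integrable setT (EFin \o u))
  (ub : forall z, 0 <= u z <= B) (uout : forall z, ~~ intime T z.1 -> u z = 0)
  (us : forall t, mu.-integrable setT (EFin \o (fun y => u (t, y))))
  (fu : forall k, (\int[PP]_z (`|stst (U (s k)) z - u z|)%:E <= (2^-1 ^+ k)%:E)%E).

Definition grads (j : nat) (i : 'I_n) (z : Z) : R := stst (gradU (s j) i) z.

(** The energy bounds the discrete gradients in space-time, which gives no bound along the sequence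
    on a single slice. What survives for almost every [t] is that their products with the mesh, the
    increments over one cell, tend to 0. *)
Definition good_slice (t : R) := [/\ intime T t,
  (\int[mu]_y `|stst (U (s k)) (t, y) - u (t, y)|) @[k --> \oo] --> 0 &
  forall i, (\int[mu]_y ((eps (s k) * grads k i (t, y)) ^+ 2)) @[k --> \oo] --> 0].

Lemma stst_sqr_integrable p (a : nat -> GX p -> R) :
  PP.-integrable setT (EFin \o (fun z => stst a z ^+ 2)).
Proof.
have [h _] := stst_integral T0 A0 (fun k x => a k x * a k x).
by apply: eq_integrable h => // z _; rewrite /= stst_mul expr2.
Qed.

Lemma eps_subseq k : eps (s k) <= 2^-1 ^+ k.
Proof.
by rewrite /eps; apply: ler_wiXn2l => //; rewrite ?invr_ge0// invf_le1// ler1n.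
Qed.

Lemma ae_good_slice : \forall t \ae lebesgue_measure, intime T t -> good_slice t.
Proof.
have CE0 : 0 <= CE m alpha chi M0 T B.
  by apply: le_trans (grad_energy su 0); apply: sumr_ge0 => i _; apply: Rintegral_ge0 => z _; exact: sqr_ge0.
have m1 k : measurable_fun setT (fun z => `|stst (U (s k)) z - u z|).
  by apply: measurableT_comp => //; apply: measurable_funB => //; exact: measurable_stst.
have fu1 k : (\int[PP]_z (`|stst (U (s k)) z - u z|)%:E <= (1 * 2^-1 ^+ k)%:E)%E by rewrite mul1r.
have [_ a1] := slice_ae_cvg0 ltr01 m1 (fun k z => normr_ge0 _) fu1.
have a2 i : \forall t \ae lebesgue_measure,
    (\int[mu]_y ((eps (s k) * grads k i (t, y)) ^+ 2)) @[k --> \oo] --> 0.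
  have m2 k : measurable_fun setT (fun z => (eps (s k) * grads k i z) ^+ 2).
    by apply: measurable_funX; apply: measurable_funM => //; exact: measurable_stst.
  have C1 : 0 < CE m alpha chi M0 T B + 1 by rewrite ltr_wpDl.
  have f2 k : (\int[PP]_z ((eps (s k) * grads k i z) ^+ 2)%:E <=
      ((CE m alpha chi M0 T B + 1) * 2^-1 ^+ k)%:E)%E.
    have e0 := eps_gt0 R (s k).
    under eq_integral do rewrite exprMn.
    have i2 := stst_sqr_integrable (gradU (s k) i).
    apply: integral_le_EFin; first exact: (integrableZl measurableT (eps (s k) ^+ 2) i2).
    rewrite RintegralZl//.
    have h1 : \int[PP]_z (grads k i z ^+ 2) <= CE m alpha chi M0 T B.
      apply: le_trans (grad_energy su (s k)); rewrite (bigD1 i)//= lerDl.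
      by apply: sumr_ge0 => j _; apply: Rintegral_ge0 => z _; exact: sqr_ge0.
    rewrite mulrC; apply: ler_pM; rewrite ?sqr_ge0//.
    - by apply: Rintegral_ge0 => z _; exact: sqr_ge0.
    - by apply: le_trans h1 _; rewrite lerDl.
    apply: le_trans (eps_subseq k); rewrite expr2 ler_piMl ?(ltW e0)//.
    exact: eps_le1.
  by have [_] := slice_ae_cvg0 C1 m2 (fun k z => sqr_ge0 _) f2.
have : \forall t \ae lebesgue_measure, forall i : 'I_n,
    (\int[mu]_y ((eps (s k) * grads k i (t, y)) ^+ 2)) @[k --> \oo] --> 0.
  by apply: filter_forall.
by move: a1; apply: filterS2 => t h1 h2 zt; split.
Qed.

Lemma slice_pow_cvg t : good_slice t ->
  (\int[mu]_y `|phi (stst (U (s k)) (t, y)) - phi (u (t, y))|) @[k --> \oo] --> 0.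
Proof.
case=> zt ft _.
apply: (@lip_L1_cvg _ _ _ mu phi B (Lp m B) _ _ _ _ _
  (fun k y => stst (U (s k)) (t, y)) (fun y => u (t, y))) => //.
- exact: (phi0 su).
- exact: measurable_powR.
- exact: ltW.
- exact/ltW/(Lp_gt0 su).
- by apply: pow_lip; exact/ltW/(su_m su).
- by move=> k y; exact: (density_bounds su).
- by move=> k; exact: stst_slice_integrable.
Qed.

Lemma slice_pow_integrable t : mu.-integrable setT (EFin \o (fun y => phi (u (t, y)))).
Proof.
apply: (@lip_integrable _ _ _ mu phi B (Lp m B)) => //.
- exact: (phi0 su).
- exact: measurable_powR.
- exact: ltW.
- exact/ltW/(Lp_gt0 su).
- by apply: pow_lip; exact/ltW/(su_m su).
Qed.

Lemma slice_pairing p (a b : nat -> GX p -> R) t : intime T t ->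
  \int[mu]_y (stst a (t, y) * stst b (t, y)) =
  w p * \sum_x a (tcell T A p t) x * b (tcell T A p t) x.
Proof.
move=> zt; have [_ <-] := spst_integral (fun x : GX p => a (tcell T A p t) x * b (tcell T A p t) x).
apply: eq_Rintegral => y _; rewrite -stst_mul stst_slice//.
Qed.

Lemma inbox_mono p q (y : Rn) : (p <= q)%N -> inbox p y -> inbox q y.
Proof.
move=> pq /forallP h; apply/forallP => i; have /andP[h1 h2] := h i.
have le2 : 2 ^+ p <= 2 ^+ q :> R by apply: ler_weXn2l => //; rewrite ler1n.
by apply/andP; split; [apply: le_trans h1; rewrite lerN2|exact: lt_le_trans h2 le2].
Qed.

Lemma slice_sqr_integrable p (a : nat -> GX p -> R) t :
  mu.-integrable setT (EFin \o (fun y => stst a (t, y) ^+ 2)).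
Proof.
have h := stst_slice_integrable T A (fun k x => a k x * a k x) t.
by apply: eq_integrable h => // y _; rewrite /= stst_mul expr2.
Qed.

Lemma measurable_slice (f : Z -> R) t : measurable_fun setT f ->
  measurable_fun setT (fun y : Rn => f (t, y)).
Proof. by move=> mf; exact: measurableT_comp mf (measurable_pair1 _). Qed.

Lemma density_pow p z : phi (stst (U p) z) = stst (fun l x => phi (U p l x)) z.
Proof. by apply/esym/(@stst_map R n T A p phi); exact: (phi0 su). Qed.

Lemma stst_cst_le p (M : R) z : stst (fun k (x : GX p) => M) z <= `|M|.
Proof. by rewrite /stst /spst; case: (intime T z.1); case: (inbox p z.2); rewrite ?ler_norm. Qed.

(** Summation by parts on the slice puts the difference quotient on the samples of [ps]. Replacing
    the samples by [ps] costs an error of order [eps (s k)], supported in a fixed box and paired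
    with the gradient; the mesh factor is moved to the gradient, where [good_slice] applies. *)
Lemma slice_gradient t (ps : Rn -> R) i : good_slice t -> smooth_test ps ->
  [/\ measurable_fun setT ps, exists M, forall y, `|ps y| <= M,
    mu.-integrable setT (EFin \o (fun y => ps y ^+ 2)) &
    (\int[mu]_y (grads k i (t, y) * ps y)) @[k --> \oo] -->
    - \int[mu]_y (phi (u (t, y)) * partial i ps y)].
Proof.
move=> gt sm; have [zt ft gr] := gt.
have [r lt] := smooth_lattice T sm.
have [M1 [N1 [d1 c1]]] := sampled_space T0 A0 lt i.
have [M2 [N2 [d2 c2]]] := sampled_value T0 A0 lt.
have [C [C0 err]] := sampling_error lt.
have [] := stst_limit T0 A0 d1 c1; set D1 := (fun z : Z => _) => m1 l1 b1.
have [] := stst_limit T0 A0 d2 c2; set D2 := (fun z : Z => _) => m2 l2 b2.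
pose a1 p := stst (fun k (x : GX p) => (ps (gpos R (x + unitv _ i)) - ps (gpos R x)) / eps p).
pose a2 p := stst (fun k (x : GX p) => ps (gpos R x)).
have {c1 d1}d1 : forall p (z : Z), (N1 <= p)%N -> `|a1 p z| <= stst (fun k (x : GX N1) => M1) z.
  exact: d1.
have {c2 d2}d2 : forall p (z : Z), (N2 <= p)%N -> `|a2 p z| <= stst (fun k (x : GX N2) => M2) z.
  exact: d2.
have {}l1 : forall z, (fun p => a1 p z) @ \oo --> D1 z by exact: l1.
have {}l2 : forall z, (fun p => a2 p z) @ \oo --> D2 z by exact: l2.
have psE y : ps y = D2 (t, y) by rewrite /D2 /= zt.
have paE y : partial i ps y = D1 (t, y).
  rewrite /D1 /= zt /partial.
  exact: (@derive_space R Rn (fun=> ps) t y (delta_mx 0 i)).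
have mps : measurable_fun setT ps by rewrite (funext psE); exact: measurable_slice.
have bps y : `|ps y| <= `|M2| by rewrite psE; apply: le_trans (b2 _) _; exact: stst_cst_le.
have ips : mu.-integrable setT (EFin \o (fun y => ps y ^+ 2)).
  apply: le_integrable (slice_sqr_integrable (fun k (x : GX N2) => M2) t) => //.
    by apply/measurable_EFinP; exact: measurable_funX.
  move=> y _; rewrite /= lee_fin !normrX; apply: lerXn2r; rewrite ?nnegrE//.
  by rewrite psE; apply: le_trans (b2 _) (ler_norm _).
split=> //; first by exists `|M2|.
(* The discrete product rule produces the test function at the shifted point, which is its sample
   plus the mesh times the difference quotient. *)
pose E p := stst (fun k (x : GX p) => ps (gpos R (x + unitv _ i))).
have EE p z : E p z = a2 p z + eps p * a1 p z.
  rewrite /E /a2 /a1 /stst /spst; case: ifP => _; last by rewrite mulr0 addr0.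
  case: ifP => _; last by rewrite mulr0 addr0.
  by rewrite mulrC divfK ?subrKC ?gt_eqF ?eps_gt0// addrC subrK.
have sg k : mu.-integrable setT (EFin \o (fun y => grads k i (t, y))).
  exact: stst_slice_integrable.
have mE k : measurable_fun setT (fun y => E k (t, y)).
  by apply: measurable_slice; exact: measurable_stst.
pose N := maxn N1 N2.
(* The indicator of the box of index [N], beyond which the test function and its samples vanish; it
   makes the error square-integrable. *)
pose ch (y : Rn) := stst (fun k (x : GX N) => 1) (t, y).
pose c := C + `|M1|.
have bound k y : (N <= k)%N ->
    `|grads k i (t, y) * (ps y - E (s k) (t, y))| <= c * ch y * `|eps (s k) * grads k i (t, y)|.
  move=> Nk; have e0 := eps_gt0 R (s k).
  have Ns1 : (N1 <= s k)%N by apply: leq_trans (sk k); apply: leq_trans Nk; exact: leq_maxl.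
  have Ns2 : (N2 <= s k)%N by apply: leq_trans (sk k); apply: leq_trans Nk; exact: leq_maxr.
  have [yb|yb] := boolP (inbox (s k) y); last first.
    by rewrite /grads stst_slice// /spst (negbTE yb) mul0r mulr0 normr0 mulr0.
  rewrite normrM [`|eps _ * _|]normrM (gtr0_norm e0) [leLHS]mulrC mulrA ler_wpM2r//.
  have [yN|yN] := boolP (inbox N y); last first.
    have z1 : a1 (s k) (t, y) = 0.
      apply/eqP; rewrite -normr_le0; apply: le_trans (d1 _ (t, y) Ns1) _.
      rewrite stst_slice// /spst ifN//; apply: contra yN; apply: inbox_mono; exact: leq_maxl.
    have y2 : ~~ inbox N2 y by apply: contra yN; apply: inbox_mono; exact: leq_maxr.
    have z2 : a2 (s k) (t, y) = 0.
      apply/eqP; rewrite -normr_le0; apply: le_trans (d2 _ (t, y) Ns2) _.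
      by rewrite stst_slice// /spst ifN.
    have z3 : ps y = 0.
      apply/eqP; rewrite -normr_le0 psE; apply: le_trans (b2 (t, y)) _.
      by rewrite stst_slice// /spst ifN.
    by rewrite EE z1 z2 z3 mulr0 addr0 subrr normr0 /ch stst_slice// /spst (negbTE yN) mulr0 mul0r.
  rewrite /ch stst_slice// /spst yN mulr1 EE opprD addrA /c mulrDl.
  apply: le_trans (ler_normB _ _) _; apply: lerD.
    rewrite /a2 stst_slice// /spst yb; apply: (err (s k) t y) => //.
    by have /andP[h1 h2] := zt; rewrite !ltW.
  rewrite normrM (gtr0_norm e0) mulrC ler_wpM2r ?(ltW e0)//.
  apply: le_trans (d1 _ (t, y) Ns1) _; exact: stst_cst_le.
have ich : mu.-integrable setT (EFin \o (fun y => (c * ch y) ^+ 2)).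
  have := integrableZl measurableT (c ^+ 2) (slice_sqr_integrable (fun k (x : GX N) => 1) t).
  by apply: eq_integrable => // y _; rewrite /= exprMn EFinM.
have mch : measurable_fun setT (fun y => c * ch y).
  by apply: measurable_funM => //; apply: measurable_slice; exact: measurable_stst.
have meg k : measurable_fun setT (fun y => `|eps (s k) * grads k i (t, y)|).
  apply: measurableT_comp => //; apply: measurable_funM => //.
  by apply: measurable_slice; exact: measurable_stst.
have ieg k : mu.-integrable setT (EFin \o (fun y => `|eps (s k) * grads k i (t, y)| ^+ 2)).
  have := integrableZl measurableT (eps (s k) ^+ 2) (slice_sqr_integrable (gradU (s k) i) t).
  apply: eq_integrable => // y _.
  by rewrite /= real_normK ?num_real// exprMn EFinM.
have pair0 : (\int[mu]_y (c * ch y * `|eps (s k) * grads k i (t, y)|)) @[k --> \oo] --> 0.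
  apply: (@sqr_pairing_cvg0 _ _ _ mu (fun=> fun y => c * ch y)
    (fun k y => `|eps (s k) * grads k i (t, y)|) (\int[mu]_y ((c * ch y) ^+ 2))) => //.
  rewrite (_ : (fun k => _) = (fun k => \int[mu]_y ((eps (s k) * grads k i (t, y)) ^+ 2)))//.
  apply/funext => k; apply: eq_Rintegral => y _; by rewrite real_normK ?num_real.
have igp k : mu.-integrable setT (EFin \o (fun y => grads k i (t, y) * ps y)).
  exact: integrable_mul_bounded (sg k) mps bps.
have igE k : mu.-integrable setT (EFin \o (fun y => grads k i (t, y) * E (s k) (t, y))).
  have h := stst_slice_integrable T A (fun l x => gradU (s k) i l x * ps (gpos R (x + unitv _ i))) t.
  by apply: eq_integrable h => // y _; rewrite /= stst_mul.
have split_int k : \int[mu]_y (grads k i (t, y) * ps y) =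
    \int[mu]_y (grads k i (t, y) * (ps y - E (s k) (t, y))) -
    \int[mu]_y (phi (stst (U (s k)) (t, y)) * a1 (s k) (t, y)).
  have -> : \int[mu]_y (grads k i (t, y) * (ps y - E (s k) (t, y))) =
    \int[mu]_y (grads k i (t, y) * ps y) - \int[mu]_y (grads k i (t, y) * E (s k) (t, y)).
    rewrite -RintegralB//; first by apply: eq_Rintegral => y _; rewrite mulrBr.
  (* What remains is the sum over the torus of the increments of one product, which is zero. *)
  rewrite -addrA -opprD [X in _ - X](_ : _ = 0) ?subr0//.
  have -> := slice_pairing (gradU (s k) i) (fun l x => ps (gpos R (x + unitv _ i))) zt.
  under eq_Rintegral do rewrite density_pow.
  have -> := slice_pairing (fun l x => phi (U (s k) l x))
    (fun l x => (ps (gpos R (x + unitv _ i)) - ps (gpos R x)) / eps (s k)) zt.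
  rewrite -mulrDr (_ : _ + _ = 0) ?mulr0//.
  rewrite -big_split/=; set k' := tcell _ _ _ _.
  pose V := phi \o U (s k) k'; pose q (x : GX (s k)) := ps (gpos R x).
  rewrite (eq_bigr (fun x => (eps (s k))^-1 * (V (x + unitv _ i) * q (x + unitv _ i) - V x * q x))).
    by rewrite -mulr_sumr sumrB (sum_shift (unitv _ i) (fun x => V x * q x)) subrr mulr0.
  move=> x _; rewrite /grad /dif -/(V _) -/(V _) /q.
  rewrite -[phi (U (s k) k' x)]/(V x).
  by move: (V x) (V _) (ps _) (ps _) (eps _) => *; ring.
rewrite (funext split_int) -[X in _ --> X]add0r; apply: cvgB.
  have h : (\int[mu]_y (c * ch y * `|eps (s (k + N)%N) * grads (k + N)%N i (t, y)|)) @[k --> \oo] --> 0.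
    by rewrite (cvg_shiftn N (fun k => \int[mu]_y (c * ch y * `|eps (s k) * grads k i (t, y)|))).
  rewrite -(cvg_shiftn N); apply/norm_cvg0P.
  apply: (@squeeze_cvgr _ _ _ _ (fun=> 0) (fun k =>
    \int[mu]_y (c * ch y * `|eps (s (k + N)%N) * grads (k + N)%N i (t, y)|))) => //; last exact: cvg_cst.
  apply: nearW => k; rewrite normr_ge0/=.
  have iB : mu.-integrable setT (EFin \o (fun y =>
      grads (k + N)%N i (t, y) * (ps y - E (s (k + N)%N) (t, y)))).
    have := integrableB measurableT (igp (k + N)%N) (igE (k + N)%N).
    by apply: eq_integrable => // y _; rewrite /= mulrBr EFinB.
  apply: le_trans (le_normr_Rintegral measurableT iB) _.
  apply: le_Rintegral => //; first exact: integrable_abse iB.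
    exact: (integrable_sqr_mul mch (meg _) ich (ieg _)).
  by move=> y _; apply: bound; rewrite leq_addl.
under eq_Rintegral do rewrite paE.
have bM k y : (N1 <= k)%N -> `|a1 (s k) (t, y)| <= `|M1|.
  move=> Nk; apply: le_trans (d1 _ (t, y) (leq_trans Nk (sk k))) _.
  by exact: stst_cst_le.
have s_oo : s @ \oo --> \oo.
  by move=> S [q _ qS]; exists q => // k /= qk; apply: qS; exact: leq_trans qk (sk k).
apply: (@L1_pairing_cvg _ _ _ mu (fun k y => phi (stst (U (s k)) (t, y)))
  (fun y => phi (u (t, y))) (fun k y => a1 (s k) (t, y)) (fun y => D1 (t, y)) `|M1| N1) => //.
- move=> k; have h := stst_slice_integrable T A (fun l x => phi (U (s k) l x)) t.
  by apply: eq_integrable h => // y _; rewrite /= density_pow.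
- exact: slice_pow_integrable.
- exact: slice_pow_cvg.
- by move=> k; apply: measurable_slice; exact: measurable_stst.
- exact: measurable_slice.
by apply: aeW => y; exact: cvg_comp s_oo (l1 (t, y)).
Qed.

End slices.

Lemma ae_fst d1 d2 (T1 : measurableType d1) (T2 : measurableType d2) (R : realType)
    (m1 : {sigma_finite_measure set T1 -> \bar R})
    (m2 : {sigma_finite_measure set T2 -> \bar R}) (P : T1 -> Prop) :
  (\forall t \ae m1, P t) -> \forall z \ae (m1 \x m2)%E, P z.1.
Proof.
move=> [N [mN N0 PN]]; exists (N `*` setT); split.
- exact: measurableX.
- by rewrite product_measure1E// [X in (X * _)%E]N0 mul0e.
by move=> [t y] /= Pt; split=> //=; apply: PN.
Qed.

Lemma cvg_finsum (R : realType) (I : finType) (a : nat -> I -> R) (l : I -> R) :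
  (forall i, a k i @[k --> \oo] --> l i) -> (\sum_i a k i) @[k --> \oo] --> \sum_i l i.
Proof.
move=> al; elim: (index_enum I) => [|i r IH].
  rewrite big_nil (_ : (fun k => _) = fun=> 0); first exact: cvg_cst.
  by apply/funext => k; rewrite big_nil.
rewrite big_cons (_ : (fun k => _) = (fun k => a k i + \sum_(j <- r) a k j)).
  exact: cvgD.
by apply/funext => k; rewrite big_cons.
Qed.

(** * The weak formulation along the approximations *)

Section weak_limit.
Context (R : realType) (n : nat) (m alpha chi M0 T B s0 : R) (A : nat)
  (u0 : 'rV[R]_n -> R).
Hypothesis su : setup m alpha chi M0 T B s0 A u0.
Local Notation Rn := 'rV[R]_n.
Local Notation mu := (lebesgue_rV R n).
Local Notation GX p := 'rV['I_(gsize p).+1]_n.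
Local Notation Z := (measurableTypeR R * Rn)%type.
Local Notation PP := (lebesgue_measure \x mu)%E.
Local Notation K := (nsteps A).
Local Notation tau := (tau T A).
Local Notation eps := (eps R).
Local Notation w p := (eps p ^+ n).
Local Notation stst := (@stst R n T A _).
Local Notation U p := (@U R n m alpha chi M0 T A u0 p).
Local Notation phi := (@phi R m).
Local Notation psi := (@psi R alpha).
Local Notation gradU p := (@grad R n m alpha chi M0 T A u0 p).

Let n0 := su_n su.
Let T0 := su_T su.
Let A0 := su_A su.
Let B0 := su_B su.

Variables (s : nat -> nat) (u : Z -> R).
Hypotheses (sk : forall k, (k <= s k)%N)
  (mu' : measurable_fun setT u) (ui : PP.-integrable setT (EFin \o u))
  (ub : forall z, 0 <= u z <= B) (uout : forall z, ~~ intime T z.1 -> u z = 0)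
  (us : forall t, mu.-integrable setT (EFin \o (fun y => u (t, y))))
  (fu : forall k, (\int[PP]_z (`|stst (U (s k)) z - u z|)%:E <= (2^-1 ^+ k)%:E)%E).
Local Notation grads := (@grads R n m alpha chi M0 T A u0 s).

Let f k := stst (U (s k)).

Let fi k : PP.-integrable setT (EFin \o f k).
Proof. by have [] := stst_integral T0 A0 (U (s k)). Qed.

Let s_oo : s @ \oo --> \oo.
Proof. by move=> S [q _ qS]; exists q => // k /= qk; apply: qS; exact: leq_trans qk (sk k). Qed.

Lemma density_L1 : (\int[PP]_z `|f k z - u z|) @[k --> \oo] --> 0.
Proof.
have m1 k : measurable_fun setT (fun z => `|f k z - u z|).
  by apply: measurableT_comp => //; apply: measurable_funB => //; exact: measurable_stst.
apply: (@squeeze_cvgr _ _ _ _ (fun=> 0) (fun k => 2^-1 ^+ k)).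
- apply: nearW => k; rewrite Rintegral_ge0//=.
  by have [] := ge0_integrable (m1 k) (fun z => normr_ge0 _) (fu k).
- exact: cvg_cst.
by apply: cvg_expr; rewrite ger0_norm ?invr_ge0// invf_lt1// ltr1n.
Qed.

Lemma stst_pairing p (a b : nat -> GX p -> R) :
  \int[PP]_z (stst a z * stst b z) =
  tau p * (w p * \sum_(k < K p) \sum_x a k x * b k x).
Proof.
have [_ <-] := stst_integral T0 A0 (fun k x => a k x * b k x).
by apply: eq_Rintegral => z _; rewrite stst_mul.
Qed.

Definition mass t := \int[mu]_y u (t, y).

Lemma measurable_mass : measurable_fun setT mass.
Proof.
apply: (measurableT_comp (fine_measurable _)) => //.
apply: (measurable_fun_fubini_tonelli_F (EFin \o u)) => [|z]; first exact/measurable_EFinP.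
by rewrite /= lee_fin; have /andP[] := ub z.
Qed.

Lemma mass_cvg t : good_slice m alpha chi M0 T A u0 s u t ->
  (w (s k) * \sum_x U (s k) (tcell T A (s k) t) x) @[k --> \oo] --> mass t.
Proof.
case=> zt ft _.
have E k : w (s k) * \sum_x U (s k) (tcell T A (s k) t) x = \int[mu]_y f k (t, y).
  have [_ <-] := spst_integral (U (s k) (tcell T A (s k) t)).
  by apply: eq_Rintegral => y _; rewrite /f stst_slice.
rewrite (funext E); apply/cvgrPdist_le => e e0.
have /cvgrPdist_le/(_ _ e0) := ft; apply: filterS => k.
rewrite sub0r normrN ger0_norm; last exact: Rintegral_ge0.
apply: le_trans.
have i1 : mu.-integrable setT (EFin \o (fun y => f k (t, y))) by exact: stst_slice_integrable.
rewrite distrC /mass -RintegralB//.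
apply: le_normr_Rintegral => //.
by have := integrableB measurableT i1 (us t).
Qed.

Variable te : R -> Rn -> R.
Hypothesis te1 : C1_test T%:E te.

(** Cut off outside the open time interval, as the step functions are, so that space-time integrals
    run over the whole product. *)
Definition test_space i (z : Z) : R := if intime T z.1 then partial i (te z.1) z.2 else 0.
Definition test_time (z : Z) : R := if intime T z.1 then derive1 (te ^~ z.2) z.1 else 0.
Definition test_value (z : Z) : R := if intime T z.1 then te z.1 z.2 else 0.

Definition weak_rhs := \int[PP]_z (psi (u z) * (chi * (M0 - mass z.1) * test_value z))
  + \int[PP]_z (u z * test_time z) + \int[mu]_y (u0 y * te 0 y).

(** The discrete weak formulation is exact for sampled test functions. Density terms converge by
    strong L1 convergence against bounded factors. The gradients are bounded in L2, so the sampled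
    test gradient may be exchanged for the true one, to which it converges strongly; only the
    pairing gets a limit here, not the gradients. *)
Lemma gradient_pairing_limit :
  [/\ forall i, measurable_fun setT (test_space i),
    forall i, PP.-integrable setT (EFin \o (fun z => test_space i z ^+ 2)),
    forall i, exists M, forall z, `|test_space i z| <= M,
    [/\ measurable_fun setT test_value, measurable_fun setT test_time &
    exists M, forall z, `|test_value z| <= M /\ `|test_time z| <= M] &
    (\sum_i \int[PP]_z (grads k i z * test_space i z)) @[k --> \oo] --> weak_rhs].
Proof.
have [[r lt] teT] := C1_lattice T0 te1.
pose ds i p := stst (fun k (x : GX p) => (te (k.+1%:R * tau p) (gpos R (x + unitv _ i))
          - te (k.+1%:R * tau p) (gpos R x)) / eps p).
have dsP i : exists (M : R) (N : nat), [/\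
   forall p (z : Z), (N <= p)%N -> `|ds i p z| <= stst (fun k (x : GX N) => M) z,
   measurable_fun setT (test_space i),
   forall z, (fun p => ds i p z) @ \oo --> test_space i z &
   forall z, `|test_space i z| <= stst (fun k (x : GX N) => M) z].
  have [M [N [d c]]] := sampled_space T0 A0 lt i; exists M, N.
  have DE z : test_space i z = if intime T z.1
      then 'D_((0, delta_mx 0 i) : R * Rn) (fun z : R * Rn => te z.1 z.2) z else 0.
    rewrite /test_space; case: ifP => // _.
    by rewrite /partial derive_space; case: z.
  have [m1 l1 b1] := stst_limit T0 A0 d c; split.
  - exact: d.
  - by rewrite (funext DE); exact: m1.
  - by move=> z; rewrite DE; exact: l1.
  by move=> z; rewrite DE; exact: b1.
pose dt p := stst (fun k (x : GX p) => (te (k.+1%:R * tau p) (gpos R x)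
          - te (k%:R * tau p) (gpos R x)) / tau p).
have [Mt [Nt [d c]]] := sampled_time T0 A0 lt.
have DtE z : test_time z = if intime T z.1
    then 'D_((1, 0) : R * Rn) (fun z : R * Rn => te z.1 z.2) z else 0.
  rewrite /test_time; case: ifP => // _.
  by rewrite derive_time; case: z.
have [mt' lt0 bt'] := stst_limit T0 A0 d c.
have mt : measurable_fun setT test_time by rewrite (funext DtE); exact: mt'.
have lt' z : (fun p => dt p z) @ \oo --> test_time z by rewrite DtE; exact: lt0.
have bt z : `|test_time z| <= stst (fun k (x : GX Nt) => Mt) z by rewrite DtE; exact: bt'.
have {c}dt_dom : forall p (z : Z), (Nt <= p)%N -> `|dt p z| <= stst (fun k (x : GX Nt) => Mt) z.
  exact: d.
clear DtE mt' lt0 bt' d.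
pose dv p := stst (fun k (x : GX p) => te (k.+1%:R * tau p) (gpos R x)).
have [Mv [Nv [d c]]] := sampled_value T0 A0 lt.
have [mv lv0 bv] := stst_limit T0 A0 d c.
rewrite -/test_value in mv.
have lv z : (fun p => dv p z) @ \oo --> test_value z by exact: lv0.
have {c}dv_dom : forall p (z : Z), (Nv <= p)%N -> `|dv p z| <= stst (fun k (x : GX Nv) => Mv) z.
  exact: d.
clear lv0 d.
have isp i : PP.-integrable setT (EFin \o (fun z => test_space i z ^+ 2)).
  have [M [N [_ m1 _ b1]]] := dsP i.
  apply: le_integrable (stst_sqr_integrable su (fun k (x : GX N) => M)) => //.
    by apply/measurable_EFinP; exact: measurable_funX.
  move=> z _; rewrite /= lee_fin !normrX; apply: lerXn2r; rewrite ?nnegrE//.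
  by apply: le_trans (b1 _) (ler_norm _).
split=> //.
- by move=> i; have [M [N []]] := dsP i.
- move=> i; have [M [N [_ _ _ b1]]] := dsP i; exists `|M| => z.
  by apply: le_trans (b1 z) _; exact: stst_cst_le.
- split=> //; exists (`|Mv| + `|Mt|) => z; split.
    by rewrite /test_value; apply: le_trans (bv z) _; apply: le_trans (stst_cst_le _ _ _ _ _) _; rewrite lerDl.
  by apply: le_trans (bt z) _; apply: le_trans (stst_cst_le _ _ _ _ _) _; rewrite lerDr.
(* the three limits on the right-hand side *)
pose rt p k : R := chi * (M0 - w p * \sum_x U p k x).
pose src p := stst (fun k (x : GX p) => rt p k * te (k.+1%:R * tau p) (gpos R x)).
have rt_bound p k : `|rt p k| <= chi * M0.
  have h := U_mass su p k; have chi0 := su_chi su.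
  have h0 : 0 <= w p * \sum_x U p k x.
    rewrite mulr_ge0 ?(ltW (w_gt0 _ _ _))//; apply: sumr_ge0 => x _.
    by have /andP[] := U_B su k x.
  rewrite normrM (gtr0_norm chi0) ler_pM2l// ger0_norm ?subr_ge0//.
  by rewrite lerBlDr lerDl.
have lim2 : (\int[PP]_z (psi (f k z) * src (s k) z)) @[k --> \oo] -->
    \int[PP]_z (psi (u z) * (chi * (M0 - mass z.1) * test_value z)).
  have psi0 : psi 0 = 0.
    by rewrite /psi powR0// gt_eqF// (lt_le_trans ltr01 (su_alpha su)).
  have mpsi : measurable_fun setT psi by exact: measurable_powR.
  have L0 : 0 <= (Num.truncn alpha).+1%:R * B `^ (alpha - 1) by rewrite mulr_ge0 ?powR_ge0.
  have pl := pow_lip (B := B) (su_alpha su).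
  apply: (@L1_pairing_cvg _ _ _ PP (fun k z => psi (f k z)) (fun z => psi (u z))
    (fun k z => src (s k) z) _ (chi * M0 * `|Mv|) Nv).
  - move=> k; apply: (lip_integrable psi0 mpsi (ltW B0) L0 pl) => // z.
    exact: (density_bounds su).
  - exact: (lip_integrable psi0 mpsi (ltW B0) L0 pl).
  - apply: (lip_L1_cvg psi0 mpsi (ltW B0) L0 pl) => //; last exact: density_L1.
    by move=> k z; exact: (density_bounds su).
  - by move=> k; exact: measurable_stst.
  - apply: measurable_funM => //; apply: measurable_funM => //; apply: measurable_funB => //.
    exact: (measurableT_comp measurable_mass measurable_fst).
  - move=> k z Nk; have h := dv_dom (s k) z (leq_trans Nk (sk k)).
    apply: (@le_trans _ _ (chi * M0 * `|dv (s k) z|)).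
      rewrite /src /dv /stst /spst; case: ifP => _; last by rewrite normr0 mulr0.
      case: ifP => _; last by rewrite normr0 mulr0.
      by rewrite normrM ler_wpM2r.
    have cM : 0 <= chi * M0 by rewrite mulr_ge0 ?ltW ?(su_chi su) ?(su_M0 su).
    apply: ler_wpM2l => //; apply: le_trans h _; exact: stst_cst_le.
  (* The nonlocal factor depends on the mass of the slice, whose convergence is known for almost
     every [t]. *)
  have gs := ae_good_slice su sk mu' fu.
  apply: filterS (ae_fst mu gs) => z gz.
  have [zt|zt] := boolP (intime T z.1); last first.
    rewrite /test_value (negbTE zt) mulr0 (_ : (fun k => _) = fun=> 0); first exact: cvg_cst.
    by apply/funext => k; rewrite /src stst_out.
  have E k : src (s k) z = rt (s k) (tcell T A (s k) z.1) * dv (s k) z.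
    by rewrite /src /dv /stst zt /spst; case: ifP => _; rewrite ?mulr0.
  rewrite (funext E); apply: cvgM; last exact: cvg_comp s_oo (lv z).
  apply: cvgMr; apply: cvgB; first exact: cvg_cst.
  by apply: mass_cvg; exact: gz.
have lim3 : (\int[PP]_z (f k z * dt (s k) z)) @[k --> \oo] --> \int[PP]_z (u z * test_time z).
  apply: (@L1_pairing_cvg _ _ _ PP f u (fun k z => dt (s k) z) _ `|Mt| Nt) => //.
  - exact: density_L1.
  - by move=> k; exact: measurable_stst.
  - move=> k z Nk; apply: le_trans (dt_dom _ z (leq_trans Nk (sk k))) _.
    exact: stst_cst_le.
  by apply: aeW => z; exact: cvg_comp s_oo (lt' z).
have lim4 : (\int[mu]_y (u0 y * spst (fun x : GX (s k) => te 0 (gpos R x)) y)) @[k --> \oo] -->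
    \int[mu]_y (u0 y * te 0 y).
  have [Mi [Ni [d c]]] := sampled_initial T0 A0 lt.
  have t2 : intime T (T / 2).
    by apply/andP; split; [rewrite divr_gt0|rewrite ltr_pdivrMr// ltr_pMr// ltr1n].
  have E p y : stst (fun k (x : GX p) => te 0 (gpos R x)) (T / 2, y) =
    spst (fun x : GX p => te 0 (gpos R x)) y by rewrite stst_slice.
  have c' y : (fun p => spst (fun x : GX p => te 0 (gpos R x)) y) @ \oo --> te 0 y.
    by rewrite -(funext (E ^~ y)); exact: (c (T / 2, y) t2).
  apply: (@L1_pairing_cvg _ _ _ mu (fun=> u0) u0
    (fun k => spst (fun x : GX (s k) => te 0 (gpos R x))) (te 0) `|Mi| Ni) => //.
  - by move=> _; exact: (u0_integrable su).
  - exact: (u0_integrable su).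
  - rewrite (_ : (fun k => _) = fun=> 0); first exact: cvg_cst.
    apply/funext => k; under eq_Rintegral do rewrite subrr normr0.
    by rewrite Rintegral_cst// mul0r.
  - by move=> k; exact: measurable_spst.
  - rewrite (_ : te 0 = fun y => limval (fun p => spst (fun x : GX p => te 0 (gpos R x)) y)).
      apply: (measurable_limval (f := fun p => spst (fun x : GX p => te 0 (gpos R x)))).
      by move=> p; exact: measurable_spst.
    by apply/funext => y; rewrite (limvalE (c' y)).
  - move=> k y Nk; rewrite -E; apply: le_trans (d _ _ (leq_trans Nk (sk k))) _.
    exact: stst_cst_le.
  by apply: aeW => y; exact: cvg_comp s_oo (c' y).
(* the error in the gradient term *)
have err0 : (\sum_i \int[PP]_z (grads k i z * (test_space i z - ds i (s k) z))) @[k --> \oo] --> 0.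
  rewrite [X in _ --> X](_ : 0 = \sum_(i < n) (0 : R)); last by rewrite big1.
  apply: cvg_finsum => i; have [M [N [d1 m1 l1 b1]]] := dsP i.
  have mds k : measurable_fun setT (fun z => test_space i z - ds i (s k) z).
    by apply: measurable_funB => //; exact: measurable_stst.
  apply: (@sqr_pairing_cvg0 _ _ _ PP (fun k => grads k i)
    (fun k z => test_space i z - ds i (s k) z) (CE m alpha chi M0 T B)) => //.
  - by move=> k; exact: measurable_stst.
  - by move=> k; exact: (stst_sqr_integrable su).
  - move=> k; have h := integrable_sqr_lin 1 (-1) m1 (measurable_stst T0 A0 _) (isp i)
      (stst_sqr_integrable su (fun k' (x : GX (s k)) => (te (k'.+1%:R * tau (s k)) (gpos R (x + unitv _ i))
          - te (k'.+1%:R * tau (s k)) (gpos R x)) / eps (s k))).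
    by apply: eq_integrable h => // z _ /=; rewrite mul1r mulN1r.
  - move=> k; apply: le_trans (grad_energy su (s k)); rewrite (bigD1 i)//= lerDl.
    by apply: sumr_ge0 => j _; apply: Rintegral_ge0 => z _; exact: sqr_ge0.
  have := @L2_dominated _ _ _ PP (fun k => ds i (s k)) (test_space i)
    (stst (fun k (x : GX N) => M)) N.
  rewrite (_ : (fun k => \int[PP]_z ((ds i (s k) z - test_space i z) ^+ 2)) =
     (fun k => \int[PP]_z ((test_space i z - ds i (s k) z) ^+ 2))); last first.
    by apply/funext => k; apply: eq_Rintegral => z _; rewrite -sqrrN opprB.
  apply=> //.
  - by move=> k; exact: measurable_stst.
  - by move=> k z Nk; apply: d1; exact: leq_trans Nk (sk k).
  - by move=> z; exact: cvg_comp s_oo (l1 z).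
  exact: (stst_sqr_integrable su).
have ident k : \sum_i \int[PP]_z (grads k i z * test_space i z) =
    \int[PP]_z (psi (f k z) * src (s k) z) + \int[PP]_z (f k z * dt (s k) z)
    + \int[mu]_y (u0 y * spst (fun x : GX (s k) => te 0 (gpos R x)) y)
    + \sum_i \int[PP]_z (grads k i z * (test_space i z - ds i (s k) z)).
  set p := s k.
  have split1 i : \int[PP]_z (grads k i z * test_space i z) =
      \int[PP]_z (grads k i z * ds i p z) +
      \int[PP]_z (grads k i z * (test_space i z - ds i p z)).
    have [M [N [_ m1 _ _]]] := dsP i.
    have mg : measurable_fun setT (grads k i) by exact: measurable_stst.
    have ig : PP.-integrable setT (EFin \o (fun z => grads k i z ^+ 2)) by exact: (stst_sqr_integrable su).
    have mds : measurable_fun setT (ds i p) by exact: measurable_stst.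
    have ids : PP.-integrable setT (EFin \o (fun z => ds i p z ^+ 2)) by exact: (stst_sqr_integrable su).
    have i1 := integrable_sqr_mul mg mds ig ids.
    have i2 := integrable_sqr_mul mg m1 ig (isp i).
    rewrite (_ : \int[PP]_z (grads k i z * (test_space i z - ds i p z)) =
       \int[PP]_z (grads k i z * test_space i z) - \int[PP]_z (grads k i z * ds i p z)).
      by rewrite addrC subrK.
    by rewrite -RintegralB//; apply: eq_Rintegral => z _; rewrite mulrBr.
  under eq_bigr do rewrite split1.
  rewrite big_split/=; congr (_ + _).
  have DW := @discrete_weak R _ n (@unitv (gsize p) n) phi psi (kap T A) (tau p) chi M0 (w p)
    (U p) (US m alpha chi M0 T A u0 p) (fun k x => te (k%:R * tau p) (gpos R x)) (K p).
  (* The last grid time is exactly [T], where the test function vanishes. *)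
  have fin0 : w p * (\sum_x U p (K p) x * te ((K p)%:R * tau p) (gpos R x)) = 0.
    by rewrite nsteps_tau// big1 ?mulr0// => x _; rewrite teT mulr0.
  rewrite fin0 subr0 in DW.
  have [_ IP] := init_pairing su (fun x : GX p => te 0 (gpos R x)).
  have {}IP : w p * (\sum_x U p 0%N x * te 0 (gpos R x)) =
    \int[mu]_y (u0 y * spst (fun x : GX p => te 0 (gpos R x)) y) by exact: IP.
  rewrite -IP; rewrite mul0r in DW; rewrite -DW !sumrB.
  have e0 := eps_gt0 R p; have tp := tau_gt0 T0 A0 p.
  have -> : \int[PP]_z (psi (f k z) * src p z) = \sum_(j < K p) tau p * (rate chi M0 (w p) (U p j) *
      (w p * \sum_x psi (U p j x) * te (j.+1%:R * tau p) (gpos R x))).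
    have psi0 : psi 0 = 0.
      by rewrite /psi powR0// gt_eqF// (lt_le_trans ltr01 (su_alpha su)).
    under eq_Rintegral do rewrite -(stst_map T A (h := psi) _ _ psi0).
    rewrite stst_pairing !mulr_sumr; apply: eq_bigr => j _; rewrite !mulr_sumr.
    by apply: eq_bigr => x _; rewrite /rt /rate; ring.
  have -> : \int[PP]_z (f k z * dt p z) = \sum_(j < K p) w p * (\sum_x U p j x *
      (te (j.+1%:R * tau p) (gpos R x) - te (j%:R * tau p) (gpos R x))).
    rewrite stst_pairing !mulr_sumr; apply: eq_bigr => j _; rewrite !mulr_sumr.
    apply: eq_bigr => x _; move: (te _ _) (te _ _) (U p j x) => a b c.
    by field; rewrite gt_eqF.
  have -> : \sum_i \int[PP]_z (grads k i z * ds i p z) = \sum_(j < K p) kap T A * (w p *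
      dform (@unitv (gsize p) n) (phi \o U p j) (fun x => te (j.+1%:R * tau p) (gpos R x))).
    under eq_bigr do rewrite stst_pairing !mulr_sumr.
    rewrite exchange_big/=; apply: eq_bigr => j _.
    rewrite /dform !mulr_sumr; apply: eq_bigr => i _; rewrite !mulr_sumr.
    apply: eq_bigr => x _; rewrite /grad tau_kap /dif /=.
    rewrite -?/p; set v1 := phi _; set v2 := phi _; set t1 := te _ _; set t2 := te _ _.
    by clearbody v1 v2 t1 t2; field; rewrite gt_eqF.
  move: (\sum_(j < K p) _) (\sum_(j < K p) _) (\sum_(j < K p) _) => a b c.
  by ring.
rewrite (funext ident) -[X in _ --> X]addr0; apply: cvgD => //.
by rewrite /weak_rhs; apply: cvgD => //; exact: cvgD.
Qed.

End weak_limit.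

(** * Norms and integrals in time *)

Section integral_tools.
Context d (T : measurableType d) (R : realType) (mu : {measure set T -> \bar R}).

Lemma Lfun2_intro (f : T -> R) : measurable_fun setT f ->
  mu.-integrable setT (EFin \o (fun z => f z ^+ 2)) -> f \in Lfun mu 2%:E.
Proof.
move=> mf /integrableP[_ fi]; rewrite inE; apply/andP; split; rewrite inE//=.
rewrite /finite_norm unlock; apply: poweR_lty; apply: le_lt_trans fi.
rewrite le_eqVlt; apply/orP; left; apply/eqP; apply: eq_integral => z _.
by rewrite /= powR_mulrn// -normrX.
Qed.

Lemma Rintegral_finsum (I : finType) (F : I -> T -> R) :
  (forall i, mu.-integrable setT (EFin \o F i)) ->
  mu.-integrable setT (EFin \o (fun z => \sum_i F i z)) /\
  \int[mu]_z (\sum_i F i z) = \sum_i \int[mu]_z F i z.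
Proof.
move=> iF.
have E : EFin \o (fun z => \sum_i F i z) = (fun z => (\sum_i (EFin \o F i) z)%E).
  by apply/funext => z /=; rewrite sumEFin.
split; first by rewrite E; exact: integrable_sum.
rewrite /Rintegral -[X in fine (integral _ _ X)]/(EFin \o _) E integral_sum//.
by rewrite -sum_fine// => i _; exact: integrable_fin_num.
Qed.

Lemma Lnorm1_le (f : T -> R) (c : R) : (forall z, 0 <= f z) ->
  mu.-integrable setT (EFin \o f) -> \int[mu]_z f z <= c -> ('N[mu]_1 [EFin \o f] <= c%:E)%E.
Proof.
move=> f0 fi fc; rewrite Lnorm1; under eq_integral do rewrite /= ger0_norm//.
exact: integral_le_EFin.
Qed.

Lemma Lnormoo_le (f : T -> R) (c : R) : (forall z, 0 <= f z <= c) -> 0 <= c ->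
  ('N[mu]_+oo [EFin \o f] <= c%:E)%E.
Proof.
move=> fc c0; rewrite unlock; case: ifPn => _; last by rewrite lee_fin.
apply/ess_supP; apply: aeW => z /=; have /andP[h1 h2] := fc z.
by rewrite lee_fin ger0_norm.
Qed.

End integral_tools.

Section time_integrals.
Context (R : realType) (n : nat) (T : R).
Local Notation Rn := 'rV[R]_n.
Local Notation mu := (lebesgue_rV R n).
Local Notation Z := (measurableTypeR R * Rn)%type.
Local Notation PP := (lebesgue_measure \x mu)%E.

Lemma timeP t : time T%:E t <-> intime T t.
Proof.
rewrite /time /intime /=; split.
  by case=> h1; rewrite lte_fin => h2; rewrite h1.
by case/andP=> h1 h2; split=> //; rewrite ?lte_fin.
Qed.

Lemma measurable_time : measurable (time T%:E : set (measurableTypeR R)).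
Proof.
rewrite (_ : time T%:E = `]0, T[%classic); first exact: measurable_itv.
apply/seteqP; split => t /=; rewrite in_itv/=.
  by case=> h1; rewrite lte_fin => h2; rewrite h1.
by case/andP=> h1 h2; split=> //; rewrite ?lte_fin.
Qed.

Lemma time_fubini (X : Z -> R) (F : R -> R) : PP.-integrable setT (EFin \o X) ->
  (forall z, ~~ intime T z.1 -> X z = 0) ->
  (forall t, intime T t -> F t = \int[mu]_y X (t, y)) ->
  \int[lebesgue_measure]_(t in time T%:E) F t = \int[PP]_z X z.
Proof.
move=> iX X0 FX; rewrite -Rfubini// Rintegral_mkcond; apply: eq_Rintegral => t _.
rewrite patchE; case: ifPn => [/set_mem/timeP/FX//|/negP nt].
have zt : ~~ intime T t by apply: contra_notN nt => /timeP/mem_set.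
rewrite (@eq_Rintegral _ _ _ mu _ (fun=> 0)); first by rewrite Rintegral_cst// mul0r.
by move=> y _; exact: X0.
Qed.

End time_integrals.

(** * Existence for a datum bounded at every point *)

Section existence.
Context (R : realType) (n : nat) (m alpha chi M0 T B s0 : R) (A : nat)
  (u0 : 'rV[R]_n -> R).
Hypothesis su : setup m alpha chi M0 T B s0 A u0.
Local Notation Rn := 'rV[R]_n.
Local Notation mu := (lebesgue_rV R n).
Local Notation Z := (measurableTypeR R * Rn)%type.
Local Notation PP := (lebesgue_measure \x mu)%E.
Local Notation phi := (@phi R m).
Local Notation psi := (@psi R alpha).

Let T0 := su_T su.
Let A0 := su_A su.
Let B0 := su_B su.

Lemma exists_weak_solution : exists u : R -> Rn -> R,
  weak_solution m alpha chi M0 u0 T%:E u /\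
  forall t, [/\ forall y, 0 <= u t y <= B, mu.-integrable setT (EFin \o u t) &
    \int[mu]_y u t y <= M0].
Proof.
have [s [u [sk [mu' ui] ubo us fu]]] := density_limit su.
have ub z : 0 <= u z <= B by have [] := ubo z.
have uout z : ~~ intime T z.1 -> u z = 0 by have [_] := ubo z; apply.
have usi t := (us t).1; have usM t := (us t).2.
pose S : nat -> 'I_n -> Z -> R^o := @grads R n m alpha chi M0 T A u0 s.
have mS j i : measurable_fun setT (S j i) by exact: measurable_stst.
have iS j i : PP.-integrable setT (EFin \o (fun z => S j i z ^+ 2)).
  exact: (stst_sqr_integrable su).
have [H [G [hH mG iG HG HG0]]] := mazur_L2 mS iS (fun j => grad_energy su (s j)).
have hH0 k : mid_hull S 0 (H k) by exact: mid_hullW (leq0n k) (hH k).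
have hull_out a : mid_hull S 0 a -> forall i z, ~~ intime T z.1 -> a i z = 0.
  elim=> [j _ i z zt|x y _ Hx _ Hy i z zt]; first exact: stst_out.
  by rewrite -[LHS]/(2^-1 * (x i z + y i z)) Hx// Hy// addr0 mulr0.
have Gout i z : ~~ intime T z.1 -> G i z = 0.
  by move=> zt; apply: HG0 => k; exact: hull_out.
have hull_sq a : mid_hull S 0 a -> forall i, measurable_fun setT (a i) /\
    PP.-integrable setT (EFin \o (fun z => a i z ^+ 2)).
  by move=> ha i; exact: (mid_hull_sqr mS iS ha i).
have hull_slice a : mid_hull S 0 a -> forall i t, mu.-integrable setT (EFin \o (fun y => a i (t, y))).
  elim=> [j _ i t|x y _ Hx _ Hy i t]; first exact: stst_slice_integrable.
  have := integrableZl measurableT 2^-1 (integrableD measurableT (Hx i t) (Hy i t)).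
  by apply: eq_integrable.
have mHG i k : measurable_fun setT (fun z => (H k i z - G i z) ^+ 2).
  by apply: measurable_funX; apply: measurable_funB => //; have [] := hull_sq _ (hH0 k) i.
have iHG i k : PP.-integrable setT (EFin \o (fun z => (H k i z - G i z) ^+ 2)).
  by have [] := ge0_integrable (mHG i k) (fun z => sqr_ge0 _) (HG i k).
have mslice (X : Z -> R) t : measurable_fun setT X -> measurable_fun setT (fun y : Rn => X (t, y)).
  exact: measurable_slice.
(* almost every time slice *)
pose nice t := [/\ good_slice m alpha chi M0 T A u0 s u t,
  forall i, mu.-integrable setT (EFin \o (fun y => G i (t, y) ^+ 2)),
  forall i k, mu.-integrable setT (EFin \o (fun y => (H k i (t, y) - G i (t, y)) ^+ 2)) &
  forall i, (\int[mu]_y ((H k i (t, y) - G i (t, y)) ^+ 2)) @[k --> \oo] --> 0].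
have ae_nice : \forall t \ae lebesgue_measure, intime T t -> nice t.
  have HG1 i k : (\int[PP]_z ((H k i z - G i z) ^+ 2)%:E <= (1 * 2^-1 ^+ k)%:E)%E by rewrite mul1r.
  have sl i := slice_ae_cvg0 ltr01 (mHG i) (fun k z => sqr_ge0 _) (HG1 i).
  have a1 : \forall t \ae lebesgue_measure, forall i : 'I_n,
      mu.-integrable setT (EFin \o (fun y => G i (t, y) ^+ 2)).
    by apply: filter_forall => i; exact: slice_integrable (iG i).
  have a2 : \forall t \ae lebesgue_measure, forall i k,
      mu.-integrable setT (EFin \o (fun y => (H k i (t, y) - G i (t, y)) ^+ 2)).
    by apply: filter_forall => i; have [] := sl i.
  have a3 : \forall t \ae lebesgue_measure, forall i : 'I_n,
      (\int[mu]_y ((H k i (t, y) - G i (t, y)) ^+ 2)) @[k --> \oo] --> 0.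
    by apply: filter_forall => i; have [] := sl i.
  apply: filterS2 (filterI a1 (filterI a2 a3)) (ae_good_slice su sk mu' fu).
  by move=> t [h1 [h2 h3]] h4 /h4 g; split.
(* The integrals against [H k] have two limits: one inherited from the sequence [S] through
   [mid_hull_lim], the other from the strong convergence of [H] to [G] on the slice. *)
have slice_grad t : nice t -> forall ps i, smooth_test ps ->
    \int[mu]_y (G i (t, y) * ps y) = - \int[mu]_y (phi (u (t, y)) * partial i ps y).
  case=> gt Gi HGi HG1 ps i sm.
  have [mps [M bps] ips lim] := slice_gradient su sk ub usi i gt sm.
  have ia a : mid_hull S 0 a -> mu.-integrable setT (EFin \o (fun y => a i (t, y) * ps y)).
    by move=> ha; exact: (integrable_mul_bounded (hull_slice a ha i t) mps bps).
  have limH : (\int[mu]_y (H k i (t, y) * ps y)) @[k --> \oo] -->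
      - \int[mu]_y (phi (u (t, y)) * partial i ps y).
    apply: (mid_hull_lim (l := fun a => \int[mu]_y (a i (t, y) * ps y)) _ lim hH).
    move=> a b ha hb; rewrite -RintegralD//; [|exact: ia|exact: ia].
    rewrite -RintegralZl//; last first.
      have := integrableD measurableT (ia a ha) (ia b hb).
      by apply: eq_integrable.
    apply: eq_Rintegral => y _.
    rewrite -[(2^-1 *: (a + b)) i (t, y)]/(2^-1 * (a i (t, y) + b i (t, y))).
    by rewrite -mulrA mulrDl.
  have mGt : measurable_fun setT (fun y => G i (t, y)) by exact: mslice.
  have mHt k : measurable_fun setT (fun y => H k i (t, y)).
    by apply: mslice; have [] := hull_sq _ (hH0 k) i.
  have iGp := integrable_sqr_mul mGt mps (Gi i) ips.
  have lim0 : (\int[mu]_y (ps y * (H k i (t, y) - G i (t, y)))) @[k --> \oo] --> 0.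
    apply: (@sqr_pairing_cvg0 _ _ _ mu (fun=> ps) (fun k y => H k i (t, y) - G i (t, y))
      (\int[mu]_y (ps y ^+ 2))) => //.
      by move=> k; exact: measurable_funB.
    exact: HGi.
  have limG : (\int[mu]_y (H k i (t, y) * ps y)) @[k --> \oo] --> \int[mu]_y (G i (t, y) * ps y).
    rewrite (_ : (fun k => _) = fun k => \int[mu]_y (ps y * (H k i (t, y) - G i (t, y))) +
        \int[mu]_y (G i (t, y) * ps y)).
      by rewrite -[X in _ --> X]add0r; exact: (cvgD lim0 (cvg_cst _)).
    apply/funext => k; rewrite (_ : \int[mu]_y (ps y * (H k i (t, y) - G i (t, y))) =
      \int[mu]_y (H k i (t, y) * ps y) - \int[mu]_y (G i (t, y) * ps y)); first by rewrite subrK.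
    rewrite -RintegralB//; last exact: ia.
    by apply: eq_Rintegral => y _; rewrite -mulrBl mulrC.
  exact: (cvg_unique (@norm_hausdorff _ R^o) limG limH).
(* the power of the limit *)
have phiz : phi 0 = 0 by exact: (phi0 su).
have Lp0 := ltW (Lp_gt0 su).
have mphi : measurable_fun setT phi by exact: measurable_powR.
have pl := pow_lip (B := B) (ltW (su_m su)).
have vi : PP.-integrable setT (EFin \o (fun z => phi (u z))).
  exact: (lip_integrable phiz mphi (ltW B0) Lp0 pl).
have mv : measurable_fun setT (fun z => phi (u z)) by exact: measurableT_comp mphi mu'.
have vb z : `|phi (u z)| <= B `^ m.
  have /andP[h1 h2] := ub z; rewrite ger0_norm ?powR_ge0//.
  by apply: ge0_ler_powR; rewrite ?nnegrE// ?(ltW B0)// ltW// (lt_trans ltr01 (su_m su)).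
have vi2 : PP.-integrable setT (EFin \o (fun z => phi (u z) ^+ 2)).
  exact: (integrable_mul_bounded vi mv vb).
have vs2 t : mu.-integrable setT (EFin \o (fun y => phi (u (t, y)) ^+ 2)).
  have h := slice_pow_integrable su ub usi t.
  exact: (integrable_mul_bounded h (mslice _ t mv) (fun y => vb (t, y))).
pose Gr (t : R) (y : Rn) : Rn := \row_i G i (t, y).
exists (fun t y => u (t, y)); split; last first.
  by move=> t; split=> //; move=> y; exact: ub.
split.
- by move=> t y _ _; have /andP[] := ub (t, y).
- split.
    apply: (measurable_funTS (f := fun z : Z => u (z.1, z.2))).
    by rewrite (_ : (fun z : Z => _) = u)//; apply/funext => -[].
  exists (M0 + B); apply: aeW => t _; have M00 := ltW (su_M0 su); split.
    apply: Lnorm1_le => //; first by move=> y; have /andP[] := ub (t, y).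
    by apply: le_trans (usM t) _; rewrite lerDl ltW.
  apply: Lnormoo_le; last by rewrite addr_ge0// ltW.
  move=> y; have /andP[-> h] := ub (t, y); apply: le_trans h _.
  by rewrite lerDr.
exists Gr; split; first split.
- apply: (measurable_funTS (f := fun z : Z => phi (u (z.1, z.2)))).
  by rewrite (_ : (fun z : Z => _) = (fun z => phi (u z)))//; apply/funext => -[].
- apply: (measurable_funTS (f := fun z : Z => Gr z.1 z.2)).
  apply: measurable_fun_rV => i; rewrite (_ : (fun z : Z => _) = G i)//.
  by apply/funext => -[t y]; rewrite mxE.
- have slice_H1 t : (intime T t -> nice t) -> time T%:E t -> H1 (fun y => phi (u (t, y))) (Gr t).
    move=> nt /timeP/nt nc; have [_ Gi _ _] := nc; split.
    + by apply: Lfun2_intro; [exact: mslice mv|exact: vs2].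
    + move=> i; rewrite (_ : (fun y => _) = (fun y => G i (t, y))).
        by apply: Lfun2_intro; [exact: mslice|exact: Gi].
      by apply/funext => y; rewrite mxE.
    move=> ps sm i; under [in RHS]eq_Rintegral do rewrite mxE.
    by rewrite (slice_grad t nc ps i sm) opprK.
  case: ae_nice => N [mN N0 sN]; exists N; split=> // t bad.
  by apply: sN => /= /slice_H1.
- pose Nf (z : Z) := phi (u z) ^+ 2 + \sum_i G i z ^+ 2.
  have iN : PP.-integrable setT (EFin \o Nf).
    have [iS2 _] := Rintegral_finsum iG.
    by have := integrableD measurableT vi2 iS2.
  have mN : measurable_fun setT (EFin \o Nf).
    by have /integrableP[] := iN.
  have N0 (z : Z) : (0 <= (EFin \o Nf) z)%E.
    rewrite /= lee_fin; apply: addr_ge0; first exact: sqr_ge0.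
    by apply: sumr_ge0 => i _; exact: sqr_ge0.
  have HE t : H1_norm2 (fun y => phi (u (t, y))) (Gr t) =
      (\int[mu]_y (EFin \o Nf) (t, y))%E.
    apply: eq_integral => y _; rewrite /=; congr (_ + _)%:E.
    by apply: eq_bigr => i _; rewrite mxE.
  have /integrableP[_] := iN; rewrite (eq_integral (EFin \o Nf)); last first.
    by move=> z _; rewrite gee0_abs.
  rewrite (fubini_tonelli1 _ mN N0); apply: le_lt_trans.
  apply: (@le_trans _ _ (\int[lebesgue_measure]_(t in time T%:E)
     \int[mu]_y (EFin \o Nf) (t, y))%E).
    by rewrite le_eqVlt; apply/orP; left; apply/eqP; apply: eq_integral => t _; exact: HE.
  apply: ge0_subset_integral => //.
  + exact: measurable_time.
  + exact: measurable_fun_fubini_tonelli_F.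
  by move=> t _; apply: integral_ge0 => y _; exact: N0.
move=> te te1.
have [m1 i1 b1 [m2 m3 [Mt bt]] lim] := gradient_pairing_limit su sk mu' ui ub usi fu te1.
pose ts := test_space T te; pose tt := test_time T te; pose tv := test_value T te.
have iGt i : PP.-integrable setT (EFin \o (fun z => G i z * ts i z)).
  exact: (integrable_sqr_mul (mG i) (m1 i) (iG i) (i1 i)).
have identity : \sum_i \int[PP]_z (G i z * ts i z) = weak_rhs alpha chi M0 T u0 u te.
  have ia a i : mid_hull S 0 a -> PP.-integrable setT (EFin \o (fun z => a i z * ts i z)).
    move=> ha; have [ma ja] := hull_sq a ha i.
    exact: (integrable_sqr_mul ma (m1 i) ja (i1 i)).
  have limH : (\sum_i \int[PP]_z (H k i z * ts i z)) @[k --> \oo] --> weak_rhs alpha chi M0 T u0 u te.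
    apply: (mid_hull_lim (l := fun a => \sum_i \int[PP]_z (a i z * ts i z)) _ lim hH).
    move=> a b ha hb; rewrite -big_split/= mulr_sumr; apply: eq_bigr => i _.
    rewrite -RintegralD//; [|exact: ia|exact: ia].
    rewrite -RintegralZl//; last first.
      by have := integrableD measurableT (ia a i ha) (ia b i hb); apply: eq_integrable.
    apply: eq_Rintegral => z _.
    rewrite -[(2^-1 *: (a + b)) i z]/(2^-1 * (a i z + b i z)).
    by rewrite -mulrA mulrDl.
  have limG : (\sum_i \int[PP]_z (H k i z * ts i z)) @[k --> \oo] --> \sum_i \int[PP]_z (G i z * ts i z).
    apply: (@cvg_finsum R _ (fun k i => \int[PP]_z (H k i z * ts i z))) => i.
    suff h : (\int[PP]_z (H k i z * ts i z)) @[k --> \oo] --> \int[PP]_z (G i z * ts i z) by exact: h.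
    have HGi : (\int[PP]_z ((H k i z - G i z) ^+ 2)) @[k --> \oo] --> 0.
      apply: (@squeeze_cvgr _ _ _ _ (fun=> 0) (fun k => 2^-1 ^+ k)).
      - apply: nearW => k; rewrite Rintegral_ge0/=; last by move=> z _; exact: sqr_ge0.
        by have [] := ge0_integrable (mHG i k) (fun z => sqr_ge0 _) (HG i k).
      - exact: cvg_cst.
      by apply: cvg_expr; rewrite ger0_norm ?invr_ge0// invf_lt1// ltr1n.
    have lim0 : (\int[PP]_z (ts i z * (H k i z - G i z))) @[k --> \oo] --> 0.
      apply: (@sqr_pairing_cvg0 _ _ _ PP (fun=> ts i) (fun k z => H k i z - G i z)
        (\int[PP]_z (ts i z ^+ 2))) => //.
      - by move=> k; apply: measurable_funB => //; have [] := hull_sq _ (hH0 k) i.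
      - by move=> _; exact: i1.
      - exact: iHG.
    rewrite (_ : (fun k => _) = fun k => \int[PP]_z (ts i z * (H k i z - G i z)) +
        \int[PP]_z (G i z * ts i z)).
      by rewrite -[X in _ --> X]add0r; exact: (cvgD lim0 (cvg_cst _)).
    apply/funext => k; rewrite (_ : \int[PP]_z (ts i z * (H k i z - G i z)) =
      \int[PP]_z (H k i z * ts i z) - \int[PP]_z (G i z * ts i z)); first by rewrite subrK.
    rewrite -RintegralB//; last exact: ia.
    by apply: eq_Rintegral => z _; rewrite -mulrBl mulrC.
  exact: (cvg_unique (@norm_hausdorff _ R^o) limG limH).
have tsz i t y : intime T t -> ts i (t, y) = partial i (te t) y.
  by move=> zt; rewrite /ts /test_space /= zt.
have -> : \int[lebesgue_measure]_(t in time T%:E)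
    (\int[mu]_y (\sum_i Gr t y 0 i * partial i (te t) y)) =
    \sum_i \int[PP]_z (G i z * ts i z).
  have [iX <-] := Rintegral_finsum iGt.
  apply: time_fubini => //.
    by move=> z zt; rewrite big1// => i _; rewrite Gout// mul0r.
  move=> t zt; apply: eq_Rintegral => y _; apply: eq_bigr => i _.
  by rewrite mxE tsz.
have psi0 : psi 0 = 0.
  by rewrite /psi powR0// gt_eqF// (lt_le_trans ltr01 (su_alpha su)).
have mpsi : measurable_fun setT psi by exact: measurable_powR.
have La0 : 0 <= (Num.truncn alpha).+1%:R * B `^ (alpha - 1) by rewrite mulr_ge0 ?powR_ge0.
have pla := pow_lip (B := B) (su_alpha su).
have ipsi : PP.-integrable setT (EFin \o (fun z => psi (u z))).
  exact: (lip_integrable psi0 mpsi (ltW B0) La0 pla).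
have mmass := measurable_mass mu' ub.
have mm : measurable_fun setT (fun z : Z => M0 - mass u z.1).
  by apply: measurable_funB => //; exact: (measurableT_comp mmass measurable_fst).
have mass01 t : 0 <= mass u t <= M0.
  by rewrite usM andbT; apply: Rintegral_ge0 => y _; have /andP[] := ub (t, y).
have Mt0 : 0 <= Mt by have [h _] := bt (0, 0); apply: le_trans h.
have iX2 : PP.-integrable setT (EFin \o (fun z => psi (u z) * ((M0 - mass u z.1) * tv z))).
  apply: (integrable_mul_bounded (M := M0 * Mt) ipsi); first exact: measurable_funM.
  move=> z; rewrite normrM; have [h1 _] := bt z; have /andP[h2 h3] := mass01 z.1.
  apply: ler_pM => //; rewrite ger0_norm ?subr_ge0//.
  by rewrite lerBlDr lerDl.
have -> : chi * \int[lebesgue_measure]_(t in time T%:E)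
    ((\int[mu]_y (u (t, y) `^ alpha * te t y)) * (M0 - \int[mu]_y u (t, y))) =
    \int[PP]_z (psi (u z) * (chi * (M0 - mass u z.1) * tv z)).
  have -> : \int[PP]_z (psi (u z) * (chi * (M0 - mass u z.1) * tv z)) =
      chi * \int[PP]_z (psi (u z) * ((M0 - mass u z.1) * tv z)).
    rewrite -RintegralZl//; apply: eq_Rintegral => z _.
    by rewrite -[chi * _ * tv z]mulrA mulrCA.
  congr (_ * _); apply: time_fubini => //.
    by move=> z zt; rewrite uout// psi0 mul0r.
  move=> t zt; rewrite mulrC -RintegralZl//.
    by apply: eq_Rintegral => y _; rewrite /tv /test_value /= zt mulrCA.
  have hp : mu.-integrable setT (EFin \o (fun y => psi (u (t, y)))).
    exact: (lip_integrable psi0 mpsi (ltW B0) La0 pla).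
  have mtv : measurable_fun setT (fun y => tv (t, y)) by exact: mslice.
  have h := integrable_mul_bounded hp mtv (fun y => (bt (t, y)).1).
  by apply: eq_integrable h => // y _; rewrite /= /tv /test_value /= zt.
have -> : \int[lebesgue_measure]_(t in time T%:E)
    (\int[mu]_y (u (t, y) * derive1 (te ^~ y) t)) = \int[PP]_z (u z * tt z).
  apply: time_fubini.
  - exact: (integrable_mul_bounded ui m3 (fun z => (bt z).2)).
  - by move=> z zt; rewrite uout// mul0r.
  by move=> t zt; apply: eq_Rintegral => y _; rewrite /tt /test_time /= zt.
by rewrite identity /weak_rhs -[X in X - _]addrA [X in X - _]addrC addrK addrC.
Qed.

End existence.

(** * Removal of the pointwise bounds on the initial datum *)

(** Pointwise, the power of finite exponent [r] is at most M^(r-1) times [f], so its integral is at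
    most M^r. *)
Lemma Lnorm_interpolation d (T : measurableType d) (R : realType)
    (mu : {measure set T -> \bar R}) (f : T -> R) (M : R) (k : \bar R) : 0 < M ->
  (forall z, 0 <= f z <= M) -> mu.-integrable setT (EFin \o f) -> \int[mu]_z f z <= M ->
  (1 <= k)%E -> ('N[mu]_k [EFin \o f] <= M%:E)%E.
Proof.
move=> M0 fM fi Mi; case: k => [r|_|//]; last by apply: Lnormoo_le; rewrite // ltW.
rewrite lee_fin => r1; rewrite unlock.
have r0 : 0 < r := lt_le_trans ltr01 r1.
have /integrableP[/measurable_EFinP mf _] := fi.
have key : (\int[mu]_z (`|(EFin \o f) z| `^ r) <= (M `^ r)%:E)%E.
  apply: (@le_trans _ _ (\int[mu]_z (M `^ (r - 1) * f z)%:E)%E).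
    apply: ge0_le_integral => //.
    - by move=> z _; exact: poweR_ge0.
    - apply/measurable_EFinP.
      apply: (@measurableT_comp _ _ _ _ _ _ (fun x : R => x `^ r)) => //.
      exact: measurableT_comp.
    - by apply/measurable_EFinP; exact: measurable_funM.
    move=> z _; have /andP[h1 h2] := fM z.
    by rewrite /= lee_fin ger0_norm//; exact: powR_le_lin.
  apply: integral_le_EFin; first exact: (integrableZl measurableT (M `^ (r - 1)) fi).
  rewrite RintegralZl// [leRHS](powR_split r1 (ltW M0)) mulrC.
  by apply: ler_wpM2r => //; exact: powR_ge0.
have -> : M%:E = ((M `^ r)%:E `^ r^-1)%E.
  by rewrite poweR_EFin -powRrM mulfV ?gt_eqF// powRr1// ltW.
apply: gt0_ler_poweR => //; first by rewrite invr_ge0 ltW.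
  by rewrite in_itv/= leey andbT; apply: integral_ge0 => z _; rewrite lee_fin powR_ge0.
by rewrite in_itv/= leey andbT lee_fin powR_ge0.
Qed.

(** [te 0] is a limit of spatial step functions. The single time step and the time [T / 2] are
    arbitrary choices, since the sampled values do not depend on time. *)
Lemma measurable_initial_test (R : realType) n (T : R) (te : R -> 'rV[R]_n -> R) : 0 < T ->
  C1_test T%:E te -> measurable_fun setT (te 0).
Proof.
move=> T0 te1; have [[r lt] _] := C1_lattice T0 te1.
have [Mi [Ni [_ c]]] := sampled_initial T0 (isT : (0 < 1)%N) lt.
have t2 : intime T (T / 2).
  by apply/andP; split; [rewrite divr_gt0|rewrite ltr_pdivrMr// ltr_pMr// ltr1n].
have E p y : stst T 1 (fun k (x : 'rV['I_(gsize p).+1]_n) => te 0 (gpos R x)) (T / 2, y) =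
    spst (fun x : 'rV['I_(gsize p).+1]_n => te 0 (gpos R x)) y by rewrite stst_slice.
have c' y : (fun p => spst (fun x : 'rV['I_(gsize p).+1]_n => te 0 (gpos R x)) y) @ \oo --> te 0 y.
  by rewrite -(funext (E ^~ y)); exact: (c (T / 2, y) t2).
rewrite (_ : te 0 = fun y => limval
    (fun p => spst (fun x : 'rV['I_(gsize p).+1]_n => te 0 (gpos R x)) y)).
  apply: (measurable_limval (f := fun p => spst (fun x : 'rV['I_(gsize p).+1]_n => te 0 (gpos R x)))).
  by move=> p; exact: measurable_spst.
by apply/funext => y; rewrite (limvalE (c' y)).
Qed.

Section truncation.
Context (R : realType) (n : nat) (b : R) (u0 : 'rV[R]_n -> R).
Local Notation mu := (lebesgue_rV R n).
Hypotheses (b0 : 0 <= b) (mu0 : measurable_fun setT u0)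
  (u0_ge0 : \forall x \ae mu, 0 <= u0 x) (u0_le : \forall x \ae mu, u0 x <= b).

(** The bounds on the datum hold almost everywhere, while the scheme asks for them everywhere; this
    modification changes no integral. *)
Definition truncate x := Num.max 0 (Num.min (u0 x) b).

Lemma truncate_bounds x : 0 <= truncate x <= b.
Proof. by rewrite /truncate le_max lexx/= ge_max b0/= ge_min lexx orbT. Qed.

Lemma ae_truncate : \forall x \ae mu, truncate x = u0 x.
Proof.
move: u0_le; apply: filterS2 u0_ge0 => x h1 h2.
by rewrite /truncate min_l// max_r.
Qed.

Lemma measurable_truncate : measurable_fun setT truncate.
Proof. by apply: measurable_maxr => //; exact: measurable_minr. Qed.

Lemma integral_truncate (g : 'rV[R]_n -> R) : measurable_fun setT g ->
  \int[mu]_x (truncate x * g x) = \int[mu]_x (u0 x * g x).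
Proof.
move=> mg; rewrite /Rintegral; congr fine; apply: ae_eq_integral => //.
- by apply/measurable_EFinP; apply: measurable_funM => //; exact: measurable_truncate.
- by apply/measurable_EFinP; exact: measurable_funM.
by apply: filterS ae_truncate => x -> _.
Qed.

Lemma measurable_sqeucl : measurable_fun setT (@sqeucl R n).
Proof.
apply: measurable_sum => i; apply: measurable_funX; exact: measurable_coord.
Qed.

Lemma truncate_moment : mu.-integrable setT (fun x => (u0 x * (1 + sqeucl x))%:E) ->
  mu.-integrable setT (fun x => (truncate x * (1 + sqeucl x))%:E).
Proof.
apply: le_integrable => //.
  apply/measurable_EFinP; apply: measurable_funM; first exact: measurable_truncate.
  by apply: measurable_funD => //; exact: measurable_sqeucl.
move=> x _; rewrite /= lee_fin !normrM ler_wpM2r//.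
have /andP[h1 h2] := truncate_bounds x; rewrite (ger0_norm h1) /truncate.
rewrite ge_max normr_ge0/=; apply: le_trans (ler_norm _).
by rewrite ge_min lexx.
Qed.

End truncation.

(** * Existence with a bound independent of the time horizon *)

Unset Implicit Arguments.
Set Strict Implicit.
Set Printing Implicit Defensive.

Theorem theorem1p2 (R : realType) :
  exists C : R -> R -> R -> R -> nat -> R -> R -> R -> R,
  forall (n : nat) (m alpha chi M0 : R) (u0 : 'rV[R]_n -> R),
  let mu := lebesgue_rV R n in
  let m0 := \int[mu]_x u0 x in
  (3 <= n)%N -> 1 < m -> 1 <= alpha -> alpha < m + 2 / n%:R ->
  0 < chi -> 0 < M0 ->
  (\forall x \ae mu, 0 <= u0 x) ->
  mu.-integrable setT (fun x => (u0 x * (1 + sqeucl x))%:E) ->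
  u0 \in Lfun mu +oo%E ->
  (exists g : 'rV[R]_n -> 'rV[R]_n,
     weak_gradient (fun x => u0 x `^ m) g /\ L2_vector g) ->
  m0 < M0 ->
  forall T : R, 0 < T ->
  exists u : R -> 'rV[R]_n -> R,
    weak_solution m alpha chi M0 u0 T%:E u /\
    forall k : \bar R, (1 <= k)%E ->
      (ereal_sup [set 'N[mu]_k [EFin \o u t] | t in time T%:E] <=
       (C (fine 'N[mu]_1 [EFin \o u0]) (fine 'N[mu]_+oo [EFin \o u0])
          m alpha n chi m0 M0)%:E)%E.
Proof.
(* The level is a function of the listed parameters alone, so it is fixed before the horizon; [lev]
   is 0 where no level exists. *)
pose level (b : R) (n : nat) (m alpha chi M0 : R) (B : R) := exists s0,
  [/\ 0 < B, b <= B / 4, 0 < s0 <= 1, 256 * M0 / B <= s0 ^+ n &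
    256 * n%:R * (chi * M0 * B `^ (alpha - 1) * B) * s0 ^+ 2 <=
      2^-1 ^+ n.+2 * (B / 4) `^ (m - 1) * B].
pose lev b n m alpha chi M0 : R :=
  if pselect (exists B, level b n m alpha chi M0 B) is left h then sval (cid h) else 0.
(* The sum dominates both the mass bound [M0] and the pointwise bound, so one constant serves all
   exponents between 1 and infinity. *)
exists (fun _ b m alpha n chi _ M0 => M0 + lev b n m alpha chi M0).
move=> n m alpha chi M0 u0 mu m0 n3 m1 a1 am chi0 M00 u0_ge0 u0_mom u0_oo _ m0M T T0.
set b := fine ('N[mu]_+oo [EFin \o u0]).
have n0 : (0 < n)%N by exact: leq_trans n3.
have [mu0 foo] : measurable_fun setT u0 /\ ('N[mu]_+oo [EFin \o u0] < +oo)%E.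
  by move: u0_oo; rewrite inE => /andP[]; rewrite !inE.
have bE : ('N[mu]_+oo [EFin \o u0] = b%:E)%E by rewrite fineK// ge0_fin_numE ?Lnorm_ge0.
have u0_le : \forall x \ae mu, u0 x <= b.
  (* The norm unfolds to an essential supremum only when the space has positive measure; in the
     other case every property holds almost everywhere. *)
  have [mu0'|mu0'] := ltP 0%E (mu setT); last first.
    exists setT; split=> //; apply/eqP; rewrite -measure_le0; exact: mu0'.
  have : (ess_sup mu (abse \o (EFin \o u0)) <= b%:E)%E by rewrite -bE unlock mu0'.
  move=> /ess_supP; apply: filterS => x /=; rewrite lee_fin.
  by apply: le_trans; exact: ler_norm.
have [s0 lv] : level b n m alpha chi M0 (lev b n m alpha chi M0).
  rewrite /lev; case: pselect => [h|[]]; first by case: cid.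
  by have [B [s0 h]] := exists_level b n0 (ltW m1) a1 am chi0 M00; exists B, s0.
move: lv; set B := lev _ _ _ _ _ _ => -[B0 bB s01 lev1 lev2].
(* One summand for the CFL condition, one for [su_small], doubled because the bound there is one
   half. [T] enters the choice of [A] and not that of [B]. *)
pose Q := 4 * n%:R * T * ((Num.truncn m).+1%:R * B `^ (m - 1))
  + 2 * (T * chi * M0 * B `^ (alpha - 1)).
have p1 : 0 <= 4 * n%:R * T * ((Num.truncn m).+1%:R * B `^ (m - 1)).
  by rewrite mulr_ge0 ?mulr_ge0 ?powR_ge0// ltW.
have p2 : 0 <= T * chi * M0 * B `^ (alpha - 1) by rewrite !mulr_ge0 ?powR_ge0// ltW.
pose A := (Num.truncn Q).+1.
have QA : Q <= A%:R by rewrite ltW// truncnS_gt.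
have A0 : 0 < A%:R :> R by rewrite ltr0n.
have B40 : 0 <= B / 4 by rewrite divr_ge0// ltW.
have u0_le4 : \forall x \ae mu, u0 x <= B / 4.
  by apply: filterS u0_le => x h; exact: le_trans bB.
pose v0 := truncate (B / 4) u0.
have su : setup m alpha chi M0 T B s0 A v0.
  split=> //.
  - rewrite (_ : _ * _ * _ = (4 * n%:R * T * ((Num.truncn m).+1%:R * B `^ (m - 1))) / A%:R).
      by rewrite ler_pdivrMr// mul1r; apply: le_trans QA; rewrite /Q lerDl mulr_ge0.
    by rewrite !mulrA [_ / A%:R * _]mulrAC [_ / A%:R * _]mulrAC.
  - rewrite (_ : _ * _ * _ * _ = (T * chi * M0 * B `^ (alpha - 1)) / A%:R).
      rewrite ler_pdivrMr// ler_pdivlMl//; apply: le_trans QA.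
      by rewrite /Q lerDr.
    by move: (B `^ _) => P; field; rewrite gt_eqF.
  - exact: measurable_truncate.
  - exact: truncate_bounds.
  - exact: truncate_moment.
  have := integral_truncate mu0 u0_ge0 u0_le4 (g := fun=> 1) (measurable_cst _).
  under eq_Rintegral do rewrite mulr1; move=> ->.
  by under eq_Rintegral do rewrite mulr1; exact: ltW.
have [u [[w1 w2 [G [w3 w4]]] ub]] := exists_weak_solution su.
exists u; split.
  split=> //; exists G; split=> // te te1.
  rewrite w4// integral_truncate//.
  exact: measurable_initial_test te1.
move=> k k1; apply: ge_ereal_sup => _ [t tT <-].
have [bt it mt] := ub t.
apply: Lnorm_interpolation => //; first by rewrite addr_gt0.
- by move=> y; have /andP[-> h] := bt y; apply: le_trans h _; rewrite lerDr ltW.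
by apply: le_trans mt _; rewrite lerDl ltW.
Qed.
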